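(* For every $p\ge1$ and $\gamma\ge0$ there exists a threshold $\kappa_0>0$ (with the dependencies described in the context) such that the following holds whenever $Pe>1$ and $\max\{Co,Co_{4/3}\}\le\kappa_0$. Let $T=N\tau$ and let $\{u_h^n\}_{n=0}^{N}\subset \mathring V_h$, with $u_h^0,u_h^1$ given, satisfy for $1\le n\le N-1$ $$(D_\tau u_h^{n+1},v_h)_\Omega+c_h(\tilde u_h^{n+1},v_h)+a(u_h^{n+1},v_h)=L^{n+1}(v_h)\qquad \forall v_h\in\mathring V_h .$$ Then $$\|u_h^{N}\|^2\le \Big(\|u_h^0\|^2+\|u_h^1\|^2+\|u_h^2\|^2+9\,\tau\sum_{n=1}^{N-1}\|L^{n+1}\|_h^2\Big)M,$$ where $$M=8\Big(1+\big(\tfrac{c_L}{4}+8\big)T\,e^{(\frac{c_L}{4}+8)T}\Big).$$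
   Context: Let $\Omega\subset\mathbb R^d$, $d\in\{1,2,3\}$, be an open polygonal domain with outward normal $n$, let $\mu>0$ be a constant, and let $\beta\in[H^1_0(\Omega)\cap W^{1,\infty}(\Omega)]^d$ with $\nabla\cdot\beta=0$ and $\beta\cdot n|_{\partial\Omega}=0$. Let $\{\mathcal T_h\}_h$ be a shape regular, quasi-uniform family of simplicial triangulations of $\Omega$ with mesh size $h$; $\mathcal F$ is the set of interior faces of $\mathcal T_h$ and $h_F$ the diameter of $F\in\mathcal F$. For an integer $p\ge1$, $V_h=\{v\in H^1(\Omega): v|_T\in\mathcal P_p(T)\ \forall T\in\mathcal T_h\}$ and $\mathring V_h=V_h\cap H^1_0(\Omega)$. Write $(u,v)_\Omega=\int_\Omega uv\,dx$, $\|v\|^2=(v,v)_\Omega$, $\|v\|_\infty=\sup_{x\in\overline\Omega}|v(x)|$. Forms: $c(w,v)=\int_\Omega (\beta\cdot\nabla w)\,v\,dx$, $a(w,v)=\int_\Omega\mu\nabla w\cdot\nabla v\,dx$, $$s(w,v)=\sum_{F\in\mathcal F}\int_F h_F^2(|\beta\cdot n|+\varepsilon_{\beta^\perp})[\![\nabla w]\!]\,[\![\nabla v]\!]\,ds,$$ where $n$ on $F$ is a unit normal to $F$, $\varepsilon_{\beta^\perp}\ge0$ is a fixed coefficient, and for $F=\bar T\cap\bar T'$ the gradient jump is $[\![\nabla w]\!]|_F(x)=\lim_{\epsilon\to0^+}\big(\nabla w(x-\epsilon n_T)\cdot n_T+\nabla w(x-\epsilon n_{T'})\cdot n_{T'}\big)$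 with $n_T,n_{T'}$ the outward unit normals of $T,T'$. Put $|v|_s=s(v,v)^{1/2}$ and $c_h(w,v)=c(w,v)+\gamma s(w,v)$ with stabilisation parameter $\gamma\ge0$. Define $$E(v)^2=\gamma|v|_s^2+\|\mu^{1/2}\nabla v\|^2 .$$ Time step $\tau>0$; $Co=(\|\beta\|_\infty+1)\tau/h$; $Co_{4/3}=\tau(\|\beta\|_\infty/h)^{4/3}$; $Pe=\|\beta\|_\infty h/\mu$. BDF2 operator: $D_\tau v^{n+1}=\frac{3v^{n+1}-4v^n+v^{n-1}}{2\tau}$; extrapolation: $\tilde v^{n+1}=2v^n-v^{n-1}$. $\{L^n\}$ is a sequence of bounded linear functionals on $\mathring V_h$, with $\|L\|_h=\sup_{0\ne v\in\mathring V_h}\frac{L(v)}{\sqrt{E(v)^2+\|v\|^2}}$. Set $c_L=0$ if $L^n\equiv0$ for every $n$, and $c_L=1$ otherwise. Constants: $\Omega,d,p,\varepsilon_{\beta^\perp}$ are regarded as fixed. The threshold $\kappa_0$ depends only on geometric constants of the mesh family (shape regularity, quasi-uniformity) and on $\gamma$. *)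

(* Defs.v *)
From HB Require Import structures.
From mathcomp Require Import all_boot all_order all_algebra.
From mathcomp Require Import all_classical all_reals all_analysis.

Set Implicit Arguments.
Unset Strict Implicit.
Unset Printing Implicit Defensive.

Import Order.TTheory GRing.Theory Num.Theory.
Import numFieldNormedType.Exports.

Local Open Scope classical_set_scope.
Local Open Scope ring_scope.

(* The Borel sigma-algebra of R^n, presented as the sigma-algebra generated by
   the coordinates (the library does the same for [n.-tuple T]). *)
Definition rV_display : measure_display.
Proof. exact. Qed.

Section rV_measurable.
Context {R : realType} {n : nat}.

Let coors : 'I_n -> 'rV[R]_n -> measurableTypeR R := fun i x => x ord0 i.

Let rV_set0 : g_sigma_preimage coors set0.
Proof. exact: sigma_algebra0. Qed.

Let rV_setC A : g_sigma_preimage coors A -> g_sigma_preimage coors (~` A).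
Proof. exact: sigma_algebraC. Qed.

Let rV_bigcup (F : _^nat) : (forall i, g_sigma_preimage coors (F i)) ->
  g_sigma_preimage coors (\bigcup_i (F i)).
Proof. exact: sigma_algebra_bigcup. Qed.

HB.instance Definition _ := @isMeasurable.Build rV_display
  'rV[R]_n (g_sigma_preimage coors) rV_set0 rV_setC rV_bigcup.

Lemma measurable_rV_coord (i : 'I_n) :
  measurable_fun [set: 'rV[R]_n] (fun x => x ord0 i : measurableTypeR R).
Proof.
move=> _ Y mY; rewrite setTI; apply: sub_sigma_algebra => /=.
rewrite -bigcup_seq/=; exists i => /=; first by rewrite mem_index_enum.
by exists Y => //; rewrite setTI.
Qed.

Lemma measurable_rVP d (T : measurableType d) (f : T -> 'rV[R]_n) :
  (forall i, measurable_fun [set: T] (fun x => f x ord0 i : measurableTypeR R)) ->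
  measurable_fun [set: T] f.
Proof.
move=> mf; have sub : preimage_set_system [set: T] f (g_sigma_preimage coors)
    `<=` measurable.
  rewrite -g_sigma_preimage_comp.
  apply: smallest_sub; first exact: sigma_algebra_measurable.
  move=> A; rewrite -bigcup_seq => -[i _ [B mB <-]].
  exact: mf.
by move=> _ A mA; apply: sub; exists A.
Qed.

End rV_measurable.

(* Lebesgue measure on R^n: unit mass for n = 0, and the product of the Lebesgue
   measure on R with that on R^n, carried to R^(n+1), otherwise. *)
Definition rV_cons {R : realType} {n : nat} (p : measurableTypeR R * 'rV[R]_n) :
  'rV[R]_n.+1 :=
  \row_i (if unlift ord0 i is Some j then p.2 ord0 j else p.1).

Lemma measurable_rV_cons {R : realType} {n : nat} :
  measurable_fun setT (@rV_cons R n).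
Proof.
apply: measurable_rVP => i; rewrite /rV_cons; under eq_fun do rewrite mxE.
case: unliftP => [j|] _; last exact: measurable_fst.
exact: (measurableT_comp (measurable_rV_coord j)).
Qed.

HB.instance Definition _ (R : realType) (n : nat) :=
  isMeasurableFun.Build _ _ _ _ (@rV_cons R n) measurable_rV_cons.

Section lebesgue_succ.
Context {R : realType} {n : nat}.
Variable m : {sigma_finite_measure set 'rV[R]_n -> \bar R}.

Definition leb_succ : set 'rV[R]_n.+1 -> \bar R :=
  pushforward (@lebesgue_measure R \x m)%E rV_cons.

Let leb_succ0 : leb_succ set0 = 0%E.
Proof. exact: measure0. Qed.

Let leb_succ_ge0 A : (0 <= leb_succ A)%E.
Proof. exact: measure_ge0. Qed.

Let leb_succ_sigma_additive : semi_sigma_additive leb_succ.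
Proof. exact: measure_semi_sigma_additive. Qed.

HB.instance Definition _ := isMeasure.Build _ _ _ leb_succ
  leb_succ0 leb_succ_ge0 leb_succ_sigma_additive.

Let leb_succ_sigma_finite : sigma_finite setT leb_succ.
Proof.
have /sigma_finiteP[F [TF ndF Foo]] := sigma_finiteT (@lebesgue_measure R).
have /sigma_finiteP[G [TG ndG Goo]] := sigma_finiteT m.
pose uncons (x : 'rV[R]_n.+1) : (measurableTypeR R * 'rV[R]_n)%type :=
  (x ord0 ord0, \row_j x ord0 (lift ord0 j)).
have consK : cancel rV_cons uncons.
  move=> [a v]; rewrite /uncons /rV_cons !mxE unlift_none; congr (_, _).
  by apply/rowP => j; rewrite !mxE liftK.
have muncons : measurable_fun setT uncons.
  apply: measurable_fun_pair; first exact: measurable_rV_coord.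
  apply: measurable_rVP => j; under eq_fun do rewrite mxE.
  exact: measurable_rV_coord.
exists (fun k => uncons @^-1` (F k `*` G k)).
  rewrite -preimage_bigcup (_ : \bigcup_k _ = setT) ?preimage_setT//.
  rewrite -setXTT TF TG predeqE => -[x y]; split.
    by move=> [n' _ []/= ? ?]; split; exists n'.
  move=> [/= [a _ Fax] [b _ Gby]]; exists (maxn a b) => //; split.
  - by move: x Fax; exact/subsetPset/ndF/leq_maxl.
  - by move: y Gby; exact/subsetPset/ndG/leq_maxr.
move=> k; have [mF Fk] := Foo k; have [mG Gk] := Goo k; split.
  by rewrite -[X in measurable X]setTI; apply: muncons => //; exact: measurableX.
rewrite /leb_succ /pushforward -comp_preimage.
rewrite (_ : uncons \o rV_cons = id) ?preimage_id; last first.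
  by apply/funext => x; exact: consK.
by rewrite product_measure1E// lte_mul_pinfty// ge0_fin_numE.
Qed.

HB.instance Definition _ := Measure_isSigmaFinite.Build _ _ _ leb_succ
  leb_succ_sigma_finite.

End lebesgue_succ.

Fixpoint leb {R : realType} (n : nat) :
    {sigma_finite_measure set 'rV[R]_n -> \bar R} :=
  match n with
  | 0 => \d_(0 : 'rV[R]_0)
  | n'.+1 => leb_succ (leb n')
  end.

Section euclidean.
Context {R : realType} {d : nat}.
Implicit Types (x y : 'rV[R]_d) (A : set 'rV[R]_d).

Definition dotv x y : R := \sum_i x ord0 i * y ord0 i.

(* The library norm [`|x|] on row vectors is the sup norm. *)
Definition enorm x : R := Num.sqrt (dotv x x).

Definition diam A : R := sup [set enorm (xy.1 - xy.2) | xy in A `*` A].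

Definition inball_diam A : R :=
  sup [set 2 * r | r in [set r | 0 <= r /\
    exists c, [set y | enorm (y - c) <= r] `<=` A]].

Definition outward_normal (Omega : set 'rV[R]_d) x (n : 'rV[R]_d) : Prop :=
  enorm n = 1 /\ exists2 r, 0 < r &
    forall y, enorm (y - x) < r -> (Omega y <-> dotv (y - x) n < 0).

End euclidean.

Section sobolev.
Context {R : realType} {d : nat}.
Variable Omega : set 'rV[R]_d.
Implicit Types (u v f : 'rV[R]_d -> R).

Definition pderive (i : 'I_d) f : 'rV[R]_d -> R :=
  fun x => 'D_(delta_mx ord0 i) f x.

Definition smooth f : Prop :=
  forall (s : seq 'I_d) x, differentiable (foldr pderive f s) x.

Definition test_function f : Prop :=
  [/\ smooth f, compact (closure [set x | f x != 0])
    & closure [set x | f x != 0] `<=` Omega].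

Definition loc_integrable f : Prop := measurable_fun Omega f /\
  forall K, K `<=` Omega -> compact K -> (leb d).-integrable K (EFin \o f).

Definition weak_pderivative (i : 'I_d) u g : Prop :=
  [/\ loc_integrable u, loc_integrable g & forall phi, test_function phi ->
    \int[leb d]_(x in Omega) (u x * pderive i phi x) =
    - \int[leb d]_(x in Omega) (g x * phi x)].

(* A representative of the weak partial derivative, which is unique up to null
   sets; 0 if there is none. *)
Definition wderive (i : 'I_d) u : 'rV[R]_d -> R :=
  xget (fun=> 0) [set g | weak_pderivative i u g].

Definition wgrad u (x : 'rV[R]_d) : 'rV[R]_d := \row_i wderive i u x.

Definition square_integrable f : Prop := measurable_fun Omega f /\
  (leb d).-integrable Omega (fun x => (f x ^+ 2)%:E).

Definition ess_bounded f : Prop := measurable_fun Omega f /\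
  exists M : R, {ae leb d, forall x, Omega x -> `|f x| <= M}.

Definition H1 u : Prop := square_integrable u /\
  forall i, exists2 g, square_integrable g & weak_pderivative i u g.

Definition W1oo u : Prop := ess_bounded u /\
  forall i, exists2 g, ess_bounded g & weak_pderivative i u g.

Definition ip u v : R := \int[leb d]_(x in Omega) (u x * v x).

Definition L2norm v : R := Num.sqrt (ip v v).

Definition H1norm u : R :=
  Num.sqrt (L2norm u ^+ 2 + \sum_i L2norm (wderive i u) ^+ 2).

Definition H10 u : Prop := H1 u /\
  forall e, 0 < e -> exists2 phi, test_function phi & H1norm (u \- phi) < e.

Definition sup_norm (beta : 'rV[R]_d -> 'rV[R]_d) : R :=
  sup [set enorm (beta x) | x in closure Omega].

(* [beta] is identified with its continuous representative on the closure of
   [Omega], to which the boundary condition and [sup_norm] refer. *)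
Definition admissible_velocity (beta : 'rV[R]_d -> 'rV[R]_d) : Prop :=
  [/\ {within closure Omega, continuous beta},
      forall i, H10 (fun x => beta x ord0 i) /\ W1oo (fun x => beta x ord0 i),
      {ae leb d, forall x, Omega x ->
        \sum_i wderive i (fun y => beta y ord0 i) x = 0}
    & forall x n, (closure Omega `\` Omega) x -> outward_normal Omega x n ->
        dotv (beta x) n = 0].

End sobolev.

(* A simplex is encoded by its set of vertices, given by their indices among the
   nodes of the mesh. *)
Record mesh (R : realType) (d : nat) := Mesh {
  num_nodes : nat;
  node : 'I_num_nodes -> 'rV[R]_d;
  cells : {set {set 'I_num_nodes}} }.

Section mesh.
Context {R : realType} {d : nat}.
Implicit Types (m : mesh R d) (Omega : set 'rV[R]_d).

Definition hull m (S : {set 'I_(num_nodes m)}) : set 'rV[R]_d :=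
  [set x | exists l : 'I_(num_nodes m) -> R,
    [/\ forall i, i \in S -> 0 <= l i, \sum_(i in S) l i = 1
      & x = \sum_(i in S) l i *: node i]].

Definition affinely_independent m (S : {set 'I_(num_nodes m)}) : Prop :=
  forall l : 'I_(num_nodes m) -> R,
    \sum_(i in S) l i = 0 -> \sum_(i in S) l i *: node i = 0 ->
    forall i, i \in S -> l i = 0.

Definition simplicial_cover Omega m : Prop :=
  (forall T, T \in cells m -> #|T| = d.+1 /\ affinely_independent T) /\
  closure Omega = \bigcup_(T in [set` cells m]) hull T.

Definition polygonal_domain Omega : Prop :=
  [/\ open Omega, connected Omega, Omega !=set0,
      interior (closure Omega) = Omega & exists m, simplicial_cover Omega m].

Definition triangulation Omega m : Prop := simplicial_cover Omega m /\
  forall T T', T \in cells m -> T' \in cells m ->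
    hull T `&` hull T' = hull (T :&: T').

Definition mesh_size m : R := \big[Num.max/0]_(T in cells m) diam (hull T).

Definition shape_regular (sigma : R) m : Prop := forall T, T \in cells m ->
  diam (hull T) <= sigma * inball_diam (hull T).

Definition quasi_uniform (q : R) m : Prop := forall T, T \in cells m ->
  mesh_size m <= q * diam (hull T).

Definition interior_faces m : {set {set 'I_(num_nodes m)}} :=
  [set F : {set 'I_(num_nodes m)} | (#|F| == d) && (#|[set T in cells m | F \subset T]| == 2)].

Definition unit_normal m (F : {set 'I_(num_nodes m)}) (n : 'rV[R]_d) : Prop :=
  enorm n = 1 /\
  forall i j, i \in F -> j \in F -> dotv (node i - node j) n = 0.

Definition face_normal m (F : {set 'I_(num_nodes m)}) : 'rV[R]_d :=
  xget 0 [set n | unit_normal F n].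

Definition cell_normal m (T F : {set 'I_(num_nodes m)}) : 'rV[R]_d :=
  xget 0 [set n | unit_normal F n /\
    forall i j, i \in F -> j \in T :\: F -> dotv (node j - node i) n < 0].

Definition ref_simplex n : set 'rV[R]_n :=
  [set t | (forall i, 0 <= t ord0 i) /\ \sum_i t ord0 i <= 1].

(* Surface integral over the face with vertices a_0, ..., a_(d-1), through its
   affine parametrisation t |-> a_0 + \sum_k t_k (a_(k+1) - a_0) by the reference
   simplex of R^(d-1); for d = 1, this is evaluation at a_0. *)
Definition face_integral m (F : {set 'I_(num_nodes m)})
    (f : 'rV[R]_d -> R) : R :=
  let a k := nth 0 [seq node i | i <- enum F] k in
  let J : 'M[R]_(d.-1, d) := \matrix_(k, j) (a k.+1 - a 0%N) ord0 j in
  Num.sqrt (\det (J *m J^T)) *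
  \int[leb d.-1]_(t in @ref_simplex d.-1) f (a 0%N + t *m J).

(* Real polynomial functions of d variables, of total degree at most p. *)
Definition polynomial (p : nat) (P : 'rV[R]_d -> R) : Prop :=
  exists c : {ffun 'I_d -> 'I_p.+1} -> R, forall x,
    P x = \sum_(a : {ffun 'I_d -> 'I_p.+1} | (\sum_i a i <= p)%N)
            c a * \prod_i x ord0 i ^+ a i.

(* Elements of V_h are represented by their continuous representative. *)
Definition Vh Omega m (p : nat) (v : 'rV[R]_d -> R) : Prop :=
  H1 Omega v /\ forall T, T \in cells m ->
    exists2 P, polynomial p P & forall x, hull T x -> v x = P x.

Definition Vh0 Omega m p v : Prop := Vh Omega m p v /\ H10 Omega v.

(* Gradients are polynomial in each cell, so that the traces below are limits of
   classical gradients at interior points of the two cells containing F. *)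
Definition grad_jump m (F : {set 'I_(num_nodes m)}) (w : 'rV[R]_d -> R)
    (x : 'rV[R]_d) : R :=
  lim ((\sum_(T in cells m | F \subset T)
     dotv (\row_i pderive i w (x - e *: cell_normal T F)) (cell_normal T F))
   @[e --> 0^'+]).

End mesh.

Section forms.
Context {R : realType} {d : nat}.
Variables (Omega : set 'rV[R]_d) (m : mesh R d) (p : nat).
Variables (mu gamma eps_perp : R) (beta : 'rV[R]_d -> 'rV[R]_d).
Implicit Types v w : 'rV[R]_d -> R.

Definition conv_form w v : R :=
  \int[leb d]_(x in Omega) (dotv (beta x) (wgrad Omega w x) * v x).

Definition diff_form w v : R :=
  \int[leb d]_(x in Omega) (mu * dotv (wgrad Omega w x) (wgrad Omega v x)).

Definition stab_form w v : R :=
  \sum_(F in interior_faces m) face_integral F (fun x =>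
    diam (hull F) ^+ 2 * (`|dotv (beta x) (face_normal F)| + eps_perp) *
    grad_jump F w x * grad_jump F v x).

Definition stab_seminorm v : R := Num.sqrt (stab_form v v).

Definition conv_form_h w v : R := conv_form w v + gamma * stab_form w v.

(* The square of E(v). *)
Definition energy_sq v : R := gamma * stab_seminorm v ^+ 2 +
  \int[leb d]_(x in Omega) enorm (Num.sqrt mu *: wgrad Omega v x) ^+ 2.

Definition bounded_linear (L : ('rV[R]_d -> R) -> R) : Prop :=
  (forall a v w, Vh0 Omega m p v -> Vh0 Omega m p w ->
     L (a \*o v \+ w) = a * L v + L w) /\
  exists C, forall v, Vh0 Omega m p v -> `|L v| <= C * H1norm Omega v.

Definition dual_norm (L : ('rV[R]_d -> R) -> R) : R :=
  sup [set L v / Num.sqrt (energy_sq v + L2norm Omega v ^+ 2) | v in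
    [set v | Vh0 Omega m p v /\ exists2 x, Omega x & v x != 0]].

End forms.

Section time_stepping.
Context {R : realType} {d : nat}.
Implicit Type u : nat -> 'rV[R]_d -> R.

(* The BDF2 quotient and the extrapolation at the time index n.+1, for n > 0. *)
Definition bdf2 (tau : R) u (n : nat) : 'rV[R]_d -> R :=
  fun x => (3 * u n.+1 x - 4 * u n x + u n.-1 x) / (2 * tau).

Definition extrapolation u (n : nat) : 'rV[R]_d -> R :=
  fun x => 2 * u n x - u n.-1 x.

End time_stepping.

Section parameters.
Context {R : realType}.
Implicit Types tau h mu b : R.

(* Here b stands for the sup norm of the velocity. *)
Definition Co tau h b : R := (b + 1) * tau / h.

Definition Co43 tau h b : R := tau * (b / h) `^ (4 / 3).

Definition Pe mu h b : R := b * h / mu.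

(* [S] is the space on which the functionals [L n] are considered. *)
Definition cL {V : Type} (S : V -> Prop) (L : nat -> V -> R) : R :=
  if `[< forall n v, S v -> L n v = 0 >] then 0 else 1.

Definition stability_factor (c T : R) : R :=
  8 * (1 + (c / 4 + 8) * T * expR ((c / 4 + 8) * T)).

End parameters.

(* Main.v *)
Require Import Defs.
From mathcomp Require Import all_boot all_order all_algebra.
From mathcomp Require Import all_classical all_reals all_analysis.
From mathcomp Require Import measurable_realfun perm.
From mathcomp Require Import ring lra.

(** The idea is to test each equation with the extrapolation w = 2 u^n - u^(n-1)
    itself. The velocity is divergence free, so that the convection form vanishes on
    the diagonal (conv_form_diag). With a^n = |u^n|^2, twice the product of the time
    difference 3 u^(n+1) - 4 u^n + u^(n-1) with w is
    (3 a^(n+1) - a^n) - (3 a^n - a^(n-1)) - 3 |delta|^2, where delta = u^(n+1) - w is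
    the second difference. This telescopes, and stabilisation and diffusion are
    dissipative, so that only |delta|^2 has to be controlled (energy_step).

    That square is controlled by the scheme as well. Subtract two consecutive equations
    and test with the new delta: the time difference gives 3 delta^(n+1) - delta^n, so
    that |delta|^2 contracts, up to small multiples of the dissipation and to the
    transport k |d| |delta| of the increment d = u^n - u^(n-1), where k is of order
    tau |beta| / h (difference_step). Testing the equation with the increment bounds
    |d|^2 by |delta|^2, the dissipation, and k^2 |w|^2 (increment_bound). The convection
    is thus paid for twice, the error is k^4 |w|^2, and the four-thirds Courant
    condition amounts to k^4 <= kappa tau: the error is of the order of one
    time step and is absorbed by Gronwall's inequality (lyapunov, summed_bound,
    abstract_stability).

    The remaining work shows that the discrete forms have the sizes which the abstract
    argument requires. Values and derivatives of a polynomial on a cube are bounded by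
    its mean square on a concentric smaller cube (inverse_estimate); shape regularity
    and quasi-uniformity carry this to cells (cell_inverse), and summation to discrete
    functions (wderive_inverse, discrete_form_bounds), for which weak derivatives agree
    with the derivatives of the cell polynomials inside each cell (wderive_local). The
    gradient jump at a point in the relative interior of a face is the sum of two such
    polynomial gradients (grad_jumpE), which bounds the stabilisation form in the same
    way (stab_form_bound). Diffusion, of order tau mu / h^2, is dominated by
    tau |beta| / h because Pe > 1; and since h is at most the diameter of the domain, a
    bound on the Courant number also bounds tau itself (time_step_bounds). The
    functionals enter only through their dual norm (dual_norm_bound). *)

Set Implicit Arguments.
Unset Strict Implicit.
Unset Printing Implicit Defensive.

Import Order.TTheory GRing.Theory Num.Theory.
Import numFieldNormedType.Exports.

Local Open Scope classical_set_scope.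
Local Open Scope ring_scope.

(** * Borel sets and Lebesgue measure *)

Section rV_borel.
Context {R : realType} {n : nat}.
Implicit Types (x y : 'rV[R]_n) (U : set 'rV[R]_n).

Lemma ball_rVP x (e : R) y : 0 < e ->
  ball x e y <-> forall i, `|x ord0 i - y ord0 i| < e.
Proof.
move=> e0; split=> [[_ h] i|h]; first exact: h.
by split => // i j; rewrite ord1; exact: h.
Qed.

Lemma open_rVP U : open U <-> forall x, U x ->
  exists2 e : R, 0 < e & forall y, (forall i, `|x ord0 i - y ord0 i| < e) -> U y.
Proof.
rewrite openE; split=> h x Ux.
  have /nbhs_ballP[e /= e0 he] := h x Ux.
  by exists e => // y hy; apply: he; apply/ball_rVP.
have [e e0 he] := h x Ux; apply/nbhs_ballP; exists e => //= y /ball_rVP.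
by move=> /(_ e0); exact: he.
Qed.

Lemma measurable_coord_preimage (i : 'I_n) (A : set R) :
  measurable (A : set (measurableTypeR R)) ->
  measurable [set x : 'rV[R]_n | A (x ord0 i)].
Proof.
by move=> mA; rewrite -[X in measurable X]setTI; apply: measurable_rV_coord.
Qed.

Lemma measurable_rV_boxes (A : 'I_n -> set R) :
  (forall i, measurable (A i : set (measurableTypeR R))) ->
  measurable [set x : 'rV[R]_n | forall i, A i (x ord0 i)].
Proof.
move=> mA.
have -> : [set x : 'rV[R]_n | forall i, A i (x ord0 i)] =
    \bigcap_(i in [set: 'I_n]) [set x : 'rV[R]_n | A i (x ord0 i)].
  by apply/seteqP; split=> x /= h i; [move=> _; exact: h|exact: h].
apply: fin_bigcap_measurable; first exact: finite_finset.
by move=> i _; exact: measurable_coord_preimage.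
Qed.

Definition obox (a b : 'I_n -> R) : set 'rV[R]_n :=
  [set x | forall i, x ord0 i \in `]a i, b i[].

Definition cbox (a b : 'I_n -> R) : set 'rV[R]_n :=
  [set x | forall i, x ord0 i \in `[a i, b i]].

Lemma measurable_obox a b : measurable (obox a b).
Proof.
apply: (measurable_rV_boxes (A := fun i => [set x | x \in `]a i, b i[])) => i.
exact: measurable_itv.
Qed.

Lemma subset_obox_cbox a b : obox a b `<=` cbox a b.
Proof. by move=> x h i; have := h i; rewrite !in_itv/= => /andP[/ltW -> /ltW ->]. Qed.

Definition rat_lo (c : 'rV[rat]_n * nat) (i : 'I_n) : R := ratr (c.1 ord0 i) - c.2.+1%:R^-1.
Definition rat_hi (c : 'rV[rat]_n * nat) (i : 'I_n) : R := ratr (c.1 ord0 i) + c.2.+1%:R^-1.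

(** Rational centres and radii 1/(k+1) make the union countable, which is what
    measurability and almost everywhere statements need; that the closed boxes stay in
    the set leaves room for the supports of bump functions. *)
Lemma open_rat_boxes U : open U -> U =
  \bigcup_(c in [set c | cbox (rat_lo c) (rat_hi c) `<=` U]) obox (rat_lo c) (rat_hi c).
Proof.
move=> /open_rVP oU; apply/seteqP; split=> [x Ux|x [c /= cU Bx]]; last first.
  by apply: cU; exact: subset_obox_cbox.
have [e e0 he] := oU x Ux.
have [k hk] : exists k : nat, k.+1%:R^-1 < e / 2.
  have /ltr_add_invr[k hk] : 0 < e / 2 by rewrite divr_gt0.
  by exists k; rewrite add0r in hk.
have hq i : exists q : rat, `|ratr q - x ord0 i| < k.+1%:R^-1.
  have [q] := @rat_in_itvoo R (x ord0 i - k.+1%:R^-1) (x ord0 i + k.+1%:R^-1)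
    ltac:(by rewrite ltrBlDr -addrA ltrDl addr_gt0 ?invr_gt0).
  by rewrite in_itv/= => hq; exists q; rewrite ltr_distl.
pose q i := projT1 (cid (hq i)).
exists (\row_i q i, k).
  move=> /= y hy; apply: he => i; have := hy i.
  rewrite /rat_lo /rat_hi in_itv/= mxE /q; case: (cid (hq i)) => r /= hr hry.
  rewrite (splitr e) (le_lt_trans (ler_distD (ratr r) _ _))// ltrD//.
    by rewrite distrC (lt_trans hr).
  by rewrite distrC (le_lt_trans _ hk)// ler_distl.
move=> i; rewrite /rat_lo /rat_hi in_itv/= mxE /q; case: (cid (hq i)) => r /=.
by rewrite distrC ltr_distl.
Qed.

Lemma open_measurable_rV U : open U -> measurable U.
Proof.
move=> /open_rat_boxes ->; rewrite bigcup_mkcond; apply: countable_bigcupT_measurable.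
  exact: countableP.
move=> c; case: ifPn => _; last exact: measurable0.
exact: measurable_obox.
Qed.

Lemma closed_measurable_rV U : closed U -> measurable U.
Proof.
move=> cU; rewrite -[U]setCK; apply: measurableC; apply: open_measurable_rV.
exact: closed_openC.
Qed.

Lemma within_continuous_measurable_rV (D : set 'rV[R]_n) (f : 'rV[R]_n -> R) :
  measurable D -> {within D, continuous f} -> measurable_fun D f.
Proof.
move=> mD /continuousP cf; apply: (measurability _ (measurable_realfun.RGenOpens.measurableE R)).
move=> _ [_ [a [b ->] <-]].
have /open_subspaceP[V oV VE] := cf _ (@interval_open R (BSide false a) (BSide true b) isT isT).
rewrite setIC -VE; apply: measurableI => //; exact: open_measurable_rV.
Qed.

Lemma continuous_measurable_rV (D : set 'rV[R]_n) (f : 'rV[R]_n -> R) :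
  measurable D -> continuous f -> measurable_fun D f.
Proof.
by move=> mD cf; apply: within_continuous_measurable_rV => //; exact: continuous_subspaceT.
Qed.

End rV_borel.

Section leb_integral.
Context {R : realType}.
Local Open Scope ereal_scope.

Lemma ge0_integral_lebS n (f : 'rV[R]_n.+1 -> \bar R) :
  measurable_fun [set: 'rV[R]_n.+1] f -> (forall x, 0 <= f x) ->
  \int[@leb R n.+1]_x f x =
  \int[@lebesgue_measure R]_t \int[@leb R n]_y f (rV_cons (t, y)).
Proof.
move=> mf f0.
rewrite (eq_measure_integral (pushforward (@lebesgue_measure R \x leb n) rV_cons)) //.
rewrite (ge0_integral_pushforward measurable_rV_cons) //.
rewrite preimage_setT fubini_tonelli1 //; last by move=> x; exact: f0.
by apply: measurableT_comp => //; exact: measurable_rV_cons.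
Qed.

Lemma ge0_integral_lebS2 n (f : 'rV[R]_n.+1 -> \bar R) :
  measurable_fun [set: 'rV[R]_n.+1] f -> (forall x, 0 <= f x) ->
  \int[@leb R n.+1]_x f x =
  \int[@leb R n]_y \int[@lebesgue_measure R]_t f (rV_cons (t, y)).
Proof.
move=> mf f0; rewrite ge0_integral_lebS//.
apply: (@fubini_tonelli _ _ _ _ _ _ _ (f \o rV_cons)) => //.
  by apply: measurableT_comp => //; exact: measurable_rV_cons.
by move=> x; exact: f0.
Qed.

Lemma ge0_integral_lebesgue_affine (k c : R) (f : R -> \bar R) : (0 < k)%R ->
  measurable_fun setT f -> (forall x, 0 <= f x) ->
  \int[@lebesgue_measure R]_t f (k * t + c)%R =
  k^-1%:E * \int[@lebesgue_measure R]_t f t.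
Proof.
move=> k0 mf f0; pose phi (t : measurableTypeR R) : measurableTypeR R := (k * t + c)%R.
have mphi : measurable_fun setT phi.
  by apply: measurable_funD => //; apply: measurable_funM.
pose K : {nonneg R} := NngNum (ltW k0).
pose mu' := [the measure _ _ of mscale K (measure_function_pushforward__canonical__measure_function_Measure (@lebesgue_measure R) mphi)].
have muE A : mu' A = k%:E * @lebesgue_measure R (phi @^-1` A) by [].
have E A : measurable (A : set (measurableTypeR R)) -> @lebesgue_measure R A = mu' A.
  apply: lebesgue_measure_unique => _ [[a b]] _ <-.
  rewrite muE.
  rewrite (_ : phi @^-1` `]a, b] = `]((a - c) / k)%R, ((b - c) / k)%R])%classic; last first.
    apply/seteqP; split=> x /=; rewrite !in_itv/= /phi ltr_pdivrMr// ler_pdivlMr//;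
      rewrite ltrBlDr lerBrDr mulrC //.
  rewrite !lebesgue_measure_itv/= !lte_fin ltr_pM2r ?invr_gt0// ltrD2r.
  case: ifPn => ab; rewrite ?mule0// -EFinM; congr EFin.
  by field; rewrite gt_eqF.
rewrite [in RHS](eq_measure_integral mu'); last by move=> A mA _; exact: E.
rewrite ge0_integral_mscale//= (ge0_integral_pushforward mphi)//=.
by rewrite preimage_setT muleA -EFinM mulVf ?mul1e// gt_eqF.
Qed.

Lemma rV_consDZ n (k : R) (c : 'rV[R]_n.+1) t (y : 'rV[R]_n) :
  (k *: rV_cons (t, y) + c = rV_cons
     (k * t + c ord0 ord0, k *: y + \row_j c ord0 (lift ord0 j)))%R.
Proof.
apply/rowP => i; rewrite !mxE /=.
by case: unliftP => [j ->|->] //; rewrite !mxE.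
Qed.

(** One coordinate at a time, from the affine change of variables on the line. *)
Lemma ge0_integral_leb_affine n (k : R) (c : 'rV[R]_n) (f : 'rV[R]_n -> \bar R) :
  (0 < k)%R -> measurable_fun [set: 'rV[R]_n] f -> (forall x, 0 <= f x) ->
  \int[@leb R n]_x f (k *: x + c)%R = (k ^- n)%:E * \int[@leb R n]_x f x.
Proof.
move=> k0; elim: n => [|n IH] in c f *.
  move=> mf f0; rewrite expr0 invr1 mul1e.
  by apply: eq_integral => x _; congr f; apply/rowP => -[].
move=> mf f0.
have mg : measurable_fun [set: 'rV[R]_n.+1] (fun x : 'rV[R]_n.+1 => k *: x + c)%R.
  apply: measurable_rVP => i; under eq_fun do rewrite !mxE.
  apply: measurable_funD => //; apply: measurable_funM => //.
  exact: measurable_rV_coord.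
rewrite ge0_integral_lebS//; last exact: measurableT_comp.
pose F t := \int[@leb R n]_y f (rV_cons (t, y)).
under eq_integral => t _.
  under eq_integral do rewrite rV_consDZ.
  rewrite (IH _ (fun y => f (rV_cons (k * t + c ord0 ord0, y)%R)))//; last first.
    apply: measurableT_comp => //; apply: measurableT_comp => //.
    exact: measurable_rV_cons.
  over.
have mF : measurable_fun setT F.
  apply: (measurable_fun_fubini_tonelli_F (f \o rV_cons)); last by move=> x; exact: f0.
  by apply: measurableT_comp => //; exact: measurable_rV_cons.
have F0 t : 0 <= F t by exact: integral_ge0.
rewrite /= ge0_integralZl//; last 3 first.
- apply: (measurableT_comp mF).
  by apply: measurable_funD => //; apply: measurable_funM.
- by move=> x _; exact: F0.
- by rewrite lee_fin invr_ge0 exprn_ge0// ltW.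
rewrite (ge0_integral_lebesgue_affine (c ord0 ord0) k0 mF F0).
rewrite muleA -EFinM -(ge0_integral_lebS mf f0) exprS invfM mulrC; congr (_%:E * _).
Qed.

End leb_integral.

Section leb_sets.
Context {R : realType}.

Lemma rV_cons0 n (t : R) (y : 'rV[R]_n) : rV_cons (t, y) ord0 ord0 = t.
Proof. by rewrite mxE unlift_none. Qed.

Lemma rV_consS n (t : R) (y : 'rV[R]_n) j :
  rV_cons (t, y) ord0 (lift ord0 j) = y ord0 j.
Proof. by rewrite mxE liftK. Qed.

Lemma continuous_sum_coord n (c : 'I_n -> R) :
  continuous (fun x : 'rV[R]_n => \sum_i c i * x ord0 i).
Proof.
apply: continuous_big => [x|i _ x]; first exact: add_continuous.
exact: (cvgM (cvg_cst _) (@coord_continuous _ _ _ ord0 i x)).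
Qed.

Lemma measurable_hyperplane n (c : 'I_n -> R) (b : R) :
  measurable [set x : 'rV[R]_n | \sum_i c i * x ord0 i = b].
Proof.
have := continuous_measurable_rV measurableT (@continuous_sum_coord n c).
move=> /(_ measurableT [set b] (measurable_set1 _)); rewrite setTI; exact.
Qed.

Definition cube n (r : R) : set 'rV[R]_n :=
  [set x | forall i, x ord0 i \in `[- r, r]].
Arguments cube : clear implicits.

Lemma measurable_cube n (r : R) : measurable (cube n r).
Proof.
apply: (measurable_rV_boxes (A := fun=> [set x | x \in `[- r, r]])) => i.
exact: measurable_itv.
Qed.

Lemma leb_cube n (r : R) : 0 <= r -> leb n (cube n r) = ((2 * r) ^+ n)%:E.
Proof.
move=> r0; elim: n => [|n IH].
  rewrite expr0 /= diracE mem_set//=.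
  by move=> -[].
rewrite /= /leb_succ /pushforward.
rewrite (_ : _ @^-1` _ = [set x | x \in `[- r, r]] `*` cube n r); last first.
  apply/seteqP; split=> [[t y] /= h|[t y] /= [ht hy] i].
    split; first by have := h ord0; rewrite rV_cons0.
    by move=> i; have := h (lift ord0 i); rewrite rV_consS.
  by case: (unliftP ord0 i) => [j ->|->]; rewrite ?rV_cons0 ?rV_consS.
rewrite product_measure1E; [|exact: measurable_itv|exact: measurable_cube].
rewrite IH.
have := @lebesgue_measure_itv R `[- r, r].
rewrite /= lte_fin => ->; case: ifPn => [h|].
  by rewrite -EFinB -EFinM exprS opprK; congr (_ * _)%:E; ring.
rewrite -leNgt => r0'; have -> : r = 0 by lra.
by rewrite mulr0 [in RHS]expr0n/= mul0e.
Qed.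

(** Integrate first along the leading coordinate if its coefficient does not
    vanish, the sections being points; otherwise all sections are hyperplanes in one
    dimension less. *)
Lemma leb_hyperplane n (c : 'I_n -> R) (b : R) : (exists i, c i != 0) ->
  leb n [set x : 'rV[R]_n | \sum_i c i * x ord0 i = b] = 0%E.
Proof.
elim: n => [|n IH] in c b *; first by case=> -[].
move=> [i ci]; set A := [set x | _].
have mA : measurable A by exact: measurable_hyperplane.
have -> : leb n.+1 A = (\int[leb n.+1]_x (\1_A x)%:E)%E by rewrite integral_indic// setIT.
have mi : measurable_fun [set: 'rV[R]_n.+1] (fun x => (\1_A x)%:E : \bar R).
  by apply/measurable_EFinP; exact: measurable_indic.
have i0 (x : 'rV[R]_n.+1) : (0 <= (\1_A x)%:E :> \bar R)%E by rewrite lee_fin.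
have AE (t : R) y : A (rV_cons (t, y)) <->
    c ord0 * t + \sum_j c (lift ord0 j) * y ord0 j = b.
  rewrite /A /= big_ord_recl rV_cons0.
  by rewrite (eq_bigr (fun j => c (lift ord0 j) * y ord0 j))// => j _; rewrite mxE liftK.
have [c0|c0] := eqVneq (c ord0) 0.
  rewrite ge0_integral_lebS// integral0_eq// => t _.
  pose B := [set y : 'rV[R]_n | \sum_j c (lift ord0 j) * y ord0 j = b].
  rewrite (eq_integral (fun y => (\1_B y)%:E)); last first.
    move=> y _; congr (_%:E); rewrite !indicE; congr (_%:R).
    congr nat_of_bool; apply/idP/idP; rewrite !inE => h.
      by have /AE := h; rewrite c0 mul0r add0r.
    by apply/AE; rewrite c0 mul0r add0r.
  rewrite integral_indic ?setIT//; last exact: measurable_hyperplane.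
  apply: IH; case: (unliftP ord0 i) ci => [j ->|->]; first by exists j.
  by rewrite c0 eqxx.
rewrite ge0_integral_lebS2// integral0_eq// => y _.
pose s := (b - \sum_j c (lift ord0 j) * y ord0 j) / c ord0.
rewrite (eq_integral (fun t : measurableTypeR R =>
    (\1_([set s] : set (measurableTypeR R)) t)%:E)); last first.
  move=> t _; congr (_%:E); rewrite !indicE; congr (_%:R).
  congr nat_of_bool; apply/idP/idP; rewrite !inE /= => h.
    have /AE e := h; apply: (@mulfI _ (c ord0)) => //; rewrite /s mulrC [RHS]mulrCA divff//.
    by rewrite mulr1 -e addrK mulrC.
  by apply/AE; rewrite h /s; field.
by rewrite integral_indic// setIT; exact: lebesgue_measure_set1.
Qed.

(** Boundedness in coordinates; for the integrals below it is handier than the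
    filter formulation. *)
Definition box_bounded n (A : set 'rV[R]_n) := exists2 r : R, 0 <= r & A `<=` cube n r.

Lemma cubeP n (r : R) (x : 'rV[R]_n) : cube n r x <-> forall i, `|x ord0 i| <= r.
Proof. by split=> h i; have := h i; rewrite /= in_itv/= ler_norml. Qed.

Lemma coord_le_norm n (x : 'rV[R]_n) i : `|x ord0 i| <= `|x|.
Proof.
rewrite [leRHS]/Num.norm /= mx_normrE.
by apply: (@le_bigmax _ R _ 0 (fun ij : 'I_1 * 'I_n => `|x ij.1 ij.2|) (ord0, i)).
Qed.

Lemma box_boundedE n (A : set 'rV[R]_n) : box_bounded A <-> bounded_set A.
Proof.
split=> [[r r0 Ar]|[M [Mr hM]]].
  exists r; split; first exact: ger0_real.
  move=> s rs x /Ar/cubeP xr; have s0 : 0 <= s by rewrite (le_trans r0)// ltW.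
  rewrite /= [leLHS]/Num.norm /= mx_normrE.
  apply/bigmax_leP; split=> // -[i j] _ /=; rewrite ord1 (le_trans (xr j))//.
  exact: ltW.
exists (`|M| + 1); first by rewrite addr_ge0.
move=> x Ax; apply/cubeP => i; apply: (le_trans (coord_le_norm _ _)).
by apply: hM => //; rewrite (le_lt_trans (ler_norm M))// ltrDl.
Qed.

Lemma box_bounded_compact n (A : set 'rV[R]_n) : compact A -> box_bounded A.
Proof. by move=> /compact_bounded; rewrite box_boundedE. Qed.

Lemma box_bounded_closure n (A : set 'rV[R]_n) :
  box_bounded A -> box_bounded (closure A).
Proof.
move=> [r r0 Ar]; exists r => //.
have cl : closed (cube n r).
  have -> : cube n r = \bigcap_(i in [set: 'I_n])
      ((fun x : 'rV[R]_n => x ord0 i) @^-1` [set` `[- r, r]]).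
    by apply/seteqP; split=> x /= h i; [move=> _; exact: h|exact: h].
  apply: closed_bigI => i _.
  by apply: closed_comp => [x _|]; [exact: coord_continuous|exact: interval_closed].
by apply: (subset_trans (closure_subset Ar)); rewrite -(closure_id _).1.
Qed.

Lemma box_bounded_lty n (A : set 'rV[R]_n) :
  measurable A -> box_bounded A -> (leb n A < +oo)%E.
Proof.
move=> mA [r r0 Ar]; apply: (@le_lt_trans _ _ (leb n (cube n r))).
  by apply: le_measure => //; rewrite inE//; exact: measurable_cube.
by rewrite leb_cube// ltry.
Qed.

Lemma bounded_integrable_leb n (A : set 'rV[R]_n) (f : 'rV[R]_n -> R) (M : R) :
  measurable A -> box_bounded A -> measurable_fun A f ->
  (forall x, A x -> `|f x| <= M) -> (leb n).-integrable A (EFin \o f).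
Proof.
move=> mA bA mf fM; apply: measurable_bounded_integrable => //.
  exact: box_bounded_lty.
exists M; split; first exact: num_real.
by move=> y My x Ax /=; exact: (le_trans (fM _ Ax) (ltW My)).
Qed.

End leb_sets.

Arguments cube {R} n r.

(** * Smooth functions *)

Section smooth_functions.
Context {R : realType} {n : nat}.
Implicit Types (f g : 'rV[R]_n -> R) (x : 'rV[R]_n).

(** Smoothness of finite order as a recursive predicate, so that closure under sums
    and products is an induction on the order. *)
Fixpoint Ck (k : nat) f : Prop := (forall x, differentiable f x) /\
  if k is k'.+1 then forall i, Ck k' (pderive i f) else True.

Lemma CkW k f : Ck k.+1 f -> Ck k f.
Proof.
elim: k f => [|k IH] f [df h]; split=> // i.
by apply: IH; exact: h.
Qed.

Lemma smoothP f : smooth f <-> forall k, Ck k f.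
Proof.
split=> [sf k|h].
  elim: k f sf => [|k IH] f sf; split=> //; try exact: (sf [::]).
  by move=> i; apply: IH => s x; rewrite -[pderive i f]/(foldr pderive f [:: i]) -foldr_cat; exact: sf.
move=> s; elim/last_ind: s f h => [|s i IH] f h x; first exact: (h 0%N).1.
rewrite -cats1 foldr_cat /=; apply: IH => k; exact: (h k.+1).2.
Qed.

Lemma smooth_pderive i f : smooth f -> smooth (pderive i f).
Proof. by move=> /smoothP h; apply/smoothP => k; exact: (h k.+1).2. Qed.

Lemma smooth_differentiable f x : smooth f -> differentiable f x.
Proof. exact: (fun h => h [::] x). Qed.

Lemma smooth_continuous f : smooth f -> continuous f.
Proof. by move=> sf x; apply: differentiable_continuous; exact: smooth_differentiable. Qed.

Lemma pderiveD i f g : (forall x, differentiable f x) -> (forall x, differentiable g x) ->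
  pderive i (f \+ g) = pderive i f \+ pderive i g.
Proof.
move=> df dg; apply/funext => x; rewrite /pderive.
by rewrite [LHS](@deriveD _ _ _ f g)//; exact: diff_derivable.
Qed.

Lemma pderiveM i f g : (forall x, differentiable f x) -> (forall x, differentiable g x) ->
  pderive i (f \* g) = (f \* pderive i g) \+ (g \* pderive i f).
Proof.
move=> df dg; apply/funext => x; rewrite /pderive.
by rewrite [LHS](@deriveM _ _ f g)//; exact: diff_derivable.
Qed.

Lemma pderive_cst i (c : R) : pderive i (cst c : 'rV[R]_n -> R) = cst 0.
Proof. by apply/funext => x; rewrite /pderive derive_cst. Qed.

Lemma pderive_comp_coord i j (g : R -> R) x : derivable g (x ord0 j) 1 ->
  pderive i (fun y => g (y ord0 j)) x = (i == j)%:R * derive1 g (x ord0 j).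
Proof.
move=> /derivable1_diffP dg; rewrite /pderive.
have dc : differentiable (fun y : 'rV[R]_n => y ord0 j) x by exact: differentiable_coord.
rewrite deriveE; last exact: (@differentiable_comp _ _ _ _ (fun y : 'rV[R]_n => y ord0 j) g).
rewrite (@diff_comp _ _ _ _ (fun y : 'rV[R]_n => y ord0 j) g)// /=.
rewrite deriv1E; last exact/derivable1_diffP.
have -> : 'd (fun y : 'rV[R]_n => y ord0 j) x (delta_mx ord0 i) = (i == j)%:R.
  rewrite -deriveE//; apply: cvg_lim => //.
  apply: cvg_near_cst; near=> h.
  rewrite /= !mxE eqxx/= addrK [j == i]eq_sym.
  rewrite /GRing.scale/= mulrA mulVf ?mul1r//.
  by near: h; rewrite near_withinE; exact: nearW.
by [].
Unshelve. all: by end_near. Qed.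

Lemma Ck_cst k (c : R) : Ck k (cst c : 'rV[R]_n -> R).
Proof.
elim: k c => [|k IH] c; first by split=> // x; exact: differentiable_cst.
split=> [x|i]; first exact: differentiable_cst.
by rewrite pderive_cst; exact: IH.
Qed.

Lemma CkD k f g : Ck k f -> Ck k g -> Ck k (f \+ g).
Proof.
elim: k f g => [|k IH] f g [df hf] [dg hg].
  by split=> // x; exact: differentiableD.
split=> [x|i]; first exact: differentiableD.
by rewrite pderiveD//; apply: IH; [exact: hf|exact: hg].
Qed.

Lemma CkM k f g : Ck k f -> Ck k g -> Ck k (f \* g).
Proof.
elim: k f g => [|k IH] f g hf hg.
  by split=> // x; apply: differentiableM; [exact: hf.1|exact: hg.1].
split=> [x|i]; first by apply: differentiableM; [exact: hf.1|exact: hg.1].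
rewrite pderiveM; [|exact: hf.1|exact: hg.1].
by apply: CkD; apply: IH; by [exact: CkW|exact: hf.2|exact: hg.2].
Qed.

Lemma smooth_cst (c : R) : smooth (cst c : 'rV[R]_n -> R).
Proof. by apply/smoothP => k; exact: Ck_cst. Qed.

Lemma smoothD f g : smooth f -> smooth g -> smooth (f \+ g).
Proof. by move=> /smoothP hf /smoothP hg; apply/smoothP => k; exact: CkD. Qed.

Lemma smoothM f g : smooth f -> smooth g -> smooth (f \* g).
Proof. by move=> /smoothP hf /smoothP hg; apply/smoothP => k; exact: CkM. Qed.

Lemma smoothZ (c : R) f : smooth f -> smooth (fun x => c * f x).
Proof. exact: (smoothM (@smooth_cst c)). Qed.

Lemma smooth_sum (I : Type) (r : seq I) (P : pred I) (F : I -> 'rV[R]_n -> R) :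
  (forall i, P i -> smooth (F i)) -> smooth (fun x => \sum_(i <- r | P i) F i x).
Proof.
move=> h; elim: r => [|a r IH].
  by under eq_fun do rewrite big_nil; exact: smooth_cst.
under eq_fun do rewrite big_cons.
case Pa: (P a); last exact: IH.
exact: smoothD (h _ Pa) IH.
Qed.

Lemma smooth_prod (I : Type) (r : seq I) (P : pred I) (F : I -> 'rV[R]_n -> R) :
  (forall i, P i -> smooth (F i)) -> smooth (fun x => \prod_(i <- r | P i) F i x).
Proof.
move=> h; elim: r => [|a r IH].
  by under eq_fun do rewrite big_nil; exact: smooth_cst.
under eq_fun do rewrite big_cons.
case Pa: (P a); last exact: IH.
exact: smoothM (h _ Pa) IH.
Qed.

(** A family of functions of one variable closed under differentiation consists
    of smooth functions. *)
Lemma smooth_comp_coord (S : set (R -> R)) (j : 'I_n) :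
  (forall g : R -> R, S g -> (forall t, derivable g t 1) /\
     exists c h, S h /\ forall t, derive1 g t = c * h t) ->
  forall g : R -> R, S g -> smooth (fun x : 'rV[R]_n => g (x ord0 j)).
Proof.
move=> hS g Sg; apply/smoothP => k; elim: k g Sg => [|k IH] g Sg.
all: have dg (x : 'rV[R]_n) : differentiable (fun y : 'rV[R]_n => g (y ord0 j)) x.
  1,3: by apply: (@differentiable_comp _ _ _ _ (fun y : 'rV[R]_n => y ord0 j) g);
    [exact: differentiable_coord|apply/derivable1_diffP; exact: (hS _ Sg).1].
all: split=> // i.
have [dgg [c [h [Sh hE]]]] := hS _ Sg.
have -> : pderive i (fun y : 'rV[R]_n => g (y ord0 j)) =
    cst ((i == j)%:R * c) \* (fun x => h (x ord0 j)).
  by apply/funext => x; rewrite pderive_comp_coord//= hE mulrA.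
by apply: CkM; [exact: Ck_cst|exact: IH].
Qed.

Lemma smooth_coord j : smooth (fun x : 'rV[R]_n => x ord0 j).
Proof.
apply: (@smooth_comp_coord [set g | g = id \/ exists c, g = cst c] j _ id); last by left.
move=> g [->|[c ->]].
  split=> [t|]; first exact: derivable_id.
  exists 1, (cst 1); split; first by right; exists 1.
  by move=> t; rewrite derive1E derive_id mulr1.
split=> [t|]; first exact: derivable_cst.
exists 0, (cst 0); split; first by right; exists 0.
by move=> t; rewrite derive1E derive_cst mul0r.
Qed.

End smooth_functions.

(** * Flat functions of one variable *)

Section flat_functions.
Context {R : realType}.
Implicit Types (Q : {poly R}) (s t : R).

(** Polynomials in 1/s times exp(-1/s), extended by 0: a family that contains the
    usual flat function and is closed under differentiation. *)
Definition flat Q s : R := if 0 < s then Q.[s^-1] * expR (- s^-1) else 0.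

Lemma horner_le_power Q : exists2 A : R, 0 <= A &
  forall t, 1 <= t -> `|Q.[t]| <= A * t ^+ size Q.
Proof.
exists (\sum_(i < size Q) `|Q`_i|); first by apply: sumr_ge0.
move=> t t1; rewrite horner_coef (le_trans (ler_norm_sum _ _ _))// mulr_suml.
apply: ler_sum => i _; rewrite normrM ler_wpM2l// ger0_norm ?exprn_ge0// ?(le_trans ler01)//.
by apply: ler_weXn2l => //; exact: ltnW.
Qed.

(** At 1/s the exponential beats the polynomial with a power of s to spare. Since
    the bound holds for every polynomial, it gives both continuity and
    differentiability at 0. *)
Lemma flat_bound Q : exists2 K : R, 0 <= K &
  forall s, `|s| <= 1 -> `|flat Q s| <= K * `|s|.
Proof.
have [A A0 hA] := horner_le_power Q; set m := size Q in hA.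
exists (A * m.+1`!%:R); first by rewrite mulr_ge0.
move=> s s1; rewrite /flat; case: ifPn => [s0|_]; last first.
  by rewrite normr0 !mulr_ge0.
rewrite (gtr0_norm s0) in s1 *.
have t1 : 1 <= s^-1 by rewrite -invr1 lef_pV2 ?posrE.
have t0 : 0 < s^-1 by rewrite invr_gt0.
rewrite normrM (gtr0_norm (expR_gt0 _)) expRN.
apply: (@le_trans _ _ (A * s^-1 ^+ m * (m.+1`!%:R / s^-1 ^+ m.+1))).
  rewrite ler_pM ?invr_ge0 ?expR_ge0//; first exact: hA.
  rewrite -[leRHS]invf_div lef_pV2 ?posrE ?expR_gt0//; last first.
    by rewrite divr_gt0// ?exprn_gt0// ltr0n fact_gt0.
  have := expR_ge1Dxn m (ltW t0); apply: le_trans.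
  by rewrite lerDr.
rewrite exprS invfM invrK le_eqVlt; apply/orP; left; apply/eqP.
by field; rewrite expf_neq0//= gt_eqF.
Qed.

Lemma flat_X Q s : flat ('X * Q) s = s^-1 * flat Q s.
Proof. by rewrite /flat hornerM hornerX; case: ifP => _; rewrite ?mulr0// mulrA. Qed.

Lemma is_derive_flat Q s : is_derive s 1 (flat Q) (flat ('X^2 * (Q - Q^`())) s).
Proof.
have [s0|s0|<-] := ltgtP 0 s.
- have s0' : s != 0 by rewrite gt_eqF.
  apply: (@near_eq_is_derive _ _ _ (fun t => Q.[t^-1] * expR (- t^-1))).
    near=> t; rewrite /flat ifT//.
    by near: t; exact: lt_nbhsr.
  rewrite /flat s0.
  have dI : is_derive s 1 (fun t : R => t^-1) (- s ^- 2).
    by apply: is_derive_eq; [exact: is_deriveV|rewrite /GRing.scale/= mulr1].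
  have dQ : is_derive s 1 (fun t => Q.[t^-1]) (Q^`().[s^-1] * - s ^- 2).
    exact: (is_derive1_comp (f := horner Q)).
  have dN : is_derive s 1 (fun t : R => - t^-1) (s ^- 2).
    by apply: is_derive_eq; rewrite opprK.
  have dE : is_derive s 1 (fun t => expR (- t^-1)) (expR (- s^-1) * s ^- 2).
    exact: (is_derive1_comp (f := expR)).
  apply: (is_derive_eq (is_deriveM dQ dE)).
  rewrite /GRing.scale/= hornerM hornerXn hornerD hornerN exprVn.
  by move: (Q.[_]) (expR _) (Q^`().[_]) (s ^- 2) => u e v w; ring.
- apply: (@near_eq_is_derive _ _ _ (cst 0)).
    near=> t; rewrite /flat ifF//; apply/negbTE; rewrite -leNgt ltW//.
    by near: t; exact: lt_nbhsl.
  by rewrite /flat ltNge (ltW s0)/=; exact: is_derive_cst.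
- have f0 P : flat P 0 = 0 by rewrite /flat ltxx.
  rewrite f0.
  have [K K0 hK] := flat_bound ('X * Q).
  have cvg0 : (h : R)^-1 *: ((flat Q \o shift 0) (h *: (1 : R)) - flat Q 0) @[h --> 0^'] --> (0 : R).
    apply/cvgr0Pnorm_lt => e e0; near=> h.
    rewrite f0 subr0 /= addr0 /GRing.scale/= mulr1 -flat_X.
    have h1 : `|h| <= 1.
      by near: h; apply: dnbhs0_le.
    apply: (le_lt_trans (hK h h1)); apply: (@le_lt_trans _ _ ((K + 1) * `|h|)).
      by rewrite ler_wpM2r// lerDl.
    rewrite mulrC -ltr_pdivlMr ?ltr_pwDr//.
    by near: h; apply: dnbhs0_lt; rewrite divr_gt0// ltr_pwDr.
  by split; [apply/cvg_ex; exists 0|exact: cvg_lim].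
Unshelve. all: by end_near. Qed.

Lemma flat1_ge0 s : 0 <= flat 1 s.
Proof. by rewrite /flat; case: ifP => // _; rewrite hornerE mul1r expR_ge0. Qed.

Lemma flat1_le1 s : flat 1 s <= 1.
Proof.
rewrite /flat; case: ifP => // s0.
by rewrite hornerE mul1r -expR0 ler_expR oppr_le0 invr_ge0 ltW.
Qed.

Lemma flat1_gt0 s : (flat 1 s != 0) = (0 < s).
Proof. by rewrite /flat; case: ifP => _; rewrite ?eqxx// hornerE mul1r gt_eqF// expR_gt0. Qed.

(** Stretching the flat function gives the indicator of the half line. *)
Lemma cvg_flat1 s : flat 1 (k.+1%:R * s) @[k --> \oo] --> ((0 < s)%R%:R : R).
Proof.
have [s0|s0] := ltP 0 s; last first.
  rewrite (_ : (fun k => _) = cst 0); first exact: cvg_cst.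
  by apply/funext => k; rewrite /flat pmulr_rgt0 ?ltr0Sn// ltNge s0.
rewrite (_ : (fun k => _) = (fun k => expR (- (s^-1 * k.+1%:R^-1)))); last first.
  by apply/funext => k; rewrite /flat pmulr_rgt0 ?ltr0Sn// s0 hornerE mul1r invfM mulrC.
rewrite -[X in _ --> X]expR0; apply: continuous_cvg; first exact: continuous_expR.
rewrite -oppr0; apply: cvgN; rewrite -(mulr0 s^-1); apply: cvgM; first exact: cvg_cst.
exact: cvg_harmonic.
Qed.

Definition flat_affine (g : R -> R) := exists Q k a, g = fun s => flat Q (k * (s - a)).

Lemma is_derive_flat_affine Q k a s :
  is_derive s 1 (fun s => flat Q (k * (s - a)))
    (flat ('X^2 * (Q - Q^`())) (k * (s - a)) * k).
Proof.
have dA : is_derive s 1 (fun s : R => k * (s - a)) k.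
  apply: is_derive_eq; by rewrite /GRing.scale/= ?(mulr0, mulr1, addr0, subr0).
exact: (is_derive1_comp (is_derive_flat Q _) dA).
Qed.

Lemma smooth_flat_coord n Q k a (j : 'I_n) :
  smooth (fun x : 'rV[R]_n => flat Q (k * (x ord0 j - a))).
Proof.
apply: (@smooth_comp_coord _ _ flat_affine j _ (fun s => flat Q (k * (s - a)))); last first.
  by exists Q, k, a.
move=> _ [P [l [b ->]]]; split=> [t|].
  by have := is_derive_flat_affine P l b t => -[].
exists l, (fun s => flat ('X^2 * (P - P^`())) (l * (s - b))); split.
  by do 3 eexists.
by move=> t; rewrite derive1E; have := is_derive_flat_affine P l b t => -[_ ->]; rewrite mulrC.
Qed.

End flat_functions.

(** * Test functions *)

Section test_functions.
Context {R : realType} {n : nat}.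
Implicit Types (f g phi psi : 'rV[R]_n -> R) (x : 'rV[R]_n) (U : set 'rV[R]_n).

Definition supp f := closure [set x | f x != 0].

Lemma supp0 f x : ~ supp f x -> f x = 0.
Proof.
move=> h; apply/eqP/negPn/negP => fx; apply: h; exact: subset_closure.
Qed.

Lemma test_smooth U phi : test_function U phi -> smooth phi.
Proof. by case. Qed.

Lemma test_continuous U phi : test_function U phi -> continuous phi.
Proof. by move=> /test_smooth; exact: smooth_continuous. Qed.

Lemma test_functionW U V phi : U `<=` V -> test_function U phi -> test_function V phi.
Proof. by move=> UV [? ? h]; split=> //; exact: subset_trans UV. Qed.

Lemma test_out U phi x : test_function U phi -> ~ U x -> phi x = 0.
Proof. by move=> [_ _ h] Ux; apply: supp0 => /h. Qed.

Lemma test_function_sub U phi f : test_function U phi -> smooth f ->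
  (forall x, phi x = 0 -> f x = 0) -> test_function U f.
Proof.
move=> [sphi cphi Uphi] sf fphi.
have sub : supp f `<=` supp phi.
  by apply: closure_subset => x /=; apply: contra_neq; exact: fphi.
split=> //; last exact: subset_trans sub Uphi.
apply: (subclosed_compact _ cphi) => //; exact: closed_closure.
Qed.

Lemma testD U phi psi : test_function U phi -> test_function U psi ->
  test_function U (phi \+ psi).
Proof.
move=> [sphi cphi Uphi] [spsi cpsi Upsi].
have sub : supp (phi \+ psi) `<=` supp phi `|` supp psi.
  rewrite /supp -closureU; apply: closure_subset => x /= h.
  have [p0|] := eqVneq (phi x) 0; last by left.
  by right; move: h; rewrite p0 add0r.
split; first exact: smoothD.
  apply: (subclosed_compact _ (compactU cphi cpsi)) => //; exact: closed_closure.
by apply: subset_trans sub _ => x [/Uphi|/Upsi].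
Qed.

Lemma testMl U phi g : test_function U phi -> smooth g -> test_function U (phi \* g).
Proof.
move=> tphi sg; apply: (test_function_sub tphi).
  exact: smoothM (test_smooth tphi) sg.
by move=> x /= ->; rewrite mul0r.
Qed.

Lemma testZ U (c : R) phi : test_function U phi -> test_function U (fun x => c * phi x).
Proof.
move=> tphi; apply: (test_function_sub tphi).
  exact: smoothZ (test_smooth tphi).
by move=> x /= ->; rewrite mulr0.
Qed.

Lemma pderive_out i f x : ~ supp f x -> pderive i f x = 0.
Proof.
move=> h; rewrite /pderive.
have oc : open (~` supp f) by apply: closed_openC; exact: closed_closure.
rewrite (@near_eq_derive _ _ _ f (cst 0)) ?derive_cst//.
have : \forall y \near x, (~` supp f) y by exact: open_nbhs_nbhs.
by apply: filterS => y; exact: supp0.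
Qed.

Lemma test_pderive U i phi : test_function U phi -> test_function U (pderive i phi).
Proof.
move=> [sphi cphi Uphi].
have sub : supp (pderive i phi) `<=` supp phi.
  have -> : supp phi = closure (supp phi).
    by apply/closure_id; exact: closed_closure.
  apply: closure_subset => x /= h; apply: contrapT => hx.
  by move: h; rewrite pderive_out ?eqxx.
split; first exact: smooth_pderive.
  apply: (subclosed_compact _ cphi) => //; exact: closed_closure.
exact: subset_trans sub Uphi.
Qed.

Lemma continuous_compact_bounded (A : set 'rV[R]_n) f : compact A -> {within A, continuous f} ->
  exists2 M : R, 0 <= M & forall x, A x -> `|f x| <= M.
Proof.
move=> cA cf; have := compact_bounded (continuous_compact cf cA).
move=> [M [_ hM]]; exists (`|M| + 1); first by rewrite addr_ge0.
move=> x Ax; apply: (hM (`|M| + 1)); first by rewrite (le_lt_trans (ler_norm _))// ltrDl.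
by exists x.
Qed.

Lemma test_bounded U phi : test_function U phi ->
  exists2 M : R, 0 <= M & forall x, `|phi x| <= M.
Proof.
move=> tphi; have [_ cphi _] := tphi.
have [|M M0 hM] := continuous_compact_bounded cphi (f := phi).
  by apply: continuous_subspaceT; exact: (test_continuous tphi).
exists M => // x; have [h|/supp0 ->] := pselect (supp phi x); first exact: hM.
by rewrite normr0.
Qed.

Lemma test_integrable U A phi : measurable A -> test_function U phi ->
  (leb n).-integrable A (EFin \o phi).
Proof.
move=> mA tphi; have [M M0 hM] := test_bounded tphi; have [_ cphi _] := tphi.
have ms : measurable (supp phi) by apply: closed_measurable_rV; exact: closed_closure.
apply: (integrableS measurableT mA) => //.
have -> : EFin \o phi = (EFin \o phi) \_ (supp phi).
  apply/funext => x; rewrite patchE; case: ifPn => //.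
  by rewrite notin_setE => /supp0 /= ->.
apply/(integrable_mkcond _ ms).1; apply: (bounded_integrable_leb (M := M)) => //.
- exact: box_bounded_compact.
- by apply: continuous_measurable_rV => //; exact: (test_continuous tphi).
Qed.

(** The factor k+1 stretches the flat functions, so that the bumps on a fixed box
    converge to its indicator. *)
Definition box_bump (a b : 'I_n -> R) (k : nat) : 'rV[R]_n -> R := fun x =>
  \prod_i (flat 1 (k.+1%:R * (x ord0 i - a i)) * flat 1 (- k.+1%:R * (x ord0 i - b i))).

Lemma cbox_closed (a b : 'I_n -> R) : closed (cbox a b).
Proof.
have -> : cbox a b = \bigcap_(i in [set: 'I_n])
    ((fun x : 'rV[R]_n => x ord0 i) @^-1` [set` `[a i, b i]]).
  by apply/seteqP; split=> x /= h i; [move=> _; exact: h|exact: h].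
apply: closed_bigI => i _.
by apply: closed_comp => [x _|]; [exact: coord_continuous|exact: interval_closed].
Qed.

Lemma cbox_compact (a b : 'I_n -> R) : compact (cbox a b).
Proof. have := @rV_compact R n (fun i => [set` `[a i, b i]]).
by apply => i; exact: segment_compact. Qed.

Lemma smooth_box_bump a b k : smooth (box_bump a b k).
Proof.
by apply: smooth_prod => i _; apply: smoothM; exact: smooth_flat_coord.
Qed.

Lemma box_bump_neq0 a b k x : box_bump a b k x != 0 <-> obox a b x.
Proof.
have E i : (flat 1 (k.+1%:R * (x ord0 i - a i)) * flat 1 (- k.+1%:R * (x ord0 i - b i)) != 0 :> R)
    = (x ord0 i \in `]a i, b i[).
  rewrite mulf_eq0 negb_or !flat1_gt0 pmulr_rgt0 ?ltr0Sn// mulNr oppr_gt0 pmulr_rlt0 ?ltr0Sn//.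
  by rewrite subr_gt0 subr_lt0 in_itv.
split=> [/prodf_neq0 h i|h]; first by rewrite -E; exact: h.
by apply/prodf_neq0 => i _; rewrite E; exact: h.
Qed.

Lemma test_box_bump U a b k : cbox a b `<=` U -> test_function U (box_bump a b k).
Proof.
move=> hU.
have sub : supp (box_bump a b k) `<=` cbox a b.
  have -> : cbox a b = closure (cbox a b).
    by rewrite -(closure_id _).1//; exact: cbox_closed.
  apply: closure_subset => x /= /box_bump_neq0 h i; have := h i.
  by rewrite !in_itv/= => /andP[/ltW -> /ltW ->].
split; first exact: smooth_box_bump.
  apply: (subclosed_compact _ (@cbox_compact a b)) => //; exact: closed_closure.
exact: subset_trans hU.
Qed.

Lemma box_bump_le1 a b k x : 0 <= box_bump a b k x <= 1.
Proof.
apply/andP; split; first by apply: prodr_ge0 => i _; rewrite mulr_ge0// flat1_ge0.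
by apply: prodr_ile1 => i _; rewrite mulr_ge0 ?flat1_ge0//= mulr_ile1 ?flat1_ge0 ?flat1_le1.
Qed.

Lemma cvg_box_bump a b x : box_bump a b k x @[k --> \oo] --> (\1_(obox a b) x : R).
Proof.
have -> : (\1_(obox a b) x : R) = \prod_i ((0 < x ord0 i - a i)%R%:R * (0 < - (x ord0 i - b i))%R%:R).
  have E i : (0 < x ord0 i - a i)%R%:R * (0 < - (x ord0 i - b i))%R%:R =
     (x ord0 i \in `]a i, b i[)%:R :> R.
    by rewrite -natrM mulnb in_itv/= subr_gt0 oppr_gt0 subr_lt0.
  under eq_bigr do rewrite E.
  rewrite indicE; have [h|h] := pselect (obox a b x).
    by rewrite mem_set// big1// => i _; rewrite h.
  rewrite memNset//; apply/esym/eqP; apply/negPn/negP => /prodf_neq0 H; apply: h => i.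
  by have := H i isT; rewrite pnatr_eq0; case: (_ \in _).
apply: cvg_big => [|i _]; first exact: mul_continuous.
apply: cvgM; first exact: cvg_flat1.
under eq_fun do rewrite mulNr -mulrN.
exact: cvg_flat1.
Qed.

End test_functions.

(** * Integration by parts *)

Section integration_by_parts.
Context {R : realType} {n : nat}.
Implicit Types (f g phi psi : 'rV[R]_n -> R) (x : 'rV[R]_n) (U : set 'rV[R]_n).

Lemma measurable_shift (c : 'rV[R]_n) : measurable_fun [set: 'rV[R]_n] (fun x => x + c).
Proof.
apply: measurable_rVP => i; under eq_fun do rewrite !mxE.
by apply: measurable_funD => //; exact: measurable_rV_coord.
Qed.

Lemma cvg_cst0_eq (l : \bar R) : (fun=> 0%E : \bar R) @ \oo --> l -> l = 0%E.
Proof. by move=> /(cvg_lim (@ereal_hausdorff R)) <-; rewrite lim_cst. Qed.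

Lemma integral_leb_shift (c : 'rV[R]_n) (f : 'rV[R]_n -> \bar R) :
  measurable_fun [set: 'rV[R]_n] f ->
  (\int[leb n]_x f (x + c)%R = \int[leb n]_x f x)%E.
Proof.
move=> mf; have H (h : 'rV[R]_n -> \bar R) : measurable_fun [set: 'rV[R]_n] h ->
    (forall x, 0 <= h x)%E -> (\int[leb n]_x h (x + c)%R = \int[leb n]_x h x)%E.
  move=> mh h0; have := ge0_integral_leb_affine c ltr01 mh h0.
  rewrite expr1n invr1 mul1e => <-.
  by apply: eq_integral => x _; rewrite scale1r.
rewrite integralE [RHS]integralE; congr (_ - _)%E.
  rewrite -(H f^\+%E (measurable_funepos mf)); last by move=> x; exact: funepos_ge0.
  by apply: eq_integral => x _; rewrite !funeposE.
rewrite -(H f^\-%E (measurable_funeneg mf)); last by move=> x; exact: funeneg_ge0.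
by apply: eq_integral => x _; rewrite !funenegE.
Qed.

Lemma is_derive_line f x v (t : R) : derivable f (x + t *: v) v ->
  is_derive t 1 (fun s => f (x + s *: v)) ('D_v f (x + t *: v)).
Proof.
move=> df; have E : (fun h : R => h^-1 *: (((fun s => f (x + s *: v)) \o shift t) (h *: (1 : R)) - f (x + t *: v)))
    = (fun h => h^-1 *: ((f \o shift (x + t *: v)) (h *: v) - f (x + t *: v))).
  apply/funext => h /=; congr (_ *: (f _ - _)).
  by rewrite [h *: 1]mulr1 scalerDl addrCA.
by split; rewrite /derivable /derive E.
Qed.

Lemma cvg_difference_quotient f x v : derivable f x v ->
  k.+1%:R * (f (x + k.+1%:R^-1 *: v) - f x) @[k --> \oo] --> 'D_v f x.
Proof.
move=> df.
have H : (k.+1%:R^-1 : R) @[k --> \oo] --> (0 : R)^'.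
  move=> A /= A0; have : \forall k \near \oo, (k.+1%:R^-1 : R) != 0 -> A (k.+1%:R^-1).
    exact: (@cvg_harmonic R _ A0).
  by apply: filterS => k; apply; rewrite invr_eq0 pnatr_eq0.
have := cvg_comp _ _ H df; apply: cvg_trans; apply: near_eq_cvg; near=> k.
by rewrite /= invrK [_ *: v + x]addrC.
Unshelve. all: by end_near. Qed.

Lemma mean_value_bound f v (M : R) : (forall x, derivable f x v) ->
  (forall x, `|'D_v f x| <= M) -> forall x (t : R), 0 < t -> `|f (x + t *: v) - f x| <= M * t.
Proof.
move=> df hM x t t0.
have [] := @MVT R (fun s => f (x + s *: v)) (fun s => 'D_v f (x + s *: v)) 0 t t0.
- by move=> s _; exact: is_derive_line.
- apply: derivable_within_continuous => s _.
  by have [] := is_derive_line (df (x + s *: v)).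
move=> s _; rewrite scale0r addr0 subr0 => ->.
by rewrite normrM (gtr0_norm t0) ler_wpM2r// ltW.
Qed.

(** The integrals of the difference quotients vanish by translation invariance, and
    the quotients are dominated because the derivative is bounded and the support
    compact. *)
Lemma integral_pderive U i phi : test_function U phi ->
  (\int[leb n]_x (pderive i phi x)%:E = 0)%E.
Proof.
move=> tphi; have [sphi cphi _] := tphi.
have dphi x v : derivable phi x v.
  by apply: diff_derivable; exact: smooth_differentiable.
have [M M0 hM] := test_bounded (test_pderive i tphi).
have [r r0 hr] := box_bounded_compact cphi.
pose e : 'rV[R]_n := delta_mx ord0 i.
have cphi' := test_continuous tphi.
have mphi : measurable_fun [set: 'rV[R]_n] phi by exact: continuous_measurable_rV.
pose F (k : nat) x := (k.+1%:R * (phi (x + k.+1%:R^-1 *: e) - phi x))%:E.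
have mphis c : measurable_fun [set: 'rV[R]_n] (fun x => phi (x + c)).
  by apply: (measurableT_comp mphi); exact: measurable_shift.
have mF k : measurable_fun [set: 'rV[R]_n] (F k).
  apply/measurable_EFinP; apply: measurable_funM => //.
  by apply: measurable_funB.
have F0 k : (\int[leb n]_x F k x = 0)%E.
  have i1 : (leb n).-integrable setT (EFin \o phi) by exact: test_integrable tphi.
  have i2 : (leb n).-integrable setT (EFin \o (fun x => phi (x + k.+1%:R^-1 *: e))).
    apply/integrableP; split; first exact/measurable_EFinP.
    have /integrableP[_] := i1; apply: le_lt_trans; rewrite le_eqVlt; apply/orP; left; apply/eqP.
    apply: (integral_leb_shift (k.+1%:R^-1 *: e) (f := fun x => `|(phi x)%:E|%E)).
    by apply: measurableT_comp => //; exact/measurable_EFinP.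
  transitivity (\int[leb n]_x (k.+1%:R%:E * ((phi (x + k.+1%:R^-1 *: e))%:E - (phi x)%:E)))%E.
    by apply: eq_integral => x _; rewrite -EFinB -EFinM.
  rewrite integralZl//; last exact: integrableB.
  rewrite integralB// (integral_leb_shift (k.+1%:R^-1 *: e) (f := EFin \o phi)); last exact/measurable_EFinP.
  by rewrite subee ?mule0//; exact: integrable_fin_num.
pose g x : \bar R := (M * \1_(cube n (r + 1)) x)%:E.
have mc : measurable (cube n (r + 1)) by exact: measurable_cube.
have ig : (leb n).-integrable setT g.
  have -> : g = (fun x => M%:E * (\1_(cube n (r + 1)) x)%:E)%E by [].
  apply: integrableZl => //; apply/integrableP; split.
    by apply/measurable_EFinP; exact: measurable_indic.
  under eq_integral do rewrite gee0_abs//.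
  have cf : (leb n (cube n (r + 1)) < +oo)%E by rewrite leb_cube ?ltry// addr_ge0.
  by rewrite integral_indic// setIT; exact: cf.
have out x : ~ cube n r x -> phi x = 0 by move=> h; apply: supp0 => /hr.
have dom k x : (`|F k x| <= g x)%E.
  rewrite /F /g abse_EFin lee_fin.
  have [h|h] := pselect (cube n (r + 1) x).
    rewrite indicE mem_set// mulr1 normrM ger0_norm// mulrC -ler_pdivlMr ?ltr0Sn//.
    by apply: mean_value_bound.
  rewrite (out x) ?(out (x + _)) ?subrr ?mulr0 ?normr0 ?mulr_ge0//.
  - move=> h'; apply: h => j; have := h' j; rewrite !mxE !in_itv/=.
    have k1 : (k.+1%:R^-1 : R) <= 1 by rewrite invf_le1// ler1n.
    have k0 : 0 <= (k.+1%:R^-1 : R) by rewrite invr_ge0.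
    have [k2 k3] : 0 <= k.+1%:R^-1 * (j == i)%:R :> R /\ k.+1%:R^-1 * (j == i)%:R <= 1 :> R.
      by case: (j == i); rewrite ?mulr1 ?mulr0 ?ler01.
    by move: k2 k3; move: (_ * _) => t t0 t1 /andP[h1 h2]; apply/andP; split; lra.
  - by move=> h'; apply: h => j; have := h' j; rewrite !in_itv/= => /andP[h1 h2]; apply/andP; split; lra.
have C x : F k x @[k --> \oo] --> (pderive i phi x)%:E.
  by apply: cvg_EFin; [exact: nearW|exact: cvg_difference_quotient].
have := @dominated_cvg _ _ R (leb n) setT measurableT F (EFin \o pderive i phi) g mF
  (fun x _ => C x) (fun x _ => isT) ig (fun k x _ => dom k x).
under eq_fun do rewrite F0.
exact: cvg_cst0_eq.
Qed.

End integration_by_parts.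

(** * The fundamental lemma of the calculus of variations *)

Section fundamental_lemma.
Context {R : realType} {n : nat}.
Implicit Types (f g phi psi : 'rV[R]_n -> R) (x : 'rV[R]_n) (U : set 'rV[R]_n).

Definition oboxes : set (set 'rV[R]_n) := [set A | exists a b, A = obox a b].

Lemma oboxI (a b a' b' : 'I_n -> R) : obox a b `&` obox a' b' =
  obox (fun i => Num.max (a i) (a' i)) (fun i => Num.min (b i) (b' i)).
Proof.
apply/seteqP; split=> x /=.
  move=> [h h'] i; move: (h i) (h' i).
  by rewrite !in_itv/= gt_max lt_min => /andP[-> ->] /andP[-> ->].
by move=> h; split=> i; have := h i; rewrite !in_itv/= gt_max lt_min => /andP[/andP[? ?] /andP[? ?]]; apply/andP.
Qed.

Lemma oboxes_setI : setI_closed oboxes.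
Proof. by move=> _ _ [a [b ->]] [a' [b' ->]]; do 2 eexists; exact: oboxI. Qed.

Lemma measurable_oboxes : (measurable : set (set 'rV[R]_n)) = <<s oboxes >>.
Proof.
apply/seteqP; split; last first.
  apply: smallest_sub; first exact: sigma_algebra_measurable.
  by move=> _ [a [b ->]]; exact: measurable_obox.
apply: smallest_sub; first exact: smallest_sigma_algebra.
move=> A; rewrite -bigcup_seq => -[i _ [B mB <-]].
have : measurable_fun setT ((fun x => x ord0 i) : g_sigma_algebraType oboxes -> R).
  apply: (measurability _ (measurable_realfun.RGenOpens.measurableE R)).
  move=> _ [_ [a [b ->]] <-].
  rewrite [X in _ X](_ : _ = \bigcup_k
      obox (fun j => if j == i then a else - k%:R) (fun j => if j == i then b else k%:R)).
    apply: bigcupT_measurable => k; apply: sub_sigma_algebra.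
    by do 2 eexists.
  apply/seteqP; split=> x /=; last first.
    by move=> [k _ /(_ i)]; rewrite !eqxx.
  move=> [_ xab]; have [k hk] : exists k : nat, `|x| < k%:R.
    by exists (Num.bound `|x|); exact: archi_boundP.
  exists k => // j; case: eqP => [->//|_].
  by rewrite in_itv/= -ltr_norml (le_lt_trans (coord_le_norm _ _)).
by move=> /(_ measurableT B mB).
Qed.

Lemma integral_setC_eq0 (D S : set 'rV[R]_n) g : measurable D -> measurable S ->
  (leb n).-integrable D (EFin \o g) ->
  (\int[leb n]_(x in D) (g x)%:E = 0 -> \int[leb n]_(x in S `&` D) (g x)%:E = 0 ->
   \int[leb n]_(x in ~` S `&` D) (g x)%:E = 0)%E.
Proof.
move=> mD mS iD D0 S0.
have DE : D = (S `&` D) `|` (~` S `&` D) by rewrite -setIUl setUv setTI.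
move: D0; rewrite [in X in X -> _]DE integral_setU.
- by rewrite S0 add0e.
- exact: measurableI.
- by apply: measurableI => //; exact: measurableC.
- by rewrite -DE; exact: measurable_int iD.
- by apply/disj_setPS => x [[Sx _] []].
Qed.

(** The box case of the fundamental lemma; boxes are a pi-system generating the
    measurable sets, hence the indefinite integral vanishes identically. *)
Lemma ae_eq0_obox a b g : (leb n).-integrable (obox a b) (EFin \o g) ->
  (forall a' b', (\int[leb n]_(x in obox a' b' `&` obox a b) (g x)%:E = 0)%E) ->
  {ae leb n, forall x, obox a b x -> g x = 0}.
Proof.
set D := obox a b => iD h0.
have mD : measurable D by exact: measurable_obox.
have D0 : (\int[leb n]_(x in D) (g x)%:E = 0)%E by have := h0 a b; rewrite setIid.
have all0 S : measurable S -> (\int[leb n]_(x in S `&` D) (g x)%:E = 0)%E.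
  move=> mS; move: (mS); rewrite measurable_oboxes.
  apply: (dynkin_induction (P := fun S => (\int[leb n]_(x in S `&` D) (g x)%:E = 0)%E)
    measurable_oboxes oboxes_setI).
  - by rewrite setTI.
  - by move=> _ [a' [b' ->]]; exact: h0.
  - by move=> S' mS' S'0; exact: integral_setC_eq0.
  - move=> F mF tF F0; rewrite setI_bigcupl integral_bigcup.
    + by apply: eseries0 => k _ _; exact: F0.
    + by apply: trivIset_setIr.
    + by move=> k; apply: measurableI.
    + apply: (integrableS mD) => //; first by apply: bigcupT_measurable => k; exact: measurableI.
      by move=> x [k _ []].
have : ae_eq (leb n) D (EFin \o g) (cst 0%E).
  apply: (integral_ae_eq mD iD (measurable_cst _)) => E ED mE.
  rewrite integral_cst// mul0e.
  by have := all0 _ mE; rewrite (setIidl ED).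
by apply: filterS => x /= hx Dx; have [] := hx Dx.
Qed.

Lemma ae_countable (T : countType) (P : T -> 'rV[R]_n -> Prop) :
  (forall c, {ae leb n, forall x, P c x}) -> {ae leb n, forall x, forall c, P c x}.
Proof.
move=> h; pose Q k x := if unpickle k is Some c then P c x else True.
have : {ae leb n, forall x, forall k, Q k x}.
  apply: ae_foralln => k; rewrite /Q; case: (unpickle k) => [c|]; first exact: h.
  exact: aeW.
by apply: filterS => x hx c; have := hx (pickle c); rewrite /Q pickleK.
Qed.

(** Stretched box bumps converge to the indicators of the open boxes and are
    uniformly bounded, so that the hypothesis passes to all boxes; countably many of
    them cover the open set. *)
Theorem ae_eq0_test U g : open U -> measurable_fun U g ->
  (forall K, K `<=` U -> compact K -> (leb n).-integrable K (EFin \o g)) ->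
  (forall phi, test_function U phi -> \int[leb n]_(x in U) (g x * phi x) = 0) ->
  {ae leb n, forall x, U x -> g x = 0}.
Proof.
move=> oU mg ig h0.
have mU := open_measurable_rV oU.
have box a b : cbox a b `<=` U -> (\int[leb n]_(x in obox a b) (g x)%:E = 0)%E.
  move=> cU.
  have cc := @cbox_compact _ _ a b.
  have mc : measurable (cbox a b) by apply: closed_measurable_rV; exact: cbox_closed.
  have ic := ig _ cU cc.
  have mo := measurable_obox a b.
  have mgc : measurable_fun (cbox a b) g by exact: measurable_funS mg.
  pose F k x := (g x * box_bump a b k x)%:E.
  have mb k (A : set 'rV[R]_n) : measurable A -> measurable_fun A (box_bump a b k).
    by move=> mA; apply: continuous_measurable_rV => //; apply: smooth_continuous; exact: smooth_box_bump.
  have F0 k : (\int[leb n]_(x in cbox a b) F k x = 0)%E.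
    have tk := test_box_bump k cU.
    have iF : (leb n).-integrable (cbox a b) (F k).
      apply: (le_integrable mc _ _ ic).
        apply/measurable_EFinP; apply: measurable_funM => //; exact: mb.
      move=> x _; rewrite /F /= lee_fin normrM ler_piMr//.
      by have /andP[? ?] := box_bump_le1 a b k x; rewrite ger0_norm.
    have := h0 _ tk; rewrite /Rintegral.
    have -> : (\int[leb n]_(x in U) (g x * box_bump a b k x)%:E =
               \int[leb n]_(x in cbox a b) F k x)%E.
      rewrite integral_mkcond [RHS]integral_mkcond; apply: eq_integral => x _.
      rewrite !patchE /F; case: ifPn => hU; case: ifPn => hc //.
        have -> : box_bump a b k x = 0; last by rewrite mulr0.
        apply/eqP/negPn/negP => /box_bump_neq0 /subset_obox_cbox.
        by move: hc; rewrite notin_setE.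
      by move: hU; rewrite notin_setE => nU; move: hc; rewrite inE => /cU.
    by move=> f0; rewrite -[LHS]fineK ?f0//; exact: integrable_fin_num.
  have C x : F k x @[k --> \oo] --> (g x * \1_(obox a b) x)%:E.
    apply: cvg_EFin; first exact: nearW.
    by apply: cvgM; [exact: cvg_cst|exact: cvg_box_bump].
  have mF k : measurable_fun (cbox a b) (F k).
    by apply/measurable_EFinP; apply: measurable_funM => //; exact: mb.
  have dom k x : (`|F k x| <= `|(g x)%:E|)%E.
    rewrite /F /= lee_fin normrM ler_piMr//.
    by have /andP[? ?] := box_bump_le1 a b k x; rewrite ger0_norm.
  have := @dominated_cvg _ _ R (leb n) _ mc F (fun x => (g x * \1_(obox a b) x)%:E)
    (fun x => `|(g x)%:E|%E) mF (fun x _ => C x) (fun x _ => isT)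
    (integrable_abse ic) (fun k x _ => dom k x).
  under eq_fun do rewrite F0.
  move=> /cvg_cst0_eq <-.
  rewrite [LHS]integral_mkcond [RHS]integral_mkcond; apply: eq_integral => x _.
  rewrite !patchE indicE; case: ifPn => ho.
    by rewrite ifT ?mulr1//; move: ho; rewrite !inE; exact: subset_obox_cbox.
  by rewrite mulr0; case: ifP.
have boxae a b : cbox a b `<=` U -> {ae leb n, forall x, obox a b x -> g x = 0}.
  move=> cU; apply: ae_eq0_obox.
    apply: (integrableS _ _ (@subset_obox_cbox _ _ a b)) => //.
    - by apply: closed_measurable_rV; exact: cbox_closed.
    - exact: measurable_obox.
    - by apply: ig => //; exact: cbox_compact.
  move=> a' b'; rewrite oboxI; apply: box => x h; apply: cU => i; have := h i.
  by rewrite !in_itv/= ge_max le_min => /andP[/andP[_ ->] /andP[_ ->]].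
have : {ae leb n, forall x, forall c, cbox (rat_lo c) (rat_hi c) `<=` U ->
    obox (rat_lo c) (rat_hi c) x -> g x = 0}.
  apply: ae_countable => c.
  have [cU|ncU] := pselect (cbox (rat_lo c) (rat_hi c) `<=` U).
    by apply: filterS (boxae _ _ cU) => x hx _.
  by apply: aeW => x /ncU.
apply: filterS => x hx; rewrite {1}(open_rat_boxes oU) => -[c cU xc]; exact: hx xc.
Qed.

End fundamental_lemma.

(** * Square integrable functions *)

Section square_integrable_functions.
Context {R : realType} {n : nat}.
Variable Omega : set 'rV[R]_n.
Hypothesis mO : measurable Omega.
Implicit Types (f g h : 'rV[R]_n -> R).
Local Notation si := (square_integrable Omega).
Local Notation ip := (ip Omega).
Local Notation L2norm := (L2norm Omega).

Lemma si_integrable_mul f g : si f -> si g ->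
  (leb n).-integrable Omega (fun x => (f x * g x)%:E).
Proof.
move=> [mf f2] [mg g2].
apply: (@le_integrable _ _ _ (leb n) Omega mO _ (fun x => (f x ^+ 2)%:E + (g x ^+ 2)%:E)%E).
- by apply/measurable_EFinP; exact: measurable_funM.
- move=> x _; rewrite -EFinD !abse_EFin lee_fin normrM.
  rewrite [leRHS]ger0_norm ?addr_ge0 ?sqr_ge0//.
  rewrite -(real_normK (num_real (f x))) -(real_normK (num_real (g x))).
  have := sqr_ge0 (`|f x| - `|g x|); have := normr_ge0 (f x); have := normr_ge0 (g x).
  by move: `|f x| `|g x| => u v; nra.
- exact: integrableD.
Qed.

Lemma si_sq f : si f -> (leb n).-integrable Omega (fun x => (f x * f x)%:E).
Proof. by move=> sf; exact: si_integrable_mul. Qed.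

(** The square of a sum is at most twice the sum of the squares. *)
Lemma si_dominated f g h : si g -> si h -> measurable_fun Omega f ->
  {ae leb n, forall x, Omega x -> `|f x| <= `|g x| + `|h x|} -> si f.
Proof.
move=> [mg g2] [mh h2] mf; move=> [N [mN N0 hN]]; split => //.
have mf2 : measurable_fun Omega (fun x => (f x ^+ 2)%:E).
  by apply/measurable_EFinP; exact: measurable_funX.
apply/(negligible_integrable mN mO mf2 N0).
have mON : measurable (Omega `\` N) by exact: measurableD.
apply: (@le_integrable _ _ _ (leb n) _ mON _ (fun x => 2%:E * ((g x ^+ 2)%:E + (h x ^+ 2)%:E))%E).
- by apply: measurable_funS mf2.
- move=> x [Ox Nx].
  have {hN}hx : `|f x| <= `|g x| + `|h x|.
    by apply: contrapT => H; apply: Nx; apply: hN => /(_ Ox).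
  rewrite -EFinD -EFinM !abse_EFin lee_fin [leLHS]ger0_norm ?sqr_ge0//.
  rewrite [leRHS]ger0_norm ?mulr_ge0 ?addr_ge0 ?sqr_ge0//.
  rewrite -(real_normK (num_real (f x))) -(real_normK (num_real (g x))) -(real_normK (num_real (h x))).
  have := normr_ge0 (f x); have := normr_ge0 (g x); have := normr_ge0 (h x).
  have := sqr_ge0 (`|g x| - `|h x|).
  by move: `|f x| `|g x| `|h x| hx => u v w; nra.
- apply: integrableZl => //; apply: (integrableS mO mON) => //.
  exact: integrableD.
Qed.

Lemma si0 : si (cst 0).
Proof.
split; first exact: measurable_cst.
rewrite (_ : (fun x => _) = cst 0%E); first exact: integrable0.
by apply/funext => x; rewrite expr0n.
Qed.

Lemma si_bounded_mul f h (B : R) : si f -> measurable_fun Omega h -> 0 <= B ->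
  (forall x, Omega x -> `|h x| <= B) -> si (fun x => h x * f x).
Proof.
move=> [mf f2] mh B0 hB; split; first exact: measurable_funM.
apply: (@le_integrable _ _ _ (leb n) _ mO _ (fun x => (B ^+ 2)%:E * (f x ^+ 2)%:E)%E).
- by apply/measurable_EFinP; apply: measurable_funX; exact: measurable_funM.
- move=> x Ox; rewrite -EFinM !abse_EFin lee_fin exprMn !normrM.
  by rewrite ler_wpM2r ?mulr_ge0// ler_pM// (ger0_norm B0) hB.
- exact: integrableZl.
Qed.

Lemma si_scale (a : R) f : si f -> si (fun x => a * f x).
Proof.
by move=> sf; apply: (si_bounded_mul sf (B := `|a|)).
Qed.

Lemma si_lin (a : R) f g : si f -> si g -> si (fun x => a * f x + g x).
Proof.
move=> sf sg; apply: (si_dominated (si_scale a sf) sg).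
  apply: measurable_funD; last exact: sg.1.
  by apply: measurable_funM => //; exact: sf.1.
by apply: aeW => x _; exact: ler_normD.
Qed.

Lemma si_sum (I : Type) (r : seq I) (F : I -> 'rV[R]_n -> R) :
  (forall i, si (F i)) -> si (fun x => \sum_(i <- r) F i x).
Proof.
move=> h; elim: r => [|i r IH].
  by under eq_fun do rewrite big_nil; exact: si0.
under eq_fun do rewrite big_cons -[F i _]mul1r.
exact: si_lin.
Qed.

Lemma si_ae f g : si f -> measurable_fun Omega g ->
  {ae leb n, forall x, Omega x -> g x = f x} -> si g.
Proof.
move=> sf mg h; apply: (si_dominated sf si0 mg).
by apply: filterS h => x hx Ox; rewrite hx// normr0 addr0.
Qed.

Lemma Rintegral_ae f g : measurable_fun Omega f -> measurable_fun Omega g ->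
  {ae leb n, forall x, Omega x -> f x = g x} ->
  \int[leb n]_(x in Omega) f x = \int[leb n]_(x in Omega) g x.
Proof.
move=> mf mg fg; congr fine; apply: ae_eq_integral => //.
- exact/measurable_EFinP.
- exact/measurable_EFinP.
- by apply: filterS fg => x hx Ox; rewrite hx.
Qed.

Lemma ipC f g : ip f g = ip g f.
Proof. by congr fine; apply: eq_integral => x _; rewrite mulrC. Qed.

Lemma ip_linl (a : R) f g h : si f -> si g -> si h ->
  ip (fun x => a * f x + g x) h = a * ip f h + ip g h.
Proof.
move=> sf sg sh; rewrite /Defs.ip.
have i1 := si_integrable_mul sf sh; have i2 := si_integrable_mul sg sh.
have i3 : (leb n).-integrable Omega (EFin \o (fun x => a * (f x * h x))).
  exact: (integrableZl mO a i1).
rewrite -RintegralZl// -RintegralD//.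
by apply: eq_Rintegral => x _; rewrite mulrDl mulrA.
Qed.

Lemma ip_linr (a : R) f g h : si f -> si g -> si h ->
  ip h (fun x => a * f x + g x) = a * ip h f + ip h g.
Proof. by move=> sf sg sh; rewrite ipC ip_linl// !(ipC h). Qed.

Lemma ip_ge0 f : 0 <= ip f f.
Proof. by apply: Rintegral_ge0 => x _; rewrite -expr2 sqr_ge0. Qed.

Lemma L2norm_ge0 f : 0 <= L2norm f.
Proof. exact: sqrtr_ge0. Qed.

Lemma L2norm_sq f : L2norm f ^+ 2 = ip f f.
Proof. by rewrite sqr_sqrtr// ip_ge0. Qed.

Lemma quadratic_CS (A B C : R) : 0 <= A -> 0 <= C ->
  (forall t, 0 <= t ^+ 2 * A + 2 * t * B + C) -> B ^+ 2 <= A * C.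
Proof.
move=> A0 C0 h; have [A1|A1] := eqVneq A 0.
  rewrite A1 mul0r; rewrite A1 in h; have [->|B0] := eqVneq B 0; first by rewrite expr0n.
  have := h (- (C + 1) / (2 * B)); rewrite mulr0 add0r.
  have -> : 2 * (- (C + 1) / (2 * B)) * B + C = -1 by field.
  by rewrite ler0N1.
have A2 : 0 < A by rewrite lt_neqAle eq_sym A1.
have := h (- B / A).
have -> : (- B / A) ^+ 2 * A + 2 * (- B / A) * B + C = (A * C - B ^+ 2) / A by field.
by rewrite pmulr_lge0 ?invr_gt0// subr_ge0.
Qed.

Lemma ip_CS f g : si f -> si g -> `|ip f g| <= L2norm f * L2norm g.
Proof.
move=> sf sg; rewrite -sqrtrM ?ip_ge0// -sqrtr_sqr ler_sqrt ?mulr_ge0 ?ip_ge0//.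
apply: quadratic_CS => [||t]; [exact: ip_ge0|exact: ip_ge0|].
have := ip_ge0 (fun x => t * f x + g x).
by rewrite ip_linl ?ip_linr//; [|exact: si_lin]; rewrite (ipC g f); lra.
Qed.

Lemma L2normD (a : R) f g : si f -> si g ->
  L2norm (fun x => a * f x + g x) <= `|a| * L2norm f + L2norm g.
Proof.
move=> sf sg.
rewrite -(@ler_pXn2r _ 2)// ?nnegrE ?addr_ge0 ?mulr_ge0 ?L2norm_ge0//.
rewrite L2norm_sq ip_linl ?ip_linr//; last exact: si_lin.
rewrite (ipC g f) -!L2norm_sq.
have := ip_CS sf sg; rewrite ler_norml => /andP[h1 h2].
have a2 : a ^+ 2 = `|a| ^+ 2 by rewrite real_normK ?num_real.
have : a * ip f g <= `|a| * (L2norm f * L2norm g).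
  by rewrite (le_trans (ler_norm _))// normrM ler_wpM2l//; exact: ip_CS.
by move=> hh; rewrite sqrrD exprMn -a2; lra.
Qed.

Lemma L2norm_ae f g : measurable_fun Omega f -> measurable_fun Omega g ->
  {ae leb n, forall x, Omega x -> f x = g x} -> L2norm f = L2norm g.
Proof.
move=> mf mg fg; congr Num.sqrt; apply: Rintegral_ae.
- exact: measurable_funM.
- exact: measurable_funM.
- by apply: filterS fg => x hx Ox; rewrite hx.
Qed.

End square_integrable_functions.

(** * Weak derivatives and Sobolev functions *)

Section weak_derivatives.
Context {R : realType} {n : nat}.
Implicit Types (f g h u v phi psi : 'rV[R]_n -> R) (Omega U : set 'rV[R]_n).

Lemma Rintegral_test_sub Omega U f phi : U `<=` Omega -> test_function U phi ->
  \int[leb n]_(x in Omega) (f x * phi x) = \int[leb n]_(x in U) (f x * phi x).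
Proof.
move=> UO tphi; rewrite Rintegral_mkcond [RHS]Rintegral_mkcond.
apply: eq_Rintegral => x _; rewrite !patchE.
case: ifPn => hO; case: ifPn => hU //.
  by rewrite (test_out tphi) ?mulr0//; move: hU; rewrite notin_setE.
by move: hO; rewrite notin_setE => nO; move: hU; rewrite inE => /UO.
Qed.

Lemma continuous_loc_integrable Omega f : open Omega -> continuous f -> loc_integrable Omega f.
Proof.
move=> oO cf; split.
  by apply: continuous_measurable_rV => //; exact: open_measurable_rV.
move=> K KO cK; have mK : measurable K by apply: closed_measurable_rV; exact: compact_closed.
have [M M0 hM] := continuous_compact_bounded cK (continuous_subspaceT cf).
apply: (bounded_integrable_leb (M := M)) => //; first exact: box_bounded_compact.
exact: continuous_measurable_rV.
Qed.

Lemma loc_integrable_lin Omega (a : R) f g : loc_integrable Omega f -> loc_integrable Omega g ->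
  loc_integrable Omega (fun x => a * f x + g x).
Proof.
move=> [mf lf] [mg lg]; split.
  by apply: measurable_funD => //; apply: measurable_funM.
move=> K KO cK; have mK : measurable K by apply: closed_measurable_rV; exact: compact_closed.
apply: (@integrableD _ _ _ _ _ mK (fun x => (a * f x)%:E) (fun x => (g x)%:E)); last exact: lg.
exact: (integrableZl mK a (lf _ KO cK)).
Qed.

Lemma loc_test_integrable Omega f phi : open Omega -> loc_integrable Omega f ->
  test_function Omega phi -> (leb n).-integrable Omega (EFin \o (fun x => f x * phi x)).
Proof.
move=> oO [mf lf] tphi; have mO := open_measurable_rV oO.
have [_ cK KO] := tphi; set K := closure _ in cK KO.
have mK : measurable K by apply: closed_measurable_rV; exact: compact_closed.
have [M M0 hM] := test_bounded tphi.
have lK := lf _ KO cK.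
have iK : (leb n).-integrable K (EFin \o (fun x => f x * phi x)).
  apply: (@le_integrable _ _ _ (leb n) K mK _ (fun x => M%:E * (f x)%:E)%E).
  - apply/measurable_EFinP; apply: measurable_funM; first exact: measurable_funS mf.
    by apply: continuous_measurable_rV => //; exact: test_continuous tphi.
  - move=> x _; rewrite -EFinM !abse_EFin lee_fin !normrM mulrC ler_wpM2r//.
    by rewrite (ger0_norm M0).
  - exact: integrableZl.
apply/(integrable_mkcond _ mO).
rewrite (_ : _ \_ Omega = (EFin \o (fun x => f x * phi x)) \_ K).
  exact/(integrable_mkcond _ mK).
apply/funext => x; rewrite !patchE; case: ifPn => hO; case: ifPn => hK //=.
  by rewrite (@supp0 _ _ phi) ?mulr0//; move: hK; rewrite notin_setE.
by move: hO; rewrite notin_setE => nO; move: hK; rewrite inE => /KO.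
Qed.

(** The difference of two weak derivatives is orthogonal to all test functions. *)
Lemma weak_unique Omega i u g h : open Omega ->
  weak_pderivative Omega i u g -> weak_pderivative Omega i u h ->
  {ae leb n, forall x, Omega x -> g x = h x}.
Proof.
move=> oO [_ lg wg] [_ lh wh]; have mO := open_measurable_rV oO.
have [md ld] := loc_integrable_lin (-1) lh lg.
have := ae_eq0_test oO md ld; have H phi : test_function Omega phi ->
    \int[leb n]_(x in Omega) ((-1 * h x + g x) * phi x) = 0.
  move=> tphi; have ig := loc_test_integrable oO lg tphi.
  have ih := loc_test_integrable oO lh tphi.
  rewrite (_ : (fun x => _) = (fun x => g x * phi x - h x * phi x)); last first.
    by apply/funext => x; ring.
  rewrite RintegralB//; have := wg _ tphi; rewrite wh//; lra.
by move=> /(_ H); apply: filterS => x hx Ox; have := hx Ox; lra.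
Qed.

Lemma weak_sub Omega U i u g : open Omega -> U `<=` Omega ->
  weak_pderivative Omega i u g -> measurable U -> weak_pderivative U i u g.
Proof.
move=> oO UO [[mu lu] [mg lg] w] mU; have mO := open_measurable_rV oO; split.
- by split; [exact: measurable_funS mu|move=> K KU; apply: lu; exact: subset_trans UO].
- by split; [exact: measurable_funS mg|move=> K KU; apply: lg; exact: subset_trans UO].
move=> phi tphi; rewrite -(Rintegral_test_sub u UO (test_pderive i tphi)).
by rewrite -(Rintegral_test_sub g UO tphi); apply: w; exact: test_functionW UO tphi.
Qed.

Lemma weak_ext Omega i u v g : {in Omega, u =1 v} ->
  weak_pderivative Omega i u g -> weak_pderivative Omega i v g.
Proof.
move=> uv [[mu lu] lg w]; split=> //.
- split; first exact: eq_measurable_fun mu.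
  move=> K KO cK; apply: eq_integrable (lu K KO cK); last first.
    by move=> x; rewrite inE => /KO Ox /=; rewrite uv// inE.
  by apply: closed_measurable_rV; exact: compact_closed.
- move=> phi tphi; rewrite -w//; apply: eq_Rintegral => x xO.
  by rewrite uv.
Qed.

Lemma weak_lin Omega i (a : R) u v g h : open Omega ->
  weak_pderivative Omega i u g -> weak_pderivative Omega i v h ->
  weak_pderivative Omega i (fun x => a * u x + v x) (fun x => a * g x + h x).
Proof.
move=> oO [lu lg wg] [lv lh wh]; have mO := open_measurable_rV oO.
have lin f1 f2 phi : loc_integrable Omega f1 -> loc_integrable Omega f2 ->
    test_function Omega phi ->
    \int[leb n]_(x in Omega) ((a * f1 x + f2 x) * phi x) =
    a * \int[leb n]_(x in Omega) (f1 x * phi x) + \int[leb n]_(x in Omega) (f2 x * phi x).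
  move=> l1 l2 tphi; have i1 := loc_test_integrable oO l1 tphi.
  have i2 := loc_test_integrable oO l2 tphi.
  have i3 : (leb n).-integrable Omega (EFin \o (fun x => a * (f1 x * phi x))).
    exact: (integrableZl mO a i1).
  rewrite -RintegralZl// -RintegralD//.
  by apply: eq_Rintegral => x _; rewrite mulrDl mulrA.
split; try exact: loc_integrable_lin.
move=> phi tphi; rewrite !lin//; last exact: test_pderive.
by rewrite wg// wh//; lra.
Qed.

(** The product with a test function is a test function, and its derivative has
    integral 0. *)
Lemma weak_smooth Omega i f : open Omega -> smooth f ->
  weak_pderivative Omega i f (pderive i f).
Proof.
move=> oO sf; have mO := open_measurable_rV oO.
have lf : loc_integrable Omega f.
  by apply: continuous_loc_integrable => //; exact: smooth_continuous.
have ldf : loc_integrable Omega (pderive i f).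
  by apply: continuous_loc_integrable => //; apply: smooth_continuous; exact: smooth_pderive.
split=> // phi tphi.
have tp : test_function Omega (phi \* f) by exact: testMl.
have := integral_pderive i tp.
rewrite -(_ : (\int[leb n]_(x in Omega) (pderive i (phi \* f) x)%:E =
            \int[leb n]_x (pderive i (phi \* f) x)%:E)%E); last first.
  rewrite integral_mkcond; apply: eq_integral => x _; rewrite patchE.
  case: ifPn => // hO; rewrite (test_out (test_pderive i tp))//.
  by move: hO; rewrite notin_setE.
have -> : pderive i (phi \* f) = (fun x => f x * pderive i phi x + pderive i f x * phi x).
  rewrite pderiveM; [|by move=> x; apply: smooth_differentiable; exact: test_smooth tphi
                     |by move=> x; exact: smooth_differentiable].
  by apply/funext => x /=; ring.
have i1 := loc_test_integrable oO lf (test_pderive i tphi).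
have i2 := loc_test_integrable oO ldf tphi.
move=> /(congr1 fine); rewrite -/(Rintegral _ _ _) RintegralD//= => /eqP.
by rewrite addr_eq0 => /eqP.
Qed.

Lemma wderiveP Omega i u g : weak_pderivative Omega i u g ->
  weak_pderivative Omega i u (wderive Omega i u).
Proof. by move=> w; rewrite /wderive; case: xgetP => [y -> //|/(_ g)]. Qed.

Lemma wderive_ae Omega i u g : open Omega -> weak_pderivative Omega i u g ->
  {ae leb n, forall x, Omega x -> wderive Omega i u x = g x}.
Proof. by move=> oO w; apply: weak_unique oO (wderiveP w) w. Qed.

Lemma measurable_wderive Omega i u g : weak_pderivative Omega i u g ->
  measurable_fun Omega (wderive Omega i u).
Proof. by move=> /wderiveP[_ [? _] _]. Qed.

(** This reduces weak derivatives of discrete functions to derivatives of the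
    polynomials that define them cell by cell: the test functions supported in the
    open subset already determine the weak derivative there. *)
Lemma wderive_local Omega U i u g f : open Omega -> open U -> U `<=` Omega ->
  weak_pderivative Omega i u g -> smooth f -> {in U, u =1 f} ->
  {ae leb n, forall x, U x -> wderive Omega i u x = pderive i f x}.
Proof.
move=> oO oU UO w sf uf; have mU := open_measurable_rV oU.
have w1 := weak_ext uf (weak_sub oO UO (wderiveP w) mU).
exact: weak_unique oU w1 (weak_smooth i oU sf).
Qed.

End weak_derivatives.

Section H1_functions.
Context {R : realType} {n : nat}.
Variable Omega : set 'rV[R]_n.
Hypothesis oO : open Omega.
Let mO : measurable Omega := open_measurable_rV oO.
Implicit Types (f g h u v phi psi : 'rV[R]_n -> R).
Local Notation si := (square_integrable Omega).
Local Notation wd := (wderive Omega).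
Local Notation L2norm := (L2norm Omega).

Lemma H1_weak u i : H1 Omega u -> weak_pderivative Omega i u (wd i u).
Proof. by move=> [_ /(_ i)[g _]]; exact: wderiveP. Qed.

Lemma H1_si_wderive u i : H1 Omega u -> si (wd i u).
Proof.
move=> [_ /(_ i)[g sg w]]; apply: (si_ae mO sg); first exact: measurable_wderive w.
exact: wderive_ae.
Qed.

Lemma H1_lin (a : R) u v : H1 Omega u -> H1 Omega v -> H1 Omega (fun x => a * u x + v x).
Proof.
move=> hu hv; split; first exact: si_lin hu.1 hv.1.
move=> i; exists (fun x => a * wd i u x + wd i v x).
  by apply: si_lin => //; exact: H1_si_wderive.
by apply: weak_lin => //; exact: H1_weak.
Qed.

(** Linearity holds only almost everywhere, since weak derivatives are given by
    chosen representatives. *)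
Lemma wderive_lin (a : R) u v i : H1 Omega u -> H1 Omega v ->
  {ae leb n, forall x, Omega x ->
    wd i (fun x => a * u x + v x) x = a * wd i u x + wd i v x}.
Proof.
by move=> hu hv; apply: wderive_ae => //; apply: weak_lin => //; exact: H1_weak.
Qed.

Lemma L2norm_wderive_lin (a : R) u v i : H1 Omega u -> H1 Omega v ->
  L2norm (wd i (fun x => a * u x + v x)) <= `|a| * L2norm (wd i u) + L2norm (wd i v).
Proof.
move=> hu hv; have su := H1_si_wderive i hu; have sv := H1_si_wderive i hv.
have slin := H1_si_wderive i (H1_lin a hu hv).
rewrite (L2norm_ae mO slin.1 (si_lin mO a su sv).1 (wderive_lin a i hu hv)).
exact: L2normD.
Qed.

Lemma H1norm_sq u : H1norm Omega u ^+ 2 = L2norm u ^+ 2 + \sum_i L2norm (wd i u) ^+ 2.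
Proof. by rewrite sqr_sqrtr// addr_ge0 ?sqr_ge0// sumr_ge0// => i _; exact: sqr_ge0. Qed.

Lemma L2norm_le_H1norm u : L2norm u <= H1norm Omega u.
Proof.
rewrite -(@ler_pXn2r _ 2)// ?nnegrE ?sqrtr_ge0// H1norm_sq lerDl.
by apply: sumr_ge0 => i _; exact: sqr_ge0.
Qed.

Lemma wderive_le_H1norm u i : L2norm (wd i u) <= H1norm Omega u.
Proof.
rewrite -(@ler_pXn2r _ 2)// ?nnegrE ?sqrtr_ge0// H1norm_sq.
rewrite (bigD1 i)//= addrCA lerDl addr_ge0 ?sqr_ge0//.
by apply: sumr_ge0 => j _; exact: sqr_ge0.
Qed.

Lemma sum_sqr_le (I : Type) (r : seq I) (F : I -> R) : (forall i, 0 <= F i) ->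
  \sum_(i <- r) F i ^+ 2 <= (\sum_(i <- r) F i) ^+ 2.
Proof.
move=> F0; elim: r => [|i r IH]; first by rewrite !big_nil expr0n.
rewrite !big_cons sqrrD -addrA lerD2l; apply: (le_trans IH).
by rewrite lerDr mulrn_wge0// mulr_ge0// sumr_ge0.
Qed.

Lemma H1norm_le_sum u : H1norm Omega u <= L2norm u + \sum_i L2norm (wd i u).
Proof.
have s0 : 0 <= \sum_i L2norm (wd i u) by apply: sumr_ge0 => i _; exact: sqrtr_ge0.
rewrite -(@ler_pXn2r _ 2)// ?nnegrE ?addr_ge0 ?sqrtr_ge0// H1norm_sq.
rewrite sqrrD -addrA lerD2l.
apply: (@le_trans _ _ ((\sum_i L2norm (wd i u)) ^+ 2)); last first.
  by rewrite lerDr mulrn_wge0// mulr_ge0// sqrtr_ge0.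
by apply: sum_sqr_le => i; exact: sqrtr_ge0.
Qed.

Lemma test_H1 phi : test_function Omega phi -> H1 Omega phi.
Proof.
move=> tphi.
have si_test psi : test_function Omega psi -> si psi.
  move=> tpsi; split.
    by apply: continuous_measurable_rV => //; exact: test_continuous tpsi.
  apply: (test_integrable mO (testMl tpsi (test_smooth tpsi))).
split; first exact: si_test.
move=> i; exists (pderive i phi); first by apply: si_test; exact: test_pderive.
exact: weak_smooth oO (test_smooth tphi).
Qed.

Lemma H10_lin (a : R) u v : H10 Omega u -> H10 Omega v -> H10 Omega (fun x => a * u x + v x).
Proof.
move=> [hu au] [hv av]; split; first exact: H1_lin.
move=> e e0.
pose e1 := e / (2 * (n.+1%:R * (`|a| + 1))).
have a1 : 0 < `|a| + 1 by rewrite ltr_wpDl.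
have e10 : 0 < e1 by rewrite divr_gt0// mulr_gt0// mulr_gt0// ltr0Sn.
have [phi tphi hphi] := au _ e10; have [psi tpsi hpsi] := av _ e10.
exists (fun x => a * phi x + psi x).
  exact: testD (testZ a tphi) tpsi.
have HB w chi : H1 Omega w -> test_function Omega chi -> H1 Omega (w \- chi).
  move=> hw tchi; have := H1_lin (-1) (test_H1 tchi) hw.
  by congr (H1 Omega _); apply/funext => x /=; ring.
have h1 := HB _ _ hu tphi; have h2 := HB _ _ hv tpsi.
have -> : (fun x => a * u x + v x) \- (fun x => a * phi x + psi x) =
    (fun x => a * (u \- phi) x + (v \- psi) x) by apply/funext => x /=; ring.
apply: (le_lt_trans (H1norm_le_sum _)).
have b0 : L2norm (fun x => a * (u \- phi) x + (v \- psi) x) <= (`|a| + 1) * e1.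
  apply: (le_trans (L2normD mO a h1.1 h2.1)); rewrite mulrDl mul1r lerD//.
    exact: (ler_wpM2l (normr_ge0 a) (le_trans (L2norm_le_H1norm _) (ltW hphi))).
  exact: (le_trans (L2norm_le_H1norm _) (ltW hpsi)).
have bi i : L2norm (wd i (fun x => a * (u \- phi) x + (v \- psi) x)) <= (`|a| + 1) * e1.
  apply: (le_trans (L2norm_wderive_lin a i h1 h2)); rewrite mulrDl mul1r lerD//.
    exact: (ler_wpM2l (normr_ge0 a) (le_trans (wderive_le_H1norm _ i) (ltW hphi))).
  exact: (le_trans (wderive_le_H1norm _ i) (ltW hpsi)).
apply: (@le_lt_trans _ _ (n.+1%:R * ((`|a| + 1) * e1))).
  rewrite -natr1 mulrDl mul1r addrC lerD//.
  rewrite (le_trans (ler_sum _ (fun i _ => bi i)))// sumr_const card_ord.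
  by rewrite mulr_natl.
rewrite /e1 mulrA mulrCA.
have N0 : n.+1%:R * (`|a| + 1) != 0 :> R by rewrite mulf_neq0 ?gt_eqF// ltr0Sn.
rewrite (_ : _ * _ = e / 2); first by rewrite ltr_pdivrMr// mulr_natr ltrDl.
by move: N0; move: (n.+1%:R * _) => N N0; field.
Qed.

End H1_functions.

(** * Euclidean norm and convection form *)

Section euclidean_norm.
Context {R : realType} {n : nat}.
Implicit Types (x y z : 'rV[R]_n).

Lemma dotvC x y : dotv x y = dotv y x.
Proof. by apply: eq_bigr => i _; rewrite mulrC. Qed.

Lemma dotv_linl (a : R) x y z : dotv (a *: x + y) z = a * dotv x z + dotv y z.
Proof.
by rewrite mulr_sumr -big_split; apply: eq_bigr => i _; rewrite !mxE mulrDl mulrA.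
Qed.

Lemma dotv_linr (a : R) x y z : dotv z (a *: x + y) = a * dotv z x + dotv z y.
Proof. by rewrite dotvC dotv_linl !(dotvC z). Qed.

Lemma dotv_ge0 x : 0 <= dotv x x.
Proof. by apply: sumr_ge0 => i _; rewrite -expr2 sqr_ge0. Qed.

Lemma enorm_ge0 x : 0 <= enorm x.
Proof. exact: sqrtr_ge0. Qed.

Lemma enorm_sq x : enorm x ^+ 2 = dotv x x.
Proof. by rewrite sqr_sqrtr// dotv_ge0. Qed.

Lemma dotv_CS x y : `|dotv x y| <= enorm x * enorm y.
Proof.
rewrite -sqrtrM ?dotv_ge0// -sqrtr_sqr ler_sqrt ?mulr_ge0 ?dotv_ge0//.
apply: quadratic_CS => [||t]; [exact: dotv_ge0|exact: dotv_ge0|].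
have := dotv_ge0 (t *: x + y).
by rewrite dotv_linl !dotv_linr (dotvC y x); lra.
Qed.

Lemma coord_le_enorm x i : `|x ord0 i| <= enorm x.
Proof.
rewrite -sqrtr_sqr ler_sqrt ?dotv_ge0// /dotv (bigD1 i)//= -expr2 lerDl.
by apply: sumr_ge0 => j _; rewrite -expr2 sqr_ge0.
Qed.

Lemma enorm_le_sum x : enorm x <= \sum_i `|x ord0 i|.
Proof.
have s0 : 0 <= \sum_i `|x ord0 i| by apply: sumr_ge0.
rewrite -(ger0_norm s0) -sqrtr_sqr ler_sqrt ?sqr_ge0//.
apply: (le_trans _ (sum_sqr_le _ (fun i => normr_ge0 (x ord0 i)))).
by apply: ler_sum => i _; rewrite -expr2 real_normK ?num_real.
Qed.

Lemma enormZ (a : R) x : enorm (a *: x) = `|a| * enorm x.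
Proof.
rewrite /enorm; have -> : dotv (a *: x) (a *: x) = a ^+ 2 * dotv x x.
  by rewrite mulr_sumr; apply: eq_bigr => i _; rewrite !mxE; ring.
by rewrite sqrtrM ?sqr_ge0// sqrtr_sqr.
Qed.

End euclidean_norm.

Section convection_form.
Context {R : realType} {n : nat}.
Variable Omega : set 'rV[R]_n.
Hypothesis oO : open Omega.
Hypothesis bO : box_bounded Omega.
Variable beta : 'rV[R]_n -> 'rV[R]_n.
Hypothesis abeta : admissible_velocity Omega beta.
Let mO : measurable Omega := open_measurable_rV oO.
Implicit Types (f g h u v w phi psi : 'rV[R]_n -> R).
Local Notation si := (square_integrable Omega).
Local Notation wd := (wderive Omega).
Local Notation L2norm := (L2norm Omega).
Local Notation ip := (ip Omega).
Local Notation B := (sup_norm Omega beta).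
Let betai i x := beta x ord0 i.

Lemma compact_closure_box : compact (closure Omega).
Proof.
apply: bounded_closed_compact; last exact: closed_closure.
by apply/box_boundedE; exact: box_bounded_closure.
Qed.

Lemma within_beta_coord i : {within closure Omega, continuous (betai i)}.
Proof.
have [cb _ _ _] := abeta; move=> x.
exact: (@continuous_comp (subspace (closure Omega)) _ _ beta
  (fun y : 'rV[R]_n => y ord0 i) x (cb x) (@coord_continuous _ _ _ ord0 i (beta x))).
Qed.

Lemma beta_le_sup x : closure Omega x -> enorm (beta x) <= B.
Proof.
move=> cx; apply: ub_le_sup; last by exists x.
have H i : exists M : R, forall x, closure Omega x -> `|betai i x| <= M.
  have [M M0 hM] := continuous_compact_bounded compact_closure_box (@within_beta_coord i).
  by exists M.
pose M i := projT1 (cid (H i)).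
exists (\sum_i M i) => _ [y cy <-]; apply: (le_trans (enorm_le_sum _)).
by apply: ler_sum => i _; rewrite /M; case: (cid (H i)) => K hK /=; exact: hK.
Qed.

Lemma betai_le_sup i x : Omega x -> `|betai i x| <= B.
Proof.
move=> Ox; apply: (le_trans (coord_le_enorm _ _)); apply: beta_le_sup.
exact: subset_closure.
Qed.

Lemma sup_norm_ge0 : 0 <= B.
Proof.
have [[x Ox]|h] := pselect (exists x, closure Omega x).
  exact: le_trans (enorm_ge0 _) (beta_le_sup Ox).
rewrite /sup_norm (_ : [set enorm (beta x) | x in _] = set0) ?sup0//.
by rewrite predeqE => y; split=> // -[x cx _]; apply: h; exists x.
Qed.

Lemma betai_H1 i : H1 Omega (betai i).
Proof. by have [_ /(_ i)[[]]] := abeta. Qed.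

Lemma measurable_betai i : measurable_fun Omega (betai i).
Proof. by have [[]] := betai_H1 i. Qed.

Lemma si_betai_mul i f : si f -> si (fun x => betai i x * f x).
Proof.
move=> sf; apply: (si_bounded_mul mO sf (measurable_betai i) sup_norm_ge0).
by move=> x; exact: betai_le_sup.
Qed.

Lemma ip_sum (I : Type) (r : seq I) (F : I -> 'rV[R]_n -> R) g :
  (forall i, si (F i)) -> si g ->
  ip (fun x => \sum_(i <- r) F i x) g = \sum_(i <- r) ip (F i) g.
Proof.
move=> sF sg; elim: r => [|i r IH].
  rewrite big_nil /Defs.ip; under eq_Rintegral do rewrite big_nil mul0r.
  by rewrite Rintegral_cst// mul0r.
rewrite big_cons -IH -[ip (F i) g]mul1r -ip_linl//; last exact: si_sum.
by congr (ip _ _); apply/funext => x; rewrite big_cons mul1r.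
Qed.

Lemma conv_formE w v : H1 Omega w -> si v ->
  conv_form Omega beta w v = \sum_i ip (fun x => betai i x * wd i w x) v.
Proof.
move=> hw sv; rewrite -ip_sum//; last first.
  by move=> i; apply: si_betai_mul; exact: H1_si_wderive.
apply: eq_Rintegral => x _; congr (_ * _); apply: eq_bigr => i _.
by rewrite mxE.
Qed.

Lemma conv_form_linl (a : R) u w v : H1 Omega u -> H1 Omega w -> si v ->
  conv_form Omega beta (fun x => a * u x + w x) v =
  a * conv_form Omega beta u v + conv_form Omega beta w v.
Proof.
move=> hu hw sv; rewrite !conv_formE//; last exact: H1_lin.
rewrite mulr_sumr -big_split; apply: eq_bigr => i _ /=.
have s1 := si_betai_mul i (H1_si_wderive oO i hu).
have s2 := si_betai_mul i (H1_si_wderive oO i hw).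
have s3 := si_betai_mul i (H1_si_wderive oO i (H1_lin oO a hu hw)).
rewrite -ip_linl//; apply: Rintegral_ae => //.
- by apply: measurable_funM; [exact: s3.1|exact: sv.1].
- by apply: measurable_funM; [exact: (si_lin mO a s1 s2).1|exact: sv.1].
- apply: filterS (wderive_lin oO a i hu hw) => x hx Ox; rewrite hx//.
  by congr (_ * _); ring.
Qed.

Lemma conv_form_linr (a : R) u w v : H1 Omega v -> si u -> si w ->
  conv_form Omega beta v (fun x => a * u x + w x) =
  a * conv_form Omega beta v u + conv_form Omega beta v w.
Proof.
move=> hv su sw; rewrite !conv_formE//; last exact: si_lin.
rewrite mulr_sumr -big_split; apply: eq_bigr => i _ /=.
by rewrite ip_linr//; apply: si_betai_mul; exact: H1_si_wderive.
Qed.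

Lemma L2norm_betai_mul i f : si f -> L2norm (fun x => betai i x * f x) <= B * L2norm f.
Proof.
move=> sf; rewrite -(ger0_norm sup_norm_ge0) -sqrtr_sqr -sqrtrM ?sqr_ge0//.
rewrite ler_sqrt ?mulr_ge0 ?sqr_ge0 ?ip_ge0//.
have sb := si_betai_mul i sf.
have i1 := si_integrable_mul mO sf sf; have i2 := si_integrable_mul mO sb sb.
have i3 : (leb n).-integrable Omega (EFin \o (fun x => B ^+ 2 * (f x * f x))).
  exact: (integrableZl mO (B ^+ 2) i1).
rewrite /Defs.ip -RintegralZl//; apply: le_Rintegral => // x Ox.
rewrite mulrACA -!expr2 ler_wpM2r ?sqr_ge0//.
rewrite -(real_normK (num_real (betai i x))) lerXn2r ?nnegrE//.
- exact: sup_norm_ge0.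
- exact: betai_le_sup.
- exact: sup_norm_ge0.
- exact: sup_norm_ge0.
Qed.

Lemma conv_form_le u v : H1 Omega u -> si v ->
  `|conv_form Omega beta u v| <= B * (\sum_i L2norm (wd i u)) * L2norm v.
Proof.
move=> hu sv; rewrite conv_formE// (le_trans (ler_norm_sum _ _ _))//.
rewrite mulr_sumr mulr_suml; apply: ler_sum => i _.
have su := H1_si_wderive oO i hu.
apply: (le_trans (ip_CS mO (si_betai_mul i su) sv)).
by rewrite ler_wpM2r ?sqrtr_ge0//; exact: L2norm_betai_mul.
Qed.

(** The divergence constraint enters here, through the definition of the weak
    derivative of beta tested with the square of the test function. *)
Lemma conv_form_test phi : test_function Omega phi -> conv_form Omega beta phi phi = 0.
Proof.
move=> tphi; have hphi := test_H1 oO tphi.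
have sphi := test_smooth tphi.
have t2 : test_function Omega (phi \* phi) by exact: testMl.
have lbeta i := let: And3 _ l _ := H1_weak i (betai_H1 i) in l.
rewrite conv_formE//; last exact: hphi.1.
have -> : \sum_i ip (fun x => betai i x * wd i phi x) phi =
    \sum_i (- 2^-1) * \int[leb n]_(x in Omega) (wd i (betai i) x * (phi x * phi x)).
  apply: eq_bigr => i _.
  have [_ _ /(_ _ t2) W] := H1_weak i (betai_H1 i).
  rewrite [X in _ * X](_ : _ = - \int[leb n]_(x in Omega) (betai i x * pderive i (phi \* phi) x)); last first.
    by rewrite W opprK.
  have smul := si_betai_mul i (H1_si_wderive oO i hphi).
  have l1 : loc_integrable Omega (betai i) by have [] := H1_weak i (betai_H1 i).
  have i1 := loc_test_integrable oO l1 (test_pderive i t2).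
  rewrite mulrNN -RintegralZl//; apply: Rintegral_ae => //.
  - by apply: measurable_funM; [exact: smul.1|exact: hphi.1.1].
  - apply: measurable_funM => //; apply: measurable_funM; first exact: measurable_betai.
    by apply: continuous_measurable_rV => //; exact: (test_continuous (test_pderive i t2)).
  - apply: filterS (wderive_ae oO (weak_smooth i oO sphi)) => x hx Ox; rewrite hx//.
    rewrite pderiveM; [|by move=> y; exact: smooth_differentiable..].
    by rewrite /=; field.
rewrite -mulr_sumr.
suff -> : \sum_i \int[leb n]_(x in Omega) (wd i (betai i) x * (phi x * phi x)) = 0.
  by rewrite mulr0.
have s2 : si (phi \* phi) := (test_H1 oO t2).1.
rewrite -(@ip_sum _ _ (fun i => wd i (betai i)) (phi \* phi))//; last first.
  by move=> i; apply: H1_si_wderive => //; exact: betai_H1.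
have ssum : si (fun x => \sum_i wd i (betai i) x).
  by apply: si_sum => // i; apply: H1_si_wderive => //; exact: betai_H1.
rewrite /Defs.ip (@Rintegral_ae _ _ _ mO _ (cst 0)).
- by rewrite Rintegral_cst// mul0r.
- by apply: measurable_funM; [exact: ssum.1|exact: s2.1].
- exact: measurable_cst.
- by have [_ _ div0 _] := abeta; apply: filterS div0 => x hx Ox; rewrite hx// mul0r.
Qed.

(** The velocity is bounded, so that the form is continuous for the norm of H1, in which
    the functions with zero boundary values are limits of test functions. *)
Theorem conv_form_diag v : H10 Omega v -> conv_form Omega beta v v = 0.
Proof.
move=> [hv av]; apply/eqP; rewrite -normr_eq0; apply/eqP/le_anti; rewrite normr_ge0 andbT.
set H := H1norm Omega v.
have H0 : 0 <= H by exact: sqrtr_ge0.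
have B0 := sup_norm_ge0.
apply/ler_addgt0Pl => e e0; rewrite addr0.
pose C := B * n%:R * (2 * H + 1) + 1.
have C0 : 0 < C by rewrite ltr_wpDl// !mulr_ge0// addr_ge0 ?mulr_ge0.
pose d := Num.min 1 (e / C).
have d0 : 0 < d by rewrite lt_min ltr01 divr_gt0.
have [phi tphi hphi] := av d d0.
pose g := v \- phi.
have hp := test_H1 oO tphi.
have hg : H1 Omega g.
  by have := H1_lin oO (-1) hp hv; congr (H1 Omega _); apply/funext => x /=; rewrite /g /=; ring.
have pE : phi = (fun x => -1 * g x + v x) by apply/funext => x; rewrite /g /=; ring.
have := conv_form_test tphi; rewrite {1}pE conv_form_linl//; last exact: hp.1.
rewrite pE !conv_form_linr//; [|exact: hg.1|exact: hv.1|exact: hg.1|exact: hv.1].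
move=> E.
have bd u w : H1 Omega u -> H1 Omega w ->
    `|conv_form Omega beta u w| <= B * n%:R * (H1norm Omega u * H1norm Omega w).
  move=> hu hw; apply: (le_trans (conv_form_le hu hw.1)).
  have hS : \sum_i L2norm (wd i u) <= n%:R * H1norm Omega u.
    apply: (le_trans (ler_sum _ (fun i _ => wderive_le_H1norm Omega u i))).
    by rewrite sumr_const card_ord mulr_natl.
  have S0 : 0 <= \sum_i L2norm (wd i u) by apply: sumr_ge0 => i _; exact: sqrtr_ge0.
  move: B0 S0 hS (sqrtr_ge0 _ : 0 <= L2norm w) (L2norm_le_H1norm Omega w).
  move: (\sum_i _) (L2norm w) (H1norm Omega u) (H1norm Omega w) B => S l a b c c0 S0 Sa l0 lb.
  by rewrite -!mulrA ler_wpM2l// mulrA ler_pM.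
have b1 := bd _ _ hg hv; have b2 := bd _ _ hv hg; have b3 := bd _ _ hg hg.
move: E b1 b2 b3 hphi (sqrtr_ge0 _ : 0 <= H1norm Omega g); rewrite -/g -/H.
move: (conv_form Omega beta g g) (conv_form Omega beta g v) (conv_form Omega beta v g).
move: (conv_form Omega beta v v) (H1norm Omega g) => vv G gg gv vg E b1 b2 b3 /ltW Gd G0.
have [G1 G2] : G <= 1 /\ G <= e / C by move: Gd; rewrite le_min => /andP.
have Bn : 0 <= B * n%:R by rewrite mulr_ge0.
have -> : vv = gv + vg - gg by lra.
apply: (@le_trans _ _ (C * G)); last by rewrite mulrC -ler_pdivlMr.
apply: (le_trans (ler_normB _ _)); apply: (le_trans (lerD (ler_normD _ _) (lexx _))).
apply: (le_trans (lerD (lerD b1 b2) b3)).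
have : B * n%:R * (G * G) <= B * n%:R * G by rewrite ler_wpM2l// ler_piMr.
move: (B * n%:R) @C C0 Bn G1 G0 H0 {b1 b2 b3 Gd G2 d d0} => b C C0 Bn G1 G0 H0 h.
by rewrite /C; move: H H0 {C C0} => H H0; lra.
Qed.

End convection_form.

(** * Polynomials of one variable *)

Section one_variable_polynomials.
Context {R : realType}.
Implicit Types (q : {poly R}) (t y : R).

Definition lagrange_basis N (t : 'I_N -> R) (j : 'I_N) : {poly R} :=
  \prod_(k < N | k != j) ((t j - t k)^-1 *: ('X - (t k)%:P)).

Lemma lagrange_basisE N (t : 'I_N -> R) j y :
  (lagrange_basis t j).[y] = \prod_(k < N | k != j) ((y - t k) / (t j - t k)).
Proof.
rewrite horner_prod; apply: eq_bigr => k _.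
by rewrite hornerZ hornerXsubC mulrC.
Qed.

Lemma lagrange_interpolation N (t : 'I_N -> R) q : injective t -> (size q <= N)%N ->
  q = \sum_(j < N) q.[t j] *: lagrange_basis t j.
Proof.
move=> it sq; apply/eqP; rewrite -subr_eq0; apply/eqP.
apply: (@roots_geq_poly_eq0 _ _ [seq t j | j <- enum 'I_N]).
- apply/allP => _ /mapP[j _ ->]; rewrite rootE hornerD hornerN horner_sum.
  rewrite (bigD1 j)//= big1 ?addr0 => [|k kj].
    rewrite hornerZ lagrange_basisE big1 ?mulr1 ?subrr// => k kj.
    by rewrite divff// subr_eq0; apply: contra kj => /eqP/it ->.
  rewrite hornerZ lagrange_basisE (bigD1 j)/=; last by rewrite eq_sym.
  by rewrite subrr mul0r mul0r mulr0.
- by rewrite map_inj_uniq// enum_uniq.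
- rewrite size_map -cardE card_ord (leq_trans (size_polyD _ _))// size_polyN geq_max sq/=.
  apply: (leq_trans (size_sum _ _ _)); apply/bigmax_leqP => j _.
  apply: (leq_trans (size_scale_leq _ _)); rewrite /lagrange_basis.
  rewrite (leq_trans (size_poly_prod_leq _ _))//.
  have -> : #|[pred k : 'I_N | k != j]| = N.-1.
    have := cardC1 j; rewrite card_ord => <-; apply: eq_card => k.
    by rewrite !inE.
  have N0 : (0 < N)%N by exact: leq_ltn_trans (leq0n j) (ltn_ord j).
  rewrite leq_subLR -[X in (_ <= _ + X)%N](prednK N0) addnS ltnS addnn -muln2.
  rewrite (@leq_trans (\sum_(k < N | k != j) 2)%N)//.
    apply: leq_sum => k _; apply: (leq_trans (size_scale_leq _ _)).
    by rewrite size_XsubC.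
  rewrite sum_nat_const leq_mul2r/= leq_eqVlt; apply/orP; left; apply/eqP.
  have := cardC1 j; rewrite card_ord => <-.
  by apply: eq_card => k; rewrite !inE.
Qed.

Lemma horner_bounded q (rho : R) : 0 <= rho -> exists2 C : R, 0 <= C &
  forall y, `|y| <= rho -> `|q.[y]| <= C.
Proof.
move=> r0; exists (\sum_(i < size q) `|q`_i| * rho ^+ i).
  by apply: sumr_ge0 => i _; rewrite mulr_ge0 ?exprn_ge0.
move=> y yr; rewrite horner_coef (le_trans (ler_norm_sum _ _ _))//.
apply: ler_sum => i _; rewrite normrM ler_wpM2l// normrX.
by rewrite lerXn2r ?nnegrE.
Qed.

(** A bound of Markov type: interpolation at fixed points makes the constant depend
    on the degree and the interval only. *)
Lemma deriv_bound p (rho : R) : 1 <= rho -> exists2 C : R, 0 <= C &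
  forall q, (size q <= p.+1)%N -> forall M, (forall t, `|t| <= rho -> `|q.[t]| <= M) ->
  forall y, `|y| <= rho -> `|q^`().[y]| <= C * M.
Proof.
move=> r1; have r0 : 0 <= rho by rewrite (le_trans ler01).
pose t (j : 'I_p.+1) : R := j%:R / p.+1%:R.
have it : injective t.
  move=> i j /(congr1 (fun x => x * p.+1%:R)); rewrite /t !divfK ?pnatr_eq0//.
  by move=> /eqP; rewrite eqr_nat => /eqP/val_inj.
have tr j : `|t j| <= rho.
  rewrite ger0_norm ?divr_ge0// (le_trans _ r1)// ler_pdivrMr ?ltr0Sn// mul1r ler_nat.
  exact/ltnW/ltn_ord.
pose C j := projT1 (cid2 (horner_bounded (lagrange_basis t j)^`() r0)).
have hC j : 0 <= C j /\ forall y, `|y| <= rho -> `|(lagrange_basis t j)^`().[y]| <= C j.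
  by rewrite /C; case: cid2.
exists (\sum_j C j); first by apply: sumr_ge0 => j _; exact: (hC j).1.
move=> q sq M hM y yr; rewrite {1}(lagrange_interpolation it sq) raddf_sum /= horner_sum.
rewrite (le_trans (ler_norm_sum _ _ _))// mulr_suml; apply: ler_sum => j _.
rewrite derivZ hornerZ normrM mulrC ler_pM//; first exact: (hC j).2.
exact: hM.
Qed.

Lemma measurable_horner_sq q (A : set (measurableTypeR R)) : measurable A ->
  measurable_fun A (fun t => (q.[t] ^+ 2)%:E).
Proof.
move=> mA; apply/measurable_EFinP; apply: (measurable_funS measurableT) => //.
apply: continuous_measurable_fun => t.
apply: (@continuous_comp _ _ _ (horner q) (fun x => x ^+ 2)).
  exact: continuous_horner.
exact: exprn_continuous.
Qed.

(** Each of [p.+1] separated subintervals contains a point where the value is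
    controlled by the mean square; interpolate there. *)
Lemma sup_le_mean_square p (rho : R) : 0 <= rho -> exists2 C : R, 0 <= C &
  forall q, (size q <= p.+1)%N -> forall y, `|y| <= rho ->
  ((q.[y] ^+ 2)%:E <= C%:E * \int[@lebesgue_measure R]_(t in `[(-1)%R, 1%R]%classic) (q.[t] ^+ 2)%:E)%E.
Proof.
move=> r0; pose N := p.+1; pose del : R := N%:R^-1.
have N0 : 0 < N%:R :> R by rewrite ltr0Sn.
have d0 : 0 < del by rewrite invr_gt0.
pose K := ((rho + 1) / del) ^+ p.
have K0 : 0 <= K by rewrite exprn_ge0// divr_ge0 ?addr_ge0// ltW.
exists (N%:R ^+ 2 * K ^+ 2 / del).
  by rewrite divr_ge0 ?(ltW d0)// mulr_ge0 ?sqr_ge0.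
move=> q sq y yr.
have cq : continuous (fun t : R => q.[t] ^+ 2).
  by move=> t; apply: (@continuous_comp _ _ _ (horner q) (fun x => x ^+ 2));
    [exact: continuous_horner|exact: exprn_continuous].
have mq := @measurable_horner_sq q.
set I := (X in (_ <= _ * X)%E).
have iq : (@lebesgue_measure R).-integrable `[-1, 1]%classic (fun t => (q.[t] ^+ 2)%:E).
  apply: continuous_compact_integrable; first exact: segment_compact.
  exact: continuous_subspaceT.
have Ifin : I \is a fin_num by exact: integrable_fin_num.
rewrite -(fineK Ifin) -EFinM lee_fin; set E := fine I.
have E0 : 0 <= E by apply: fine_ge0; apply: integral_ge0 => t _; rewrite lee_fin sqr_ge0.
pose s (j : 'I_N) : R := -1 + 2 * j%:R * del.
have hs j : -1 <= s j /\ s j + del <= 1.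
  have jN : (j%:R + 1) * del <= 1 :> R.
    by rewrite natr1 ler_pdivrMr// mul1r ler_nat ltn_ord.
  have j0 : 0 <= j%:R :> R by rewrite ler0n.
  by rewrite /s; split; nra.
have hmin j : exists t : R, s j <= t <= s j + del /\ q.[t] ^+ 2 * del <= E.
  have sd : s j <= s j + del by rewrite lerDl ltW.
  have [t] := EVT_min sd (continuous_subspaceT cq); rewrite in_itv/= => tI ht.
  exists t; split => //.
  rewrite -lee_fin [in leRHS](fineK Ifin).
  pose J : set (measurableTypeR R) := `[s j, s j + del]%classic.
  have mJ : measurable J by exact: measurable_itv.
  have sub : J `<=` `[(-1)%R, 1%R]%classic.
    move=> z; rewrite /J /= !in_itv/= => /andP[z1 z2]; have [h1 h2] := hs j.
    by rewrite (le_trans h1)//= (le_trans z2).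
  have h1 : ((q.[t] ^+ 2 * del)%:E = \int[@lebesgue_measure R]_(z in
      J) (q.[t] ^+ 2)%:E)%E.
    have lJ : @lebesgue_measure R J = del%:E.
      rewrite [LHS](lebesgue_measure_itv `[s j, s j + del])/= lte_fin ltrDl d0.
      by rewrite -EFinB addrAC subrr add0r.
    by rewrite integral_cst// EFinM; congr (_ * _)%E.
  have h2 : (\int[@lebesgue_measure R]_(z in J) (q.[t] ^+ 2)%:E <=
      \int[@lebesgue_measure R]_(z in J) (q.[z] ^+ 2)%:E)%E.
    apply: ge0_le_integral => //.
    - by move=> z _; rewrite lee_fin sqr_ge0.
    - exact: mq.
  have h3 : (\int[@lebesgue_measure R]_(z in J) (q.[z] ^+ 2)%:E <= I)%E.
    apply: ge0_subset_integral => //; first exact: mq.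
    by move=> z _; rewrite lee_fin sqr_ge0.
  by rewrite h1; exact: le_trans h2 h3.
pose t j := projT1 (cid (hmin j)).
have ht j : s j <= t j <= s j + del /\ q.[t j] ^+ 2 * del <= E by rewrite /t; case: cid.
have sep j k : j != k -> del <= `|t j - t k|.
  wlog : j k / (j < k)%N => [hw jk|jk _].
    have [lt|gt|e] := ltngtP j k; first exact: hw lt jk.
      by rewrite distrC; apply: (hw _ _ gt); rewrite eq_sym.
    by move: jk; rewrite (val_inj e) eqxx.
  have [/andP[_ h1] _] := ht j; have [/andP[h2 _] _] := ht k.
  rewrite distrC (le_trans _ (ler_norm _))//.
  have : (j%:R + 1 : R) <= k%:R by rewrite natr1 ler_nat.
  by move: h1 h2; rewrite /s => h1 h2 h3; nra.
have it : injective t.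
  move=> j k e; apply/eqP/negPn/negP => /sep.
  by rewrite e subrr normr0 leNgt d0.
have tb j : `|t j| <= 1.
  have [/andP[h1 h2] _] := ht j; have [h3 h4] := hs j.
  by rewrite ler_norml (le_trans h3)//= (le_trans h2).
have Lb j : `|(lagrange_basis t j).[y]| <= K.
  rewrite lagrange_basisE normr_prod.
  apply: (@le_trans _ _ (\prod_(k < N | k != j) ((rho + 1) / del))).
    apply: ler_prod => k kj; rewrite normr_ge0/= normrM normfV ler_pM ?invr_ge0//.
      by rewrite (le_trans (ler_normB _ _))// lerD.
    rewrite lef_pV2 ?posrE//; first by apply: sep; rewrite eq_sym.
    by rewrite (lt_le_trans d0)//; apply: sep; rewrite eq_sym.
  rewrite prodr_const /K; have -> // : #|[pred k | k != j]| = p.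
  have := cardC1 j; rewrite card_ord /= => <-; apply: eq_card => k.
  by rewrite !inE.
have qb j : `|q.[t j]| <= Num.sqrt (E / del).
  rewrite -sqrtr_sqr ler_sqrt ?divr_ge0 ?(ltW d0)// ler_pdivlMr//.
  exact: (ht j).2.
have : `|q.[y]| <= N%:R * (Num.sqrt (E / del) * K).
  rewrite {1}(lagrange_interpolation it sq) horner_sum (le_trans (ler_norm_sum _ _ _))//.
  have H j : `|(q.[t j] *: lagrange_basis t j).[y]| <= Num.sqrt (E / del) * K.
    by rewrite hornerZ normrM ler_pM.
  rewrite (le_trans (ler_sum _ (fun j _ => H j)))// sumr_const card_ord.
  by rewrite mulr_natl.
move=> h; rewrite -(real_normK (num_real _)).
apply: (@le_trans _ _ ((N%:R * (Num.sqrt (E / del) * K)) ^+ 2)).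
  by rewrite lerXn2r ?nnegrE// !mulr_ge0 ?sqrtr_ge0.
rewrite !exprMn sqr_sqrtr ?divr_ge0 ?(ltW d0)//.
rewrite le_eqVlt; apply/orP; left; apply/eqP.
by move: (N%:R ^+ 2) (K ^+ 2) (del^-1) => a b e; ring.
Qed.

End one_variable_polynomials.

(** * Functions that are polynomial in each variable *)

Section separately_polynomial.
Context {R : realType}.

Definition upd n (x : 'rV[R]_n) (i : 'I_n) (t : R) : 'rV[R]_n :=
  \row_j (if j == i then t else x ord0 j).

(** Unlike polynomials given by coefficients, these functions are visibly stable
    under freezing a coordinate and under dilations. *)
Definition sep_poly p n (P : 'rV[R]_n -> R) := forall x i, exists2 q : {poly R},
  (size q <= p.+1)%N & forall t, P (upd x i t) = q.[t].

Lemma upd_id n (x : 'rV[R]_n) i : upd x i (x ord0 i) = x.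
Proof. by apply/rowP => j; rewrite mxE; case: eqP => [->|]. Qed.

Lemma upd_cons0 n (s t : R) (y : 'rV[R]_n) : upd (rV_cons (s, y)) ord0 t = rV_cons (t, y).
Proof.
apply/rowP => j; rewrite mxE; case: (unliftP ord0 j) => [k ->|->]; last by rewrite eqxx rV_cons0.
by rewrite !rV_consS.
Qed.

Lemma upd_consS n (t s : R) (y : 'rV[R]_n) i :
  upd (rV_cons (s, y)) (lift ord0 i) t = rV_cons (s, upd y i t).
Proof.
apply/rowP => j; rewrite mxE; case: (unliftP ord0 j) => [k ->|->]; last by rewrite !rV_cons0.
by rewrite !rV_consS (inj_eq (@lift_inj _ ord0)) mxE.
Qed.

Lemma measurable_rV_cons_r n (t : R) : measurable_fun [set: 'rV[R]_n] (fun y => rV_cons (t, y)).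
Proof.
apply: measurable_rVP => i; case: (unliftP ord0 i) => [j ->|->].
  under eq_fun do rewrite rV_consS; exact: measurable_rV_coord.
by under eq_fun do rewrite rV_cons0; exact: measurable_cst.
Qed.

(** One coordinate at a time: the one variable estimate bounds the value by the mean
    square over the first coordinate, the induction hypothesis bounds each integrand by
    the mean square over the others, and Tonelli assembles them. *)
Lemma sep_poly_sup p n (rho : R) : 0 <= rho -> exists2 C : R, 0 <= C &
  forall P : 'rV[R]_n -> R, measurable_fun [set: 'rV[R]_n] P -> sep_poly p P ->
  forall y, cube n rho y ->
  ((P y ^+ 2)%:E <= C%:E * \int[leb n]_(x in cube n 1%R) (P x ^+ 2)%:E)%E.
Proof.
move=> r0; elim: n => [|n [Cn Cn0 hCn]].
  exists 1 => // P mP _ y _; rewrite mul1e integral_dirac//; last 2 first.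
  - exact: measurable_cube.
  - apply/measurable_EFinP; apply: measurable_funX.
    exact: measurable_funS mP.
  rewrite diracE mem_set ?mul1e; last by move=> -[].
  by rewrite (_ : y = 0)//; apply/rowP => -[].
have [C1 C10 hC1] := sup_le_mean_square p r0.
exists (C1 * Cn); first by rewrite mulr_ge0.
move=> P mP sP y cy.
pose y' : 'rV[R]_n := \row_j y ord0 (lift ord0 j).
have yE : y = rV_cons (y ord0 ord0, y').
  apply/rowP => j; case: (unliftP ord0 j) => [k ->|->]; rewrite ?rV_cons0// rV_consS mxE//.
have cy' : cube n rho y' by move=> j; rewrite mxE; exact: cy.
pose F t := (\int[leb n]_(x in cube n 1%R) (P (rV_cons (t, x)) ^+ 2)%:E)%E.
have mPc t : measurable_fun [set: 'rV[R]_n] (fun x => P (rV_cons (t, x))).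
  by apply: (measurableT_comp mP); exact: measurable_rV_cons_r.
have B t : ((P (rV_cons (t, y')) ^+ 2)%:E <= Cn%:E * F t)%E.
  apply: hCn => // x i; have [q sq hq] := sP (rV_cons (t, x)) (lift ord0 i).
  by exists q => // s; rewrite -hq upd_consS.
pose G x : \bar R := (((fun x => (P x ^+ 2)%:E) \_ (cube n.+1 1%R)) x)%E.
have mcn : measurable (cube n 1%R : set 'rV[R]_n) by exact: measurable_cube.
have mcn1 : measurable (cube n.+1 1%R : set 'rV[R]_n.+1) by exact: measurable_cube.
have mG : measurable_fun [set: 'rV[R]_n.+1] G.
  apply/(measurable_restrictT (fun x => (P x ^+ 2)%:E) mcn1).
  apply/measurable_EFinP; apply: measurable_funX; exact: measurable_funS mP.
have G0 x : (0 <= G x)%E.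
  by rewrite /G patchE; case: ifP => // _; rewrite lee_fin sqr_ge0.
have GE t : (\int[leb n]_x G (rV_cons (t, x)) = (F \_ `[(-1)%R, 1%R]%classic) t)%E.
  rewrite patchE /F; case: ifPn => ht.
    rewrite [RHS]integral_mkcond; apply: eq_integral => x _; rewrite /G !patchE.
    congr (if _ then _ else _); apply/idP/idP; rewrite !inE => h.
      by move=> i; have := h (lift ord0 i); rewrite rV_consS.
    move=> i; case: (unliftP ord0 i) => [j ->|->]; rewrite ?rV_cons0 ?rV_consS//.
    by move: ht; rewrite inE.
  rewrite integral0_eq// => x _; rewrite /G patchE memNset// => /(_ ord0).
  by rewrite rV_cons0; move: ht; rewrite notin_setE.
have mFG : measurable_fun [set: measurableTypeR R] (fun t => \int[leb n]_x G (rV_cons (t, x)))%E.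
  apply: (measurable_fun_fubini_tonelli_F (G \o rV_cons)); last by move=> x; exact: G0.
  by apply: measurableT_comp => //; exact: measurable_rV_cons.
have IE : (\int[leb n.+1]_(x in cube n.+1 1%R) (P x ^+ 2)%:E =
   \int[@lebesgue_measure R]_(t in `[(-1)%R, 1%R]%classic) F t)%E.
  rewrite [LHS]integral_mkcond -/G (ge0_integral_lebS mG G0) [RHS]integral_mkcond.
  by apply: eq_integral => t _; rewrite GE.
have mF : measurable_fun (`[(-1)%R, 1%R]%classic : set (measurableTypeR R)) F.
  apply/(measurable_restrictT F (measurable_itv _)).
  by move: mFG; congr measurable_fun; apply/funext => t; exact: GE.
have F0 t : (0 <= F t)%E by apply: integral_ge0 => x _; rewrite lee_fin sqr_ge0.
have [q sq hq] := sP y ord0.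
have hq' t : q.[t] = P (rV_cons (t, y')) by rewrite -hq yE upd_cons0.
have -> : P y = q.[y ord0 ord0] by rewrite -hq upd_id.
apply: (le_trans (hC1 q sq _ _)).
  by have := cy ord0; rewrite /= in_itv/= ler_norml.
rewrite EFinM -muleA; apply: lee_wpmul2l; first by rewrite lee_fin.
rewrite IE -ge0_integralZl//.
apply: ge0_le_integral => //.
- by move=> t _; rewrite lee_fin sqr_ge0.
- exact: measurable_horner_sq.
- exact: measurable_funeM.
- by move=> t _; rewrite hq'; exact: B.
Qed.

End separately_polynomial.

(** * Inverse estimate on cubes *)

Section inverse_estimate.
Context {R : realType}.

Lemma continuous_integrable_box n (D : set 'rV[R]_n) (f : 'rV[R]_n -> R) :
  measurable D -> box_bounded D -> continuous f -> (leb n).-integrable D (EFin \o f).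
Proof.
move=> mD bD cf.
have [|M M0 hM] := @continuous_compact_bounded _ _ (closure D) f _ (continuous_subspaceT cf).
  exact: compact_closure_box.
apply: (bounded_integrable_leb (M := M)) => //; first exact: continuous_measurable_rV.
by move=> x Dx; apply: hM; exact: subset_closure.
Qed.

Lemma pderive_section n (P : 'rV[R]_n -> R) y i (q : {poly R}) :
  (forall t, P (upd y i t) = q.[t]) -> pderive i P y = q^`().[y ord0 i].
Proof.
move=> hq; rewrite derivE derive1E /pderive /derive.
suff -> : (fun h : R => h^-1 *: ((P \o shift y) (h *: delta_mx ord0 i) - P y)) =
  (fun h => h^-1 *: ((horner q \o shift (y ord0 i)) (h *: (1 : R)) - q.[y ord0 i])) by [].
apply/funext => h /=; rewrite -[in X in _ - X](upd_id y i) hq -(hq (h *: 1 + y ord0 i)) -hq.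
congr (_ *: (P _ - _)); apply/rowP => j; rewrite !mxE eqxx/= [h *: 1]mulr1.
by case: eqP => [->|_]; rewrite ?mulr1 ?mulr0 ?add0r.
Qed.

(** The restriction to a line is a polynomial of one variable, bounded on the cube by
    the mean square, hence so is its derivative. *)
Lemma sep_pderive_bound p n (rho : R) : 1 <= rho -> exists2 C : R, 0 <= C &
  forall P : 'rV[R]_n -> R, continuous P -> sep_poly p P ->
  forall y i, cube n rho y ->
  pderive i P y ^+ 2 <= C * \int[leb n]_(x in cube n 1%R) (P x ^+ 2).
Proof.
move=> r1; have r0 : 0 <= rho by rewrite (le_trans ler01).
have [C1 C10 h1] := @deriv_bound R p rho r1.
have [C2 C20 h2] := @sep_poly_sup R p n rho r0.
exists (C1 ^+ 2 * C2); first by rewrite mulr_ge0 ?sqr_ge0.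
move=> P cP sP y i cy.
have mc : measurable (cube n 1%R : set 'rV[R]_n) by exact: measurable_cube.
have iP : (leb n).-integrable (cube n 1%R) (EFin \o (fun x => P x ^+ 2)).
  apply: continuous_integrable_box => //; first by exists 1.
  by move=> x; apply: (@continuous_comp _ _ _ P (fun t => t ^+ 2)); [exact: cP|exact: exprn_continuous].
have E0 : 0 <= \int[leb n]_(x in cube n 1%R) (P x ^+ 2).
  by apply: Rintegral_ge0 => x _; exact: sqr_ge0.
have [q sq hq] := sP y i.
have mP : measurable_fun [set: 'rV[R]_n] P by exact: continuous_measurable_rV.
have bq t : `|t| <= rho -> `|q.[t]| <= Num.sqrt (C2 * \int[leb n]_(x in cube n 1%R) (P x ^+ 2)).
  move=> tr; rewrite -sqrtr_sqr ler_sqrt ?mulr_ge0//.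
  have cu : cube n rho (upd y i t).
    move=> j; rewrite mxE; case: eqP => _; last exact: cy.
    by rewrite in_itv/= -ler_norml.
  have := h2 P mP sP _ cu; rewrite hq /Rintegral -[X in (_ * X)%E]fineK ?integrable_fin_num//.
have := h1 q sq _ bq (y ord0 i); rewrite -(pderive_section hq) => h.
have {}h : `|pderive i P y| <= C1 * Num.sqrt (C2 * \int[leb n]_(x in cube n 1%R) (P x ^+ 2)).
  by apply: h; have := cy i; rewrite /= in_itv/= ler_norml.
rewrite -(real_normK (num_real _)) -mulrA -[X in _ * X]sqr_sqrtr ?mulr_ge0//.
rewrite -exprMn lerXn2r// nnegrE//.
by rewrite mulr_ge0// sqrtr_ge0.
Qed.

Definition box_ball n (c : 'rV[R]_n) (r : R) : set 'rV[R]_n :=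
  [set x | forall i, x ord0 i \in `[c ord0 i - r, c ord0 i + r]].

Lemma measurable_box_ball n (c : 'rV[R]_n) r : measurable (box_ball c r).
Proof.
apply: (measurable_rV_boxes (A := fun i => [set x | x \in `[c ord0 i - r, c ord0 i + r]])) => i.
exact: measurable_itv.
Qed.

Lemma box_ball_affine n (c : 'rV[R]_n) r s x : 0 < r ->
  box_ball c (s * r) (r *: x + c) <-> cube n s x.
Proof.
move=> r0; split=> h i; have := h i; rewrite !mxE !in_itv/= addrC lerD2l lerD2l -mulNr;
  by rewrite ![_ * r]mulrC !ler_pM2l.
Qed.

Lemma box_bounded_ball n (c : 'rV[R]_n) r : box_bounded (box_ball c r).
Proof.
exists (`|c| + `|r|); first by rewrite addr_ge0.
move=> x h; apply/cubeP => i; have := h i; rewrite in_itv/= -ler_distl => {}h.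
rewrite -[x ord0 i](subrK (c ord0 i)) addrC (le_trans (ler_normD _ _))// lerD//.
  exact: coord_le_norm.
by rewrite (le_trans h)// ler_norm.
Qed.

Lemma Rintegral_box_ball n (c : 'rV[R]_n) r (f : 'rV[R]_n -> R) : 0 < r ->
  continuous f -> (forall x, 0 <= f x) ->
  \int[leb n]_(x in cube n 1%R) f (r *: x + c) = r ^- n * \int[leb n]_(x in box_ball c r) f x.
Proof.
move=> r0 cf f0.
have mb := measurable_box_ball c r.
pose g := ((EFin \o f) \_ (box_ball c r))%E.
have mg : measurable_fun [set: 'rV[R]_n] g.
  apply/(measurable_restrictT (EFin \o f) mb).
  by apply/measurable_EFinP; exact: continuous_measurable_rV.
have g0 x : (0 <= g x)%E by rewrite /g patchE; case: ifP => // _; rewrite lee_fin.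
have := ge0_integral_leb_affine c r0 mg g0.
rewrite -[X in (_ * X)%E]integral_mkcond => E.
rewrite /Rintegral.
have -> : (\int[leb n]_(x in cube n 1%R) (f (r *: x + c)%R)%:E = \int[leb n]_x g (r *: x + c)%R)%E.
  rewrite integral_mkcond; apply: eq_integral => x _; rewrite /g !patchE /=.
  congr (if _ then _ else _); apply/idP/idP; rewrite !inE => h.
    by have := (box_ball_affine c 1 x r0).2 h; rewrite mul1r.
  by apply: (box_ball_affine c 1 x r0).1; rewrite mul1r.
have fin : (\int[leb n]_(x in box_ball c r) (f x)%:E)%E \is a fin_num.
  exact: (integrable_fin_num mb (continuous_integrable_box mb (box_bounded_ball c r) cf)).
by rewrite E -(fineK fin) -EFinM.
Qed.

Lemma continuous_affine n (r : R) (c : 'rV[R]_n) : continuous (fun x : 'rV[R]_n => r *: x + c).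
Proof. move=> x; exact: (cvgD (@scaler_continuous R 'rV[R]_n r x) (cvg_cst c)). Qed.

Lemma affine_section n (P : 'rV[R]_n -> R) p (r : R) c : r != 0 -> sep_poly p P ->
  forall x i, exists2 q : {poly R}, (size q <= p.+1)%N &
    (forall t, P (r *: upd x i t + c) = q.[t]) /\
    q^`().[x ord0 i] = r * pderive i P (r *: x + c).
Proof.
move=> r0 sP x i; have [q sq hq] := sP (r *: x + c) i.
pose l : {poly R} := r%:P * 'X + (c ord0 i)%:P.
have hl t : l.[t] = r * t + c ord0 i by rewrite /l !hornerE.
exists (q \Po l).
  rewrite size_comp_poly2//.
  by rewrite /l size_MXaddC polyC_eq0 (negbTE r0)/= size_polyC r0.
split=> [t|].
  rewrite horner_comp hl -hq; congr P; apply/rowP => j; rewrite !mxE.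
  by case: eqP => [->|].
rewrite deriv_comp hornerM horner_comp hl (pderive_section hq) mulrC.
by rewrite /l derivD derivM !derivC derivX mul0r add0r mulr1 addr0 hornerC !mxE.
Qed.

(** Translation and dilation to the unit cube produce the power of r: n from the
    measure and 2 from the squared derivative. *)
Lemma inverse_estimate p n (rho : R) : 1 <= rho -> exists2 C : R, 0 <= C &
  forall P : 'rV[R]_n -> R, continuous P -> sep_poly p P ->
  forall c r, 0 < r -> forall y i, box_ball c (rho * r) y ->
  r ^+ n.+2 * pderive i P y ^+ 2 <= C * \int[leb n]_(x in box_ball c r) (P x ^+ 2).
Proof.
move=> r1; have [C C0 hC] := @sep_pderive_bound p n rho r1; exists C => //.
move=> P cP sP c r r0 y i hy; have r0' : r != 0 by rewrite gt_eqF.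
pose Q x := P (r *: x + c).
have cQ : continuous Q.
  suff : continuous (P \o (fun x => r *: x + c)) by [].
  by move=> x; apply: continuous_comp; [exact: continuous_affine|exact: cP].
have sQ : sep_poly p Q.
  by move=> x j; have [q sq [hq _]] := affine_section c r0' sP x j; exists q.
pose x := r^-1 *: (y - c).
have xE : r *: x + c = y by rewrite /x scalerA divff// scale1r subrK.
have cx : cube n rho x by apply/(box_ball_affine c rho x r0); rewrite xE.
have := hC Q cQ sQ x i cx.
have [q sq [hq dq]] := affine_section c r0' sP x i.
rewrite (@pderive_section n Q x i q hq) dq xE.
rewrite (@Rintegral_box_ball n c r (fun z => P z ^+ 2))//; last 2 first.
- by move=> z; apply: (@continuous_comp _ _ _ P (fun t => t ^+ 2)); [exact: cP|exact: exprn_continuous].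
- by move=> z; exact: sqr_ge0.
by rewrite exprMn [C * _]mulrCA ler_pdivlMl ?exprn_gt0// mulrA -exprD addn2.
Qed.

Lemma poly_smooth_sep p n (P : 'rV[R]_n -> R) : Defs.polynomial p P -> smooth P /\ sep_poly p P.
Proof.
move=> [c /funext hP]; have -> : P = fun x => \sum_(a : {ffun 'I_n -> 'I_p.+1} | (\sum_i a i <= p)%N)
   c a * \prod_i x ord0 i ^+ a i by exact: hP.
split.
  apply: smooth_sum => a _; apply: smoothZ; apply: smooth_prod => i _.
  elim: (nat_of_ord (a i)) => [|k IH].
    by under eq_fun do rewrite expr0; exact: smooth_cst.
  under eq_fun do rewrite exprS.
  exact: smoothM (smooth_coord i) IH.
move=> x i; exists (\sum_(a : {ffun 'I_n -> 'I_p.+1} | (\sum_i a i <= p)%N)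
   (c a * \prod_(j | j != i) x ord0 j ^+ a j) *: 'X^(a i)).
  apply: (leq_trans (size_sum _ _ _)); apply/bigmax_leqP => a _.
  by apply: (leq_trans (size_scale_leq _ _)); rewrite size_polyXn ltnS -ltnS.
move=> t; rewrite horner_sum; apply: eq_bigr => a _.
rewrite hornerZ hornerXn (bigD1 i)//= mxE eqxx -mulrA; congr (_ * _).
rewrite mulrC; congr (_ * _); apply: eq_bigr => j /negbTE ji.
by rewrite mxE ji.
Qed.

Lemma polynomial_lin p n (a : R) (P Q : 'rV[R]_n -> R) : Defs.polynomial p P -> Defs.polynomial p Q ->
  Defs.polynomial p (fun x => a * P x + Q x).
Proof.
move=> [c hc] [e he]; exists (fun k => a * c k + e k) => x.
rewrite hc he mulr_sumr -big_split; apply: eq_bigr => k _ /=.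
by rewrite mulrDl mulrA.
Qed.

End inverse_estimate.

(** * Simplices and the decomposition of the domain into cells *)

Lemma set_mem_cons (I : eqType) (i : I) s : [set` i :: s] = i |` [set` s].
Proof.
apply/seteqP; split=> j /=; rewrite inE; first by case/orP => [/eqP->|]; [left|right].
by case=> [->|->]; rewrite ?eqxx ?orbT.
Qed.

Lemma negligible_fin_bigcup (R : realType) n (I : finType) (A : {set I}) (F : I -> set 'rV[R]_n) :
  (forall i, i \in A -> (leb n).-negligible (F i)) ->
  (leb n).-negligible (\bigcup_(i in [set` A]) F i).
Proof.
move=> h; have -> : [set` A] = [set` enum A] by apply/seteqP; split=> i /=; rewrite mem_enum.
have {h} : forall i, i \in enum A -> (leb n).-negligible (F i) by move=> i; rewrite mem_enum; exact: h.
elim: (enum A) => [|i s IH] h.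
  by rewrite set_nil bigcup_set0; exact: negligible_set0.
rewrite set_mem_cons bigcup_setU1; apply: negligibleU; first by apply: h; exact: mem_head.
by apply: IH => j js; apply: h; rewrite inE js orbT.
Qed.

Section simplices.
Context {R : realType} {d : nat} {m : mesh R d}.
Implicit Types (S T F : {set 'I_(num_nodes m)}) (x : 'rV[R]_d).

Definition bary_fun (c : 'I_(num_nodes m) -> 'I_d -> R) (b : 'I_(num_nodes m) -> R) i x : R :=
  b i + \sum_j c i j * x ord0 j.

(** The open simplex, that is the relative interior of the hull. *)
Definition ohull T : set 'rV[R]_d := [set x | exists l : 'I_(num_nodes m) -> R,
  [/\ forall i, i \in T -> 0 < l i, \sum_(i in T) l i = 1
    & x = \sum_(i in T) l i *: node i]].

(** Affine independence makes the square matrix with rows (1, node) invertible; its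
    inverse gives the coordinates as affine functions, which the topology and the
    measure of simplices are read off from. *)
Lemma barycentric_coordinates T : #|T| = d.+1 -> affinely_independent T ->
  exists c b,
   (forall x, \sum_(i in T) bary_fun c b i x = 1 /\
       x = \sum_(i in T) bary_fun c b i x *: node i) /\
   (forall l : 'I_(num_nodes m) -> R, \sum_(i in T) l i = 1 -> forall i, i \in T ->
       bary_fun c b i (\sum_(i in T) l i *: node i) = l i).
Proof.
move=> hT aT.
pose e (k : 'I_d.+1) : 'I_(num_nodes m) := enum_val (cast_ord (esym hT) k).
have ei : injective e by move=> k k' /enum_val_inj/cast_ord_inj.
have eT k : e k \in T by exact: enum_valP.
have sumT (V : nmodType) (G : 'I_(num_nodes m) -> V) : \sum_(i in T) G i = \sum_k G (e k).
  rewrite big_enum_val (reindex (cast_ord (esym hT)))//.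
  by exists (cast_ord hT) => k _; rewrite ?cast_ordK ?cast_ordKV.
have eE i : i \in T -> exists k, i = e k.
  move=> iT; exists (cast_ord hT (enum_rank_in iT i)).
  by rewrite /e cast_ordK enum_rankK_in.
pose M : 'M[R]_d.+1 := \matrix_(k, j) (if unlift ord0 j is Some j' then node (e k) ord0 j' else 1).
pose pick (u : 'I_d.+1 -> R) i : R := \sum_k (e k == i)%:R * u k.
have pickE u k : pick u (e k) = u k.
  rewrite /pick (bigD1 k)//= eqxx mul1r big1 ?addr0// => k' kk'.
  by rewrite (inj_eq ei) (negbTE kk') mul0r.
have uM : M \in unitmx.
  rewrite -row_free_unit -kermx_eq0; apply/eqP/eqP/rowV0P => u /sub_kermxP u0.
  have s0 : \sum_(i in T) pick (u ord0) i = 0.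
    have /(congr1 (fun A : 'rV[R]_d.+1 => A ord0 ord0)) := u0.
    rewrite !mxE sumT => e0; rewrite -[RHS]e0; apply: eq_bigr => k _.
    by rewrite pickE mxE unlift_none mulr1.
  have s1 : \sum_(i in T) pick (u ord0) i *: node i = 0.
    apply/rowP => j; have /(congr1 (fun A : 'rV[R]_d.+1 => A ord0 (lift ord0 j))) := u0.
    rewrite !mxE sumT summxE => e0; rewrite -[RHS]e0; apply: eq_bigr => k _.
    by rewrite pickE !mxE liftK.
  by apply/rowP => k; rewrite mxE -[LHS]pickE; exact: aT s0 s1 _ (eT k).
pose y x : 'rV[R]_d.+1 := \row_j (if unlift ord0 j is Some j' then x ord0 j' else 1).
pose lam x k := (y x *m invmx M) ord0 k.
pose c i j := pick (fun k => invmx M (lift ord0 j) k) i.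
pose b i := pick (fun k => invmx M ord0 k) i.
have bE k x : bary_fun c b (e k) x = lam x k.
  rewrite /bary_fun /b pickE /lam mxE big_ord_recl !mxE unlift_none mul1r; congr (_ + _).
  by apply: eq_bigr => j _; rewrite /c pickE !mxE liftK mulrC.
exists c, b; split=> [x|l l1 i iT].
  have E : (\row_k lam x k) *m M = y x.
    have -> : \row_k lam x k = y x *m invmx M by apply/rowP => k; rewrite mxE.
    by rewrite mulmxKV.
  split.
    have /(congr1 (fun A : 'rV[R]_d.+1 => A ord0 ord0)) := E.
    rewrite !mxE unlift_none sumT => <-; apply: eq_bigr => k _.
    by rewrite bE !mxE unlift_none mulr1.
  apply/rowP => j; have /(congr1 (fun A : 'rV[R]_d.+1 => A ord0 (lift ord0 j))) := E.
  rewrite !mxE liftK sumT summxE => <-; apply: eq_bigr => k _.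
  by rewrite bE !mxE liftK.
have [k ->] := eE _ iT; rewrite bE /lam.
have -> : y (\sum_(i in T) l i *: node i) = (\row_k l (e k)) *m M.
  apply/rowP => j; case: (unliftP ord0 j) => [j' ->|->].
    rewrite !mxE liftK summxE sumT.
    by apply: eq_bigr => k' _; rewrite !mxE liftK.
  rewrite !mxE unlift_none -[LHS]l1 sumT.
  by apply: eq_bigr => k' _; rewrite !mxE unlift_none mulr1.
by rewrite mulmxK// mxE.
Qed.

Lemma ohull_hull T : ohull T `<=` hull T.
Proof. by move=> x [l [l0 l1 xl]]; exists l; split=> // i iT; rewrite ltW// l0. Qed.

Lemma continuous_bary c b i : continuous (bary_fun c b i).
Proof.
by move=> x; apply: continuousD; [exact: cst_continuous|exact: continuous_sum_coord].
Qed.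

Lemma hullE T c b :
   (forall x, \sum_(i in T) bary_fun c b i x = 1 /\ x = \sum_(i in T) bary_fun c b i x *: node i) ->
   (forall l : 'I_(num_nodes m) -> R, \sum_(i in T) l i = 1 -> forall i, i \in T ->
       bary_fun c b i (\sum_(i in T) l i *: node i) = l i) ->
   (forall x, hull T x <-> forall i, i \in T -> 0 <= bary_fun c b i x) /\
   (forall x, ohull T x <-> forall i, i \in T -> 0 < bary_fun c b i x).
Proof.
move=> h1 h2; split=> x; split.
- by move=> [l [l0 l1 ->]] i iT; rewrite h2//; exact: l0.
- by move=> h; exists (fun i => bary_fun c b i x); have [? ?] := h1 x; split.
- by move=> [l [l0 l1 ->]] i iT; rewrite h2//; exact: l0.
- by move=> h; exists (fun i => bary_fun c b i x); have [? ?] := h1 x; split.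
Qed.

Definition simplex T := #|T| = d.+1 /\ affinely_independent T.

Lemma ohull_open T : simplex T -> open (ohull T).
Proof.
move=> [hT aT]; have [c [b [h1 h2]]] := barycentric_coordinates hT aT.
have [_ oE] := hullE h1 h2.
have -> : ohull T = \bigcap_(i in [set i | i \in T]) (bary_fun c b i @^-1` `]0, +oo[%classic).
  apply/seteqP; split=> x.
    by move=> /oE h i /= iT; rewrite in_itv/= andbT; exact: h.
  by move=> h; apply/oE => i iT; have := h i iT; rewrite /= in_itv/= andbT.
rewrite -[X in open X]setCK; apply: closed_openC; rewrite setC_bigcap.
apply: closed_bigcup => [|i _]; first exact: finite_finset.
by apply: open_closedC; apply: open_comp => [x _|]; [exact: continuous_bary|exact: interval_open].
Qed.

Lemma hull_closed T : simplex T -> closed (hull T).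
Proof.
move=> [hT aT]; have [c [b [h1 h2]]] := barycentric_coordinates hT aT.
have [hE _] := hullE h1 h2.
have -> : hull T = \bigcap_(i in [set i | i \in T]) (bary_fun c b i @^-1` `[0, +oo[%classic).
  apply/seteqP; split=> x.
    by move=> /hE h i /= iT; rewrite in_itv/= andbT; exact: h.
  by move=> h; apply/hE => i iT; have := h i iT; rewrite /= in_itv/= andbT.
apply: closed_bigI => i _.
by apply: closed_comp => [x _|]; [exact: continuous_bary|exact: interval_closed].
Qed.

Lemma node_hull T i : i \in T -> hull T (node i).
Proof.
move=> iT; exists (fun j => (j == i)%:R); split=> [j _||].
- exact: ler0n.
- by rewrite (bigD1 i)//= eqxx big1 ?addr0// => j /andP[_ /negbTE ->].
- rewrite (bigD1 i)//= eqxx scale1r big1 ?addr0// => j /andP[_ /negbTE ->].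
  by rewrite scale0r.
Qed.

(** On the boundary some barycentric coordinate vanishes, and these are nonconstant
    affine functions. *)
Lemma hull_boundary_negligible T : (0 < d)%N -> simplex T ->
  (leb d).-negligible (hull T `\` ohull T).
Proof.
move=> d0 [hT aT]; have [c [b [h1 h2]]] := barycentric_coordinates hT aT.
have [hE oE] := hullE h1 h2.
pose H i := [set x : 'rV[R]_d | \sum_j c i j * x ord0 j = - b i].
have nz i : i \in T -> exists j, c i j != 0.
  move=> iT; apply: contrapT => /forallNP h.
  have c0 j : c i j = 0 by have := h j; move/negP/negPn/eqP.
  have [k kT ki] : exists2 k, k \in T & k != i.
    have : (0 < #|T :\ i|)%N by rewrite (cardsD1 i) iT add1n in hT; case: hT => ->.
    by move=> /card_gt0P[k]; rewrite !inE => /andP[? ?]; exists k.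
  have bn j : j \in T -> bary_fun c b i (node j) = (i == j)%:R.
    move=> jT; have sn : \sum_(l in T) (l == j)%:R = 1 :> R.
      by rewrite (bigD1 j)//= eqxx big1 ?addr0// => l /andP[_ /negbTE ->].
    rewrite -(h2 (fun l => (l == j)%:R) sn i iT); congr bary_fun.
    rewrite (bigD1 j)//= eqxx scale1r big1 ?addr0// => l /andP[_ /negbTE ->].
    by rewrite scale0r.
  have := bn _ iT; have := bn _ kT; rewrite eq_sym (negbTE ki) eqxx /bary_fun.
  under eq_bigr do rewrite c0 mul0r; under [in X in _ -> X -> _]eq_bigr do rewrite c0 mul0r.
  by move=> -> /eqP; rewrite eq_sym oner_eq0.
have sub : hull T `\` ohull T `<=` \bigcup_(i in [set` T]) H i.
  move=> x [/hE hx nx]; apply: contrapT => h; apply: nx; apply/oE => i iT.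
  rewrite lt_neqAle hx// andbT; apply/negP => /eqP e; apply: h; exists i => //.
  by rewrite /H /=; move: e; rewrite /bary_fun; move: (\sum_j _) => s; lra.
apply: (negligibleS sub); apply: negligible_fin_bigcup => i iT.
exists (H i); split=> //; first exact: measurable_hyperplane.
by apply: leb_hyperplane; exact: nz.
Qed.

(** A common point lies in the hull of the shared vertices, where the barycentric
    coordinate of a vertex that is not shared vanishes. *)
Lemma ohull_disjoint T T' : simplex T -> simplex T' ->
  hull T `&` hull T' = hull (T :&: T') -> T != T' -> ohull T `&` ohull T' = set0.
Proof.
move=> [hT aT] [hT' aT'] hI TT'; apply/seteqP; split=> // x [oT oT'].
have [c [b [h1 h2]]] := barycentric_coordinates hT aT.
have [_ oE] := hullE h1 h2.
have : hull (T :&: T') x by rewrite -hI; split; exact: ohull_hull.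
move=> [l [l0 l1 xl]].
have [i iT iT'] : exists2 i, i \in T & i \notin T'.
  apply/subsetPn; apply: contra TT' => sub; rewrite eqEcard sub/=.
  by rewrite hT hT'.
pose l' j := if j \in T' then l j else 0.
have e1 : \sum_(j in T) l' j = 1.
  by rewrite -l1 -big_mkcondr; apply: eq_bigl => j; rewrite !inE.
have e2 : x = \sum_(j in T) l' j *: node j.
  rewrite xl (eq_bigl (fun j => (j \in T) && (j \in T'))) => [|j]; last by rewrite !inE.
  rewrite big_mkcondr; apply: eq_bigr => j _.
  by rewrite /l'; case: ifP => // _; rewrite scale0r.
have := (oE x).1 oT i iT; rewrite e2 h2// /l' (negbTE iT').
by rewrite ltxx.
Qed.

Lemma hull_bounded T : box_bounded (hull T).
Proof.
exists (\sum_(i in T) `|node i|); first by apply: sumr_ge0.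
move=> x [l [l0 l1 ->]]; apply/cubeP => j; rewrite summxE.
apply: (le_trans (ler_norm_sum _ _ _)); apply: ler_sum => i iT.
rewrite mxE normrM (ger0_norm (l0 _ iT)) -[leRHS]mul1r ler_pM ?l0//; last exact: coord_le_norm.
rewrite -l1 (bigD1 i)//= lerDl; apply: sumr_ge0 => k /andP[kT _]; exact: l0.
Qed.

End simplices.

Section triangulated_domain.
Context {R : realType} {d : nat} {m : mesh R d} {Omega : set 'rV[R]_d}.
Hypotheses (d0 : (0 < d)%N) (pO : polygonal_domain Omega) (tO : triangulation Omega m).
Implicit Types (S T F : {set 'I_(num_nodes m)}) (x y : 'rV[R]_d).

Lemma cell_simplex T : T \in cells m -> simplex T.
Proof. by case: tO => -[h _] _; exact: h. Qed.

Lemma hull_sub_closure T : T \in cells m -> hull T `<=` closure Omega.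
Proof. by move=> Tm x hx; case: tO => -[_ ->] _; exists T. Qed.

Lemma domain_open : open Omega. Proof. by case: pO. Qed.

Lemma domain_bounded : box_bounded Omega.
Proof.
have h : forall s : seq {set 'I_(num_nodes m)}, box_bounded (\bigcup_(T in [set` s]) hull T).
  elim=> [|T s [r r0 IH]].
    by exists 0 => // x; rewrite set_nil bigcup_set0.
  have [r' r'0 h'] := hull_bounded T.
  exists (r + r'); first exact: addr_ge0.
  rewrite set_mem_cons bigcup_setU1 => x [/h'|/IH] /cubeP h; apply/cubeP => i;
    by apply: (le_trans (h i)); lra.
have [r r0 hr] := h (enum (cells m)); exists r => // x Ox; apply: hr.
have : closure Omega x by exact: subset_closure.
case: tO => -[_ ->] _ [T Tm hT]; exists T => //=; by rewrite mem_enum.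
Qed.

(** An open subset of the closure, hence of its interior, which is the domain. *)
Lemma ohull_sub T : T \in cells m -> ohull T `<=` Omega.
Proof.
move=> Tm; case: pO => _ _ _ <- _; rewrite -open_subsetE.
  exact: subset_trans (@ohull_hull _ _ _ T) (hull_sub_closure Tm).
by apply: ohull_open; exact: cell_simplex.
Qed.

Lemma measurable_ohull T : T \in cells m -> measurable (ohull T).
Proof. by move=> Tm; apply: open_measurable_rV; apply: ohull_open; exact: cell_simplex. Qed.

Lemma trivIset_ohull : trivIset [set` enum (cells m)] ohull.
Proof.
apply/trivIsetP => T T' /=; rewrite !mem_enum => Tm T'm.
by apply: ohull_disjoint; [exact: cell_simplex|exact: cell_simplex|case: tO => _; exact].
Qed.

Lemma domain_cells_negligible :
  (leb d).-negligible (Omega `\` \bigcup_(T in [set` enum (cells m)]) ohull T).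
Proof.
have sub : Omega `\` \bigcup_(T in [set` enum (cells m)]) ohull T `<=`
    \bigcup_(T in [set` cells m]) (hull T `\` ohull T).
  move=> x [Ox nx]; have : closure Omega x by exact: subset_closure.
  case: tO => -[_ ->] _ [T Tm hT]; exists T => //; split=> // oT.
  by apply: nx; exists T => //=; rewrite mem_enum.
apply: (negligibleS sub); apply: negligible_fin_bigcup => T Tm; apply: hull_boundary_negligible => //.
exact: cell_simplex.
Qed.

(** The open cells are disjoint and exhaust the domain up to the negligible
    boundaries of the cells. *)
Lemma Rintegral_cells f : (leb d).-integrable Omega (EFin \o f) ->
  \int[leb d]_(x in Omega) f x = \sum_(T in cells m) \int[leb d]_(x in ohull T) f x.
Proof.
move=> If; have mO := open_measurable_rV domain_open.
pose U := \bigcup_(T in [set` enum (cells m)]) ohull T.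
have mU : measurable U.
  by rewrite /U bigcup_seq; rewrite big_enum; apply: bigsetU_measurable => T; exact: measurable_ohull.
have UO : U `<=` Omega by apply: bigcup_sub => T /=; rewrite mem_enum; exact: ohull_sub.
have Z : leb d (Omega `\` U) = 0%E.
  have [N [mN N0 sub]] := domain_cells_negligible.
  apply/eqP; rewrite eq_le measure_ge0 andbT -N0.
  by apply: le_measure => //; rewrite inE//; exact: measurableD.
pose G T := if T \in cells m then ohull T else set0.
have GE : \big[setU/set0]_(T <- enum (cells m)) G T = U.
  by rewrite /U bigcup_seq; apply: eq_big_seq => T; rewrite mem_enum /G => ->.
rewrite /Rintegral (negligible_integral _ _ If Z)//; last exact: measurableD.
rewrite setDD (_ : Omega `&` U = U); last by apply/setIidPr.
have mf : measurable_fun U (EFin \o f).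
  by apply: (measurable_funS mO UO); exact: (measurable_int _ If).
rewrite -GE (integral_bigsetU_EFin (leb d)); first last.
- by rewrite GE.
- apply/trivIsetP => T T' Tm T'm TT'; rewrite /G; move: (Tm) (T'm) => /=; rewrite !mem_enum => -> ->.
  by have /trivIsetP/(_ T T' Tm T'm TT') := trivIset_ohull.
- exact: enum_uniq.
- by move=> T; rewrite /G; case: ifP => // Tm; exact: measurable_ohull.
rewrite -sum_fine; last first.
  move=> T _; rewrite /G; case: ifP => Tm; last by rewrite integral_set0.
  apply: integrable_fin_num; first exact: measurable_ohull.
  by apply: (integrableS mO _ (ohull_sub Tm) If); exact: measurable_ohull.
rewrite big_enum; apply: eq_bigr => T Tm.
by rewrite /G Tm.
Qed.

End triangulated_domain.

Section mesh_size.
Context {R : realType} {d : nat}.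
Implicit Types (x y c : 'rV[R]_d) (A : set 'rV[R]_d).

Lemma box_bounded_enorm A : box_bounded A ->
  exists M : R, forall x y, A x -> A y -> enorm (x - y) <= M.
Proof.
move=> [r r0 Ar]; exists (\sum_(i < d) (r + r)) => x y /Ar/cubeP hx /Ar/cubeP hy.
apply: (le_trans (enorm_le_sum _)); apply: ler_sum => i _; rewrite !mxE.
by apply: (le_trans (ler_normB _ _)); apply: lerD.
Qed.

Lemma le_diam A x y : box_bounded A -> A x -> A y -> enorm (x - y) <= diam A.
Proof.
move=> /box_bounded_enorm[M hM] Ax Ay; apply: ub_le_sup; last by exists (x, y).
by exists M => _ [[a b] [/= Aa Ab] <-]; exact: hM.
Qed.

Lemma diam_le A D x : A x -> (forall x y, A x -> A y -> enorm (x - y) <= D) -> diam A <= D.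
Proof.
move=> Ax h; apply: ge_sup; first by exists (enorm (x - x)); exists (x, x).
by move=> _ [[a b] [/= Aa Ab] <-]; exact: h.
Qed.

Lemma diam_ge0 A : 0 <= diam A.
Proof.
have [[_ [[a b] [/= Aa Ab] _]]|h] := pselect ([set enorm (xy.1 - xy.2) | xy in A `*` A] !=set0).
  have [bA|nb] := pselect (has_ubound [set enorm (xy.1 - xy.2) | xy in A `*` A]).
    by apply: (le_trans (enorm_ge0 (a - b))); apply: ub_le_sup => //; exists (a, b).
  by rewrite /diam sup_out// => -[].
by rewrite /diam sup_out// => -[].
Qed.

Lemma enorm_box_ball c (r : R) : 0 <= r -> box_ball c (r / d%:R) `<=` [set y | enorm (y - c) <= r].
Proof.
move=> r0 y hy; apply: (le_trans (enorm_le_sum _)).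
apply: (@le_trans _ _ (\sum_(i < d) (r / d%:R))).
  by apply: ler_sum => i _; rewrite !mxE ler_distl; have := hy i; rewrite in_itv.
have [->|d1] := posnP d; first by rewrite big_ord0.
by rewrite sumr_const card_ord -(mulr_natr (r / d%:R)) divfK// pnatr_eq0 -lt0n.
Qed.

Lemma box_ball_enorm x c (r : R) : enorm (x - c) <= r -> box_ball c r x.
Proof.
move=> h i; rewrite in_itv/= -ler_distl; apply: le_trans h.
by have := coord_le_enorm (x - c) i; rewrite !mxE.
Qed.

Lemma leb_box_ball c (r : R) : 0 < r -> leb d (box_ball c r) = ((2 * r) ^+ d)%:E.
Proof.
move=> r0; have := @Rintegral_box_ball R d c r (fun=> 1) r0 (@cst_continuous _ _ _) (fun=> ler01).
have mb := measurable_box_ball c r; have mc := @measurable_cube R d 1.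
rewrite !Rintegral_cst// !mul1r => {}h.
have {}h : fine (leb d (cube d 1)) = r ^- d * fine (leb d (box_ball c r)) by exact: h.
rewrite leb_cube ?ler01//= mulr1 in h.
rewrite -[LHS]fineK; last by rewrite ge0_fin_numE// box_bounded_lty//; exact: box_bounded_ball.
congr (_%:E); rewrite exprMn_comm ?h; last exact: mulrC.
by rewrite mulrAC mulVf ?mul1r// expf_neq0// gt_eqF.
Qed.

Variable m : mesh R d.
Implicit Types (S T F : {set 'I_(num_nodes m)}).

Lemma diam_le_mesh_size T : T \in cells m -> diam (hull T) <= mesh_size m.
Proof. by move=> Tm; apply: (le_bigmax_cond _ (fun T => diam (hull T))). Qed.

Lemma mesh_size_le D : 0 <= D -> (forall T, T \in cells m -> diam (hull T) <= D) -> mesh_size m <= D.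
Proof. by move=> D0 h; apply: bigmax_le. Qed.

Lemma inball_diam_ge0 A : 0 <= inball_diam A.
Proof.
rewrite /inball_diam; set E := [set _ | _ in _].
have [[[e Ee] uE]|h] := pselect (has_sup E); last by rewrite sup_out.
by case: (Ee) => r [r0 _] re; apply: (@le_trans _ _ e); [rewrite -re mulr_ge0|exact: ub_le_sup].
Qed.

(** Shape regularity and quasi-uniformity place every cell between two
    concentric cubes whose sizes are comparable with the mesh size. *)
Lemma cell_box sigma q T : (0 < d)%N -> shape_regular sigma m -> quasi_uniform q m ->
  0 < mesh_size m -> simplex T -> T \in cells m ->
  let K := 4 * `|q * sigma| * d%:R in
  exists c r, [/\ 0 < r, box_ball c r `<=` hull T, mesh_size m <= K * r & hull T `<=` box_ball c (K * r)].
Proof.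
move=> d0 sr qu h0 sT Tm K; set h := mesh_size m in h0 *.
have q1 := qu _ Tm; have s1 := sr _ Tm; have D0 := diam_ge0 (hull T); have I0 := inball_diam_ge0 (hull T).
have hI : h <= `|q * sigma| * inball_diam (hull T).
  rewrite -/h in q1; move: q1 s1 D0 I0; move: (diam _) (inball_diam _) => D I q1 s1 D0 I0.
  apply: (le_trans q1); apply: (@le_trans _ _ (`|q| * D)).
    by rewrite ler_wpM2r// ler_norm.
  rewrite normrM -mulrA ler_wpM2l//; apply: (le_trans s1); by rewrite ler_wpM2r// ler_norm.
have I1 : 0 < inball_diam (hull T).
  by rewrite lt_neqAle I0 andbT; apply/negP => /eqP I1; move: hI; rewrite -I1 mulr0 leNgt h0.
have [e [r [r0 [c hc]] re] er] : exists2 e : R, [set 2 * r | r in [set r | 0 <= r /\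
    exists c, [set y | enorm (y - c) <= r] `<=` hull T]] e & inball_diam (hull T) / 2 < e.
  have hs : has_sup [set 2 * r | r in [set r | 0 <= r /\
    exists c, [set y | enorm (y - c) <= r] `<=` hull T]].
    by apply: contrapT => ns; move: I1; rewrite /inball_diam sup_out// ltxx.
  have [|e Ee he] := @sup_adherent _ _ (inball_diam (hull T) / 2) _ hs; first by rewrite divr_gt0.
  by exists e => //; apply: le_lt_trans he; rewrite -/(inball_diam (hull T)); lra.
have r1 : inball_diam (hull T) / 4 < r by rewrite -re in er; lra.
have dR : 0 < (d%:R : R) by rewrite ltr0n.
have hK : h <= K * (r / d%:R).
  have -> : K * (r / d%:R) = `|q * sigma| * (4 * r) by rewrite /K; field; rewrite gt_eqF.
  by apply: (le_trans hI); rewrite ler_wpM2l//; lra.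
exists c, (r / d%:R); split=> //.
- by rewrite divr_gt0//; lra.
- by apply: subset_trans hc; exact: enorm_box_ball.
- move=> x hx; apply: box_ball_enorm; apply: le_trans hK.
  apply: le_trans (diam_le_mesh_size Tm); apply: le_diam => //; first exact: hull_bounded.
  by apply: hc => /=; rewrite subrr /enorm /dotv big1 ?sqrtr0// => i _; rewrite mxE mul0r.
Qed.

End mesh_size.

(** * Inverse estimates for discrete functions *)

Section cellwise_inverse.
Context {R : realType} {d : nat}.
Implicit Types (x y : 'rV[R]_d) (P f : 'rV[R]_d -> R).

Lemma Rintegral_sub_hull (m : mesh R d) (T : {set 'I_(num_nodes m)}) (A : set 'rV[R]_d) f :
  (0 < d)%N -> simplex T -> measurable A -> A `<=` hull T -> continuous f -> (forall x, 0 <= f x) ->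
  \int[leb d]_(x in A) f x <= \int[leb d]_(x in ohull T) f x.
Proof.
move=> d0 sT mA Asub cf f0.
have bT := hull_bounded T.
have mH : measurable (hull T) by apply: closed_measurable_rV; exact: hull_closed.
have mo : measurable (ohull T) by apply: open_measurable_rV; exact: ohull_open.
have IH := continuous_integrable_box mH bT cf.
have [N [mN N0 sub]] := hull_boundary_negligible d0 sT.
have Z : leb d (hull T `\` ohull T) = 0%E.
  apply/eqP; rewrite eq_le measure_ge0 andbT -N0.
  by apply: le_measure => //; rewrite inE//; exact: measurableD.
have -> : \int[leb d]_(x in ohull T) f x = \int[leb d]_(x in hull T) f x.
  rewrite /Rintegral [in RHS](negligible_integral _ _ IH Z)//; last exact: measurableD.
  rewrite setDD; congr (fine (integral _ _ _)); symmetry; apply/setIidPr; exact: ohull_hull.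
apply: fine_le.
- by apply: integrable_fin_num => //; exact: (integrableS mH mA Asub IH).
- exact: integrable_fin_num.
- apply: ge0_subset_integral => //; first exact: (measurable_int _ IH).
  by move=> x _; rewrite lee_fin.
Qed.

Lemma smooth_pderive_continuous P i : smooth P -> continuous (pderive i P).
Proof. by move=> sP; apply: smooth_continuous; exact: smooth_pderive. Qed.

(** A cell contains a cube and lies in a concentric one, both of size comparable
    with the mesh size; the derivative anywhere in the large cube is controlled by the
    mean square on the small one. *)
Lemma cell_inverse p (sigma q : R) : (0 < d)%N -> exists2 C : R, 0 <= C &
  forall m : mesh R d, shape_regular sigma m -> quasi_uniform q m -> 0 < mesh_size m ->
  forall T, T \in cells m -> simplex T -> forall P, Defs.polynomial p P ->
  forall y i, hull T y ->
  mesh_size m ^+ d.+2 * pderive i P y ^+ 2 <= C * \int[leb d]_(x in ohull T) (P x ^+ 2).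
Proof.
move=> d0; pose K := 4 * `|q * sigma| * d%:R : R.
have K0 : 0 <= K by rewrite /K !mulr_ge0.
have [|C C0 hC] := @inverse_estimate R p d (K + 1); first by rewrite lerDr.
exists (K ^+ d.+2 * C); first by rewrite mulr_ge0// exprn_ge0.
move=> m sr qu h0 T Tm sT P pP y i hy.
have [c [r [r0 cr hr rT]]] := cell_box d0 sr qu h0 sT Tm; rewrite -/K in hr rT.
have [sP seP] := poly_smooth_sep pP; have cP := smooth_continuous sP.
have hy' : box_ball c ((K + 1) * r) y.
  move=> j; have := rT _ hy j; rewrite !in_itv/= -!ler_distl => /le_trans; apply.
  by rewrite ler_wpM2r ?lerDl// ltW.
have e1 := hC _ cP seP c r r0 y i hy'.
have cP2 : continuous (fun x => P x ^+ 2) by move=> x; apply: continuousM; exact: cP.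
have e2 := Rintegral_sub_hull d0 sT (measurable_box_ball c r) cr cP2 (fun x => sqr_ge0 _).
apply: (@le_trans _ _ ((K * r) ^+ d.+2 * pderive i P y ^+ 2)).
  apply: ler_wpM2r; first exact: sqr_ge0.
  by rewrite lerXn2r// nnegrE ?mulr_ge0// ltW.
rewrite exprMn -[leLHS]mulrA -[leRHS]mulrA; apply: ler_wpM2l; first exact: exprn_ge0.
by apply: (le_trans e1); exact: ler_wpM2l.
Qed.

Lemma Rintegral_le_cell (m : mesh R d) T f (M : R) : 0 < mesh_size m -> T \in cells m -> simplex T ->
  continuous f -> (forall x, ohull T x -> f x <= M) -> 0 <= M ->
  \int[leb d]_(x in ohull T) f x <= M * (2 * mesh_size m) ^+ d.
Proof.
move=> h0 Tm sT cf fM M0; have mo : measurable (ohull T) by apply: open_measurable_rV; exact: ohull_open.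
have [r r0 hr] := hull_bounded T.
have bo : box_bounded (ohull T) by exists r => //; apply: subset_trans hr; exact: ohull_hull.
apply: (@le_trans _ _ (\int[leb d]_(x in ohull T) M)).
  apply: le_Rintegral => //; apply: continuous_integrable_box => //.
  exact: cst_continuous.
rewrite Rintegral_cst//; apply: ler_wpM2l => //.
have [k kT] : exists k, k \in T by apply/set0Pn; rewrite -card_gt0 sT.1.
have hb : (leb d (ohull T) <= ((2 * mesh_size m) ^+ d)%:E)%E.
  rewrite -(leb_box_ball (node k) h0); apply: le_measure; rewrite ?inE//.
    exact: measurable_box_ball.
  move=> x /ohull_hull hx; apply: box_ball_enorm; apply: le_trans (diam_le_mesh_size Tm).
  by apply: le_diam => //; [exact: hull_bounded|exact: node_hull].
by rewrite -lee_fin fineK// ge0_fin_numE// (le_lt_trans hb)// ltry.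
Qed.

(** Summing the cellwise estimates: discrete functions satisfy
    [h |grad v| <= C |v|] in the mean square. *)
Lemma wderive_inverse p (sigma q : R) : (0 < d)%N -> exists2 C : R, 0 <= C &
  forall (Omega : set 'rV[R]_d) m, polygonal_domain Omega -> triangulation Omega m ->
  shape_regular sigma m -> quasi_uniform q m -> 0 < mesh_size m ->
  forall v i, Vh Omega m p v ->
  mesh_size m ^+ 2 * ip Omega (wderive Omega i v) (wderive Omega i v) <= C * ip Omega v v.
Proof.
move=> d0; have [C C0 hC] := @cell_inverse p sigma q d0.
exists (2 ^+ d * C); first by rewrite mulr_ge0// exprn_ge0.
move=> Omega m pO tO sr qu h0 v i [Hv pv].
have oO := domain_open pO; have mO := open_measurable_rV oO.
have sw := H1_si_wderive oO i Hv.
have I1 := si_sq mO sw; have I2 := si_sq mO Hv.1.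
rewrite /ip (Rintegral_cells d0 pO tO I1) (Rintegral_cells d0 pO tO I2) !mulr_sumr.
apply: ler_sum => T Tm; have sT := cell_simplex tO Tm.
have [P pP vP] := pv T Tm; have [sP _] := poly_smooth_sep pP; have cP := smooth_continuous sP.
have mo := measurable_ohull tO Tm; have oT := ohull_open sT; have oTO := ohull_sub pO tO Tm.
have cdP := @smooth_pderive_continuous P i sP.
have -> : \int[leb d]_(x in ohull T) (wderive Omega i v x * wderive Omega i v x) =
    \int[leb d]_(x in ohull T) (pderive i P x ^+ 2).
  have vP' : {in ohull T, v =1 P} by move=> x /set_mem /ohull_hull; exact: vP.
  have mw : measurable_fun (ohull T) (wderive Omega i v) by exact: measurable_funS sw.1.
  apply: Rintegral_ae => //.
  - exact: measurable_funM.
  - by apply: measurable_funX; exact: continuous_measurable_rV.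
  - have := wderive_local oO oT oTO (H1_weak i Hv) sP vP'.
    by apply: filterS => x hx ox; rewrite hx// expr2.
have -> : \int[leb d]_(x in ohull T) (v x * v x) = \int[leb d]_(x in ohull T) (P x ^+ 2).
  by apply: eq_Rintegral => x /set_mem/ohull_hull hx; rewrite vP.
have hT := hC m sr qu h0 T Tm sT P pP.
set I := \int[leb d]_(x in ohull T) (P x ^+ 2) in hT *.
have I0 : 0 <= I by apply: Rintegral_ge0 => x _; exact: sqr_ge0.
set h := mesh_size m in hT h0 *.
have hd : 0 < h ^+ d.+2 by rewrite exprn_gt0.
apply: (@le_trans _ _ (h ^+ 2 * ((C * I / h ^+ d.+2) * (2 * h) ^+ d))).
  apply: ler_wpM2l; first exact: sqr_ge0.
  apply: Rintegral_le_cell => //.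
  - by move=> x; apply: continuousM; exact: cdP.
  - by move=> x /ohull_hull hx; rewrite ler_pdivlMr// mulrC; exact: hT.
  - by rewrite mulr_ge0 ?mulr_ge0// invr_ge0 ltW.
have -> : h ^+ d.+2 = h ^+ 2 * h ^+ d by rewrite -exprD.
rewrite exprMn; move: (h ^+ d) (exprn_gt0 d h0) => hh hh0.
rewrite le_eqVlt; apply/orP; left; apply/eqP; field; by rewrite !gt_eqF.
Qed.

End cellwise_inverse.

(** * Convection and diffusion on discrete functions *)

Section discrete_forms.
Context {R : realType} {d : nat}.
Implicit Types (Omega : set 'rV[R]_d) (u v w : 'rV[R]_d -> R).

Lemma Vh_lin Omega (m : mesh R d) p (a : R) u v : open Omega -> Vh Omega m p u -> Vh Omega m p v ->
  Vh Omega m p (fun x => a * u x + v x).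
Proof.
move=> oO [hu pu] [hv pv]; split; first exact: H1_lin.
move=> T Tm; have [P pP uP] := pu T Tm; have [Q pQ vQ] := pv T Tm.
exists (fun x => a * P x + Q x); first exact: polynomial_lin.
by move=> x hx; rewrite uP// vQ.
Qed.

Lemma Vh0_lin Omega (m : mesh R d) p (a : R) u v : open Omega -> Vh0 Omega m p u -> Vh0 Omega m p v ->
  Vh0 Omega m p (fun x => a * u x + v x).
Proof. by move=> oO [hu tu] [hv tv]; split; [exact: Vh_lin|exact: H10_lin]. Qed.

Lemma diff_formE Omega mu u v : open Omega -> H1 Omega u -> H1 Omega v ->
  diff_form Omega mu u v = mu * \sum_i ip Omega (wderive Omega i u) (wderive Omega i v).
Proof.
move=> oO hu hv; have mO := open_measurable_rV oO.
have su i := H1_si_wderive oO i hu; have sv i := H1_si_wderive oO i hv.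
have I i := si_integrable_mul mO (su i) (sv i).
have Is : forall r : seq 'I_d,
    (leb d).-integrable Omega (EFin \o (fun x => \sum_(i <- r) wderive Omega i u x * wderive Omega i v x)) /\
    \int[leb d]_(x in Omega) (\sum_(i <- r) wderive Omega i u x * wderive Omega i v x) =
    \sum_(i <- r) ip Omega (wderive Omega i u) (wderive Omega i v).
  elim=> [|i r [IH1 IH2]].
    split; first by under eq_fun do rewrite /= big_nil; exact: integrable0.
    by under eq_Rintegral do rewrite big_nil; rewrite big_nil Rintegral_cst// mul0r.
  split.
    rewrite (_ : _ \o _ = (fun x => (wderive Omega i u x * wderive Omega i v x)%:E +
      (\sum_(i <- r) wderive Omega i u x * wderive Omega i v x)%:E)%E).
      by apply: integrableD => //; exact: I.
    by apply/funext => x /=; rewrite big_cons EFinD.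
  under eq_Rintegral do rewrite big_cons.
  by rewrite big_cons -IH2 RintegralD//; exact: I.
have [I1 I2] := Is (index_enum 'I_d).
rewrite /diff_form -I2 -RintegralZl//.
by apply: eq_Rintegral => x _; congr (_ * _); apply: eq_bigr => i _; rewrite !mxE.
Qed.

Lemma diff_form_linl Omega mu (a : R) u v w : open Omega -> H1 Omega u -> H1 Omega v -> H1 Omega w ->
  diff_form Omega mu (fun x => a * u x + v x) w = a * diff_form Omega mu u w + diff_form Omega mu v w.
Proof.
move=> oO hu hv hw; have mO := open_measurable_rV oO.
rewrite !diff_formE//; last exact: H1_lin.
rewrite mulrCA -mulrDr; congr (_ * _); rewrite mulr_sumr -big_split; apply: eq_bigr => i _ /=.
have su := H1_si_wderive oO i hu; have sv := H1_si_wderive oO i hv; have sw := H1_si_wderive oO i hw.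
have sl := H1_si_wderive oO i (H1_lin oO a hu hv).
rewrite -(ip_linl mO)//; apply: Rintegral_ae.
- exact: mO.
- by apply: measurable_funM; [exact: sl.1|exact: sw.1].
- by apply: measurable_funM; [exact: (si_lin mO a su sv).1|exact: sw.1].
- by have := wderive_lin oO a i hu hv; apply: filterS => x hx Ox; rewrite hx.
Qed.

Lemma diff_formC Omega mu u v : diff_form Omega mu u v = diff_form Omega mu v u.
Proof. by apply: eq_Rintegral => x _; rewrite dotvC. Qed.

Lemma diff_form_ge0 Omega mu v : 0 <= mu -> 0 <= diff_form Omega mu v v.
Proof. by move=> m0; apply: Rintegral_ge0 => x _; rewrite mulr_ge0// dotv_ge0. Qed.

Lemma energy_sqE Omega m mu gamma eps (beta : 'rV[R]_d -> 'rV[R]_d) v : 0 <= mu ->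
  0 <= stab_form m eps beta v v ->
  energy_sq Omega m mu gamma eps beta v = gamma * stab_form m eps beta v v + diff_form Omega mu v v.
Proof.
move=> m0 s0; rewrite /energy_sq /stab_seminorm sqr_sqrtr//; congr (_ + _).
by apply: eq_Rintegral => x _; rewrite enormZ exprMn enorm_sq ger0_norm ?sqrtr_ge0// sqr_sqrtr.
Qed.

(** On discrete functions the inverse estimate turns the derivative in the
    convection form into a factor of order [1 / h], and the diffusion form into
    a multiple of the square norm. *)
Lemma discrete_form_bounds p (sigma q : R) : (0 < d)%N -> exists2 C : R, 0 <= C &
  forall Omega m, polygonal_domain Omega -> triangulation Omega m ->
  shape_regular sigma m -> quasi_uniform q m -> 0 < mesh_size m ->
  (forall beta w v, admissible_velocity Omega beta -> Vh Omega m p w -> Vh Omega m p v ->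
    `|conv_form Omega beta w v| <= C * (sup_norm Omega beta / mesh_size m) * L2norm Omega w * L2norm Omega v) /\
  (forall mu v, 0 <= mu -> Vh Omega m p v ->
    diff_form Omega mu v v <= C * (mu / mesh_size m ^+ 2) * L2norm Omega v ^+ 2).
Proof.
move=> d0; have [C0 C00 hC] := @wderive_inverse R d p sigma q d0.
pose C := d%:R * C0 + d%:R * Num.sqrt C0.
have C1 : d%:R * C0 <= C by rewrite /C lerDl mulr_ge0.
have C2 : d%:R * Num.sqrt C0 <= C by rewrite /C lerDr mulr_ge0.
exists C; first by apply: le_trans C1; rewrite mulr_ge0.
move=> Omega m pO tO sr qu h0; have oO := domain_open pO; have mO := open_measurable_rV oO.
have bO := domain_bounded tO.
have {}hC v i hv := hC Omega m pO tO sr qu h0 v i hv.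
set h := mesh_size m in h0 hC *.
split=> [beta w v ab hw hv|mu v m0 hv].
  apply: (le_trans (conv_form_le oO bO ab hw.1 hv.1.1)).
  apply: ler_wpM2r; first exact: L2norm_ge0.
  rewrite (mulrC C) -!mulrA; apply: ler_wpM2l; first exact: (sup_norm_ge0 bO ab).
  have n0 := L2norm_ge0 Omega w.
  apply: (@le_trans _ _ (\sum_(i < d) h^-1 * (Num.sqrt C0 * L2norm Omega w))).
    apply: ler_sum => i _; rewrite ler_pdivlMl//.
    rewrite -(@ler_pXn2r _ 2)// ?nnegrE ?mulr_ge0 ?sqrtr_ge0 ?(ltW h0)//.
    rewrite !exprMn !L2norm_sq sqr_sqrtr//; exact: hC.
  rewrite sumr_const card_ord -[leLHS]mulr_natl mulrCA.
  apply: ler_wpM2l; first by rewrite invr_ge0 ltW.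
  by rewrite mulrA; apply: ler_wpM2r.
rewrite diff_formE//; try exact: hv.1.
rewrite (mulrC C) -!mulrA; apply: ler_wpM2l => //.
apply: (@le_trans _ _ (\sum_(i < d) (h ^+ 2)^-1 * (C0 * ip Omega v v))).
  apply: ler_sum => i _; rewrite ler_pdivlMl ?exprn_gt0//; exact: hC.
rewrite sumr_const card_ord -[leLHS]mulr_natl mulrCA.
apply: ler_wpM2l; first by rewrite invr_ge0 exprn_ge0// ltW.
by rewrite L2norm_sq mulrA; apply: ler_wpM2r => //; exact: ip_ge0.
Qed.

End discrete_forms.

(** * Integration off a null set *)

Section null_sets.
Import HBNNSimple.
Context {disp : measure_display} {T : measurableType disp} {R : realType} (mu : {measure set T -> \bar R}).
Implicit Types (D N : set T).

Let nn (f : T -> \bar R) :=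
  ereal_sup [set sintegral mu h | h in [set h : {nnsfun T >-> R} | forall x, ((h x)%:E <= f x)%E]].

Let nn_le_off N (f g : T -> \bar R) : measurable N -> mu N = 0%E ->
  (forall x, 0 <= g x)%E -> (forall x, ~ N x -> f x = g x) -> (nn f <= nn g)%E.
Proof.
move=> mN N0 g0 fg; apply: ge_ereal_sup => _ /= [h hf <-].
have mC : measurable (setT `\` N) by exact: measurableD.
apply: ereal_sup_ubound; exists (proj_nnsfun h mC) => /=.
  move=> x; rewrite /mindic indicE; have [Nx|nN] := pselect (N x).
    by rewrite memNset ?mulr0//; case.
  by rewrite mem_set ?mulr1// -fg.
have -> : h \* mindic R mC = h \_ (setT `\` N).
  apply/funext => x; rewrite patchE /= /mindic indicE.
  by case: (x \in _); rewrite ?mulr1 ?mulr0.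
rewrite -(integral_nnsfun mu mC h) -integralT_nnsfun; symmetry.
apply: ge0_negligible_integral => //.
- by apply/measurable_EFinP.
- by move=> x _; rewrite lee_fin.
Qed.

(** The integral ignores null sets even for functions that are not measurable;
    this matters for jumps on the boundary of a face, where they have no good
    description. *)
Lemma Rintegral_off_null D N (f g : T -> R) : measurable N -> mu N = 0%E ->
  (forall x, D x -> ~ N x -> f x = g x) ->
  \int[mu]_(x in D) f x = \int[mu]_(x in D) g x.
Proof.
move=> mN N0 fg; congr fine; rewrite /integral -/(nn _) -/(nn _).
have E x : ~ N x -> ((EFin \o f) \_ D) x = ((EFin \o g) \_ D) x.
  move=> nN; rewrite !patchE; case: ifPn => // /set_mem Dx /=; by rewrite fg.
congr (_ - _)%E; apply/eqP; rewrite eq_le; apply/andP; split;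
  apply: (nn_le_off mN N0) => x //; rewrite ?funeposE ?funenegE ?le_max ?lexx ?orbT// => nN.
all: by rewrite /funepos /funeneg /= E.
Qed.

End null_sets.

(** * Faces and their parametrisation *)

Section reference_simplex.
Context {R : realType}.

Definition open_ref_simplex n : set 'rV[R]_n :=
  [set t | (forall i, 0 < t ord0 i) /\ \sum_i t ord0 i < 1].

Lemma ref_simplex_closed n : closed (@ref_simplex R n).
Proof.
have -> : @ref_simplex R n =
    \bigcap_(i in [set: 'I_n]) ((fun t : 'rV[R]_n => t ord0 i) @^-1` `[0, +oo[%classic) `&`
    ((fun t : 'rV[R]_n => \sum_i 1 * t ord0 i) @^-1` `]-oo, 1]%classic).
  apply/seteqP; split=> t.
    move=> [h1 h2]; split=> [i _|] /=; rewrite in_itv/= ?h1//.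
    by under eq_bigr do rewrite mul1r.
  move=> [h1 h2]; split=> [i|].
    by have := h1 i I; rewrite /= in_itv/= andbT.
  by have := h2; rewrite /= in_itv/=; under eq_bigr do rewrite mul1r.
apply: closedI.
  apply: closed_bigI => i _; apply: closed_comp => [t _|]; last exact: interval_closed.
  exact: coord_continuous.
by apply: closed_comp => [t _|]; [exact: continuous_sum_coord|exact: interval_closed].
Qed.

Lemma ref_simplex_cube n : @ref_simplex R n `<=` cube n 1.
Proof.
move=> t [t0 t1]; apply/cubeP => i; rewrite ger0_norm//; apply: le_trans t1.
by rewrite (bigD1 i)//= lerDl sumr_ge0.
Qed.

Lemma ref_simplex_bounded n : box_bounded (@ref_simplex R n).
Proof. by exists 1 => //; exact: ref_simplex_cube. Qed.

Lemma measurable_ref_simplex n : measurable (@ref_simplex R n).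
Proof. exact: closed_measurable_rV (ref_simplex_closed (n := n)). Qed.

Lemma ref_simplex_boundary n : exists N : set 'rV[R]_n,
  [/\ measurable N, leb n N = 0%E & forall t, ref_simplex t -> ~ N t -> open_ref_simplex t].
Proof.
have neg : (leb n).-negligible
   (\bigcup_(i in [set` [set: 'I_n]%SET]) [set t : 'rV[R]_n | \sum_j (j == i)%:R * t ord0 j = 0] `|`
    [set t : 'rV[R]_n | \sum_j 1 * t ord0 j = 1]).
  apply: negligibleU.
    apply: negligible_fin_bigcup => i _; eexists; split; last exact: subset_refl.
      exact: measurable_hyperplane.
    by apply: leb_hyperplane; exists i; rewrite eqxx oner_eq0.
  case: n => [|n].
    apply: (@negligibleS _ _ _ _ set0); last exact: negligible_set0.
    by move=> t /= /eqP; rewrite big_ord0 eq_sym oner_eq0.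
  eexists; split; last exact: subset_refl.
    exact: measurable_hyperplane.
  by apply: leb_hyperplane; exists ord0; exact: oner_neq0.
have [N [mN N0 sub]] := neg; exists N; split=> // t [t0 t1] nN; split.
  move=> i; rewrite lt_neqAle t0 andbT; apply/negP => /eqP e; apply: nN; apply: sub.
  left; exists i => //=; first by rewrite inE.
  rewrite (bigD1 i)//= eqxx mul1r -e big1 ?addr0// => j /negbTE ->; exact: mul0r.
rewrite lt_neqAle t1 andbT; apply/negP => /eqP e; apply: nN; apply: sub.
by right; rewrite /= -[RHS]e; apply: eq_bigr => j _; rewrite mul1r.
Qed.

End reference_simplex.

Section faces.
Context {R : realType} {n : nat} {m : mesh R n.+1}.
Implicit Types (S T F : {set 'I_(num_nodes m)}) (x y : 'rV[R]_n.+1) (t : 'rV[R]_n).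

Definition face_node F k : 'rV[R]_n.+1 := nth 0 [seq node i | i <- enum F] k.

Definition face_jac F : 'M[R]_(n, n.+1) :=
  \matrix_(k, j) (face_node F k.+1 - face_node F 0%N) ord0 j.

Definition face_param F t := face_node F 0%N + t *m face_jac F.

Lemma face_integralE F f : face_integral F f =
  Num.sqrt (\det (face_jac F *m (face_jac F)^T)) *
  \int[leb n]_(t in @ref_simplex R n) f (face_param F t).
Proof. by []. Qed.

(** The parameters are barycentric coordinates, completed by that of the base
    vertex. *)
Lemma face_param_hull F : #|F| = n.+1 ->
  (forall t, ref_simplex t -> hull F (face_param F t)) /\
  (forall t, open_ref_simplex t -> ohull F (face_param F t)).
Proof.
move=> hF.
pose e (k : 'I_n.+1) : 'I_(num_nodes m) := enum_val (cast_ord (esym hF) k).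
have ei : injective e by move=> k k' /enum_val_inj/cast_ord_inj.
have eF k : e k \in F by exact: enum_valP.
have sumF (V : nmodType) (G : 'I_(num_nodes m) -> V) : \sum_(i in F) G i = \sum_k G (e k).
  rewrite big_enum_val (reindex (cast_ord (esym hF)))//.
  by exists (cast_ord hF) => k _; rewrite ?cast_ordK ?cast_ordKV.
have eE i : i \in F -> exists k, i = e k.
  move=> iF; exists (cast_ord hF (enum_rank_in iF i)).
  by rewrite /e cast_ordK enum_rankK_in.
have nodeE (k : 'I_n.+1) : face_node F k = node (e k).
  rewrite /face_node (nth_map (e k)) -?cardE ?hF//; congr node.
  by rewrite /e /enum_val; apply: set_nth_default; rewrite -cardE hF.
pose u t (k : 'I_n.+1) := if unlift ord0 k is Some k' then t ord0 k' else 1 - \sum_k t ord0 k.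
pose l t i : R := \sum_k (e k == i)%:R * u t k.
have lE t k : l t (e k) = u t k.
  rewrite /l (bigD1 k)//= eqxx mul1r big1 ?addr0// => k' kk'.
  by rewrite (inj_eq ei) (negbTE kk') mul0r.
have l1 t : \sum_(i in F) l t i = 1.
  rewrite sumF big_ord_recl lE /u unlift_none -[RHS](subrK (\sum_k t ord0 k)).
  by congr (_ + _); apply: eq_bigr => k _; rewrite lE /u liftK.
have pE t : face_param F t = \sum_(i in F) l t i *: node i.
  rewrite sumF; apply/rowP => j; rewrite /face_param !mxE summxE big_ord_recl !mxE lE /u unlift_none.
  have -> : \sum_(i < n) t ord0 i * face_jac F i j =
     \sum_(i < n) t ord0 i * node (e (lift ord0 i)) ord0 j - (\sum_k t ord0 k) * node (e ord0) ord0 j.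
    rewrite mulr_suml -sumrB; apply: eq_bigr => i _; rewrite !mxE mulrBr.
    by rewrite (nodeE ord0) -(nodeE (lift ord0 i)).
  have -> : \sum_(i < n) (l t (e (lift ord0 i)) *: node (e (lift ord0 i))) ord0 j =
     \sum_(i < n) t ord0 i * node (e (lift ord0 i)) ord0 j.
    by apply: eq_bigr => i _; rewrite !mxE lE /u liftK.
  by rewrite (nodeE ord0) mulrBl mul1r addrCA addrC.
split=> t [t0 t1]; exists (l t); split=> // i /eE[k ->]; rewrite lE /u.
  by case: (unliftP ord0 k) => [k' _|_]; [exact: t0|rewrite subr_ge0].
by case: (unliftP ord0 k) => [k' _|_]; [exact: t0|rewrite subr_gt0].
Qed.

Lemma face_param_continuous F : continuous (face_param F).
Proof.
have c : continuous (fun t : 'rV[R]_n => t *m face_jac F).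
  have -> : (fun t : 'rV[R]_n => t *m face_jac F) = (fun t => \sum_k t ord0 k *: row k (face_jac F)).
    by apply/funext => s; exact: mulmx_sum_row.
  apply: continuous_big => [x|i _ s]; first exact: add_continuous.
  by apply: continuousZl; exact: coord_continuous.
by move=> t; exact: (cvgD (cvg_cst _) (c t)).
Qed.

Lemma hull_mono S T : S \subset T -> hull S `<=` hull T.
Proof.
move=> /finset.setIidPr ST x [l [l0 l1 xl]]; exists (fun i => if i \in S then l i else 0); split.
- by move=> i _; case: ifP => // iS; exact: l0.
- by rewrite -big_mkcondr -l1; apply: eq_bigl => i; rewrite -[in RHS]ST inE.
- rewrite xl -[in LHS]ST (eq_bigl (fun i => (i \in T) && (i \in S))) => [|i]; last by rewrite inE.
  by rewrite big_mkcondr; apply: eq_bigr => i _; case: ifP => // _; rewrite scale0r.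
Qed.

End faces.

(** * Gradient jumps *)

Lemma pderive_lin (R : realType) n (a : R) (P Q : 'rV[R]_n -> R) i x : smooth P -> smooth Q ->
  pderive i (fun y => a * P y + Q y) x = a * pderive i P x + pderive i Q x.
Proof.
move=> sP sQ; have dP y := smooth_differentiable y sP; have dQ y := smooth_differentiable y sQ.
have dc y : differentiable (cst a : 'rV[R]_n -> R) y by exact: differentiable_cst.
have -> : (fun y => a * P y + Q y) = (cst a \* P) \+ Q by [].
rewrite pderiveD//; last by move=> y; apply: smooth_differentiable; exact: smoothZ.
rewrite pderiveM// /= [pderive i (cst a) x]derive_cst mulr0 addr0; by [].
Qed.

Section gradient_jump.
Context {R : realType} {d : nat} {m : mesh R d}.
Implicit Types (S T F : {set 'I_(num_nodes m)}) (x y v : 'rV[R]_d).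

Lemma enorm0 : enorm (0 : 'rV[R]_d) = 0.
Proof. by rewrite /enorm /dotv big1 ?sqrtr0// => i _; rewrite mxE mul0r. Qed.

Lemma dotv0r x : dotv x 0 = 0.
Proof. by rewrite /dotv big1// => i _; rewrite mxE mulr0. Qed.

Lemma face_normal_le1 F : enorm (face_normal F) <= 1.
Proof. by rewrite /face_normal; case: xgetP => [y -> [-> _]|_]; rewrite ?enorm0. Qed.

Lemma cell_normal_le1 T F : enorm (cell_normal T F) <= 1.
Proof. by rewrite /cell_normal; case: xgetP => [y -> [[-> _] _]|_]; rewrite ?enorm0. Qed.

Lemma baryB c b i x v (e : R) :
  bary_fun c b i (x - e *: v) = bary_fun (m := m) c b i x - e * \sum_j c i j * v ord0 j.
Proof.
rewrite /bary_fun -addrA mulr_sumr -sumrB; congr (_ + _); apply: eq_bigr => j _.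
by rewrite !mxE mulrBr mulrCA.
Qed.

Lemma dotv_suml (I : Type) (r : seq I) (P : pred I) (a : I -> R) (X : I -> 'rV[R]_d) v :
  dotv (\sum_(i <- r | P i) a i *: X i) v = \sum_(i <- r | P i) a i * dotv (X i) v.
Proof.
elim/big_rec2: _ => [|i y1 y2 _ <-]; last by rewrite dotv_linl.
by rewrite dotvC dotv0r.
Qed.

Lemma dotvBl x y v : dotv (x - y) v = dotv x v - dotv y v.
Proof. by rewrite addrC -scaleN1r dotv_linl mulN1r addrC. Qed.

(** Moving from a point of a face against the outward normal of a cell enters
    the cell: the barycentric coordinates of the vertices of the face stay
    positive, and that of the opposite vertex grows from 0. *)
Lemma inward_ohull T F v x : simplex T -> F \subset T -> #|F| = d ->
  unit_normal F v -> (forall i j, i \in F -> j \in T :\: F -> dotv (node j - node i) v < 0) ->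
  ohull F x -> \forall e \near 0^'+, ohull T (x - e *: v).
Proof.
move=> sT FT hF [v1 vF] vT [l [l0 l1 xl]].
have [hT aT] := sT; have [c [b [h1 h2]]] := barycentric_coordinates hT aT.
have [_ oE] := hullE h1 h2.
pose l' i := if i \in F then l i else 0.
have FTi i : (i \in T) && (i \in F) = (i \in F).
  by case iF: (i \in F); rewrite ?andbF// (fintype.subsetP FT).
have l'1 : \sum_(i in T) l' i = 1 by rewrite -big_mkcondr -l1; apply: eq_bigl.
have xl' : x = \sum_(i in T) l' i *: node i.
  rewrite xl -(eq_bigl _ _ FTi) big_mkcondr; apply: eq_bigr => i _.
  by rewrite /l'; case: ifP => // _; rewrite scale0r.
have bx i : i \in T -> bary_fun c b i x = l' i by move=> iT; rewrite xl' h2.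
pose g i := \sum_j c i j * v ord0 j.
have [j jT jF] : exists2 j, j \in T & j \notin F.
  by apply/subsetPn/negP => /subset_leq_card; rewrite hT hF ltnn.
have Tj i : i \in T -> i \notin F -> i = j.
  move=> iT iF; have : #|T :\: F| == 1%N by rewrite cardsDS// hT hF subSnn.
  move=> /cards1P[k Dk]; have : i \in T :\: F by rewrite inE iF.
  have : j \in T :\: F by rewrite inE jF.
  by rewrite Dk !inE => /eqP -> /eqP ->.
have [i0 i0F] : exists i, i \in F.
  apply/set0Pn; apply/eqP => F0; move: l1; rewrite F0 big_set0 => /eqP.
  by rewrite eq_sym oner_eq0.
have gj : g j < 0.
  have E : dotv (x - 1 *: v - node i0) v = - 1.
    rewrite !dotvBl scale1r -enorm_sq v1 expr1n xl dotv_suml.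
    have -> : \sum_(i in F) l i * dotv (node i) v = dotv (node i0) v.
      rewrite -[RHS]mul1r -l1 mulr_suml; apply: eq_bigr => i iF; congr (_ * _).
      by apply/eqP; rewrite -subr_eq0 -dotvBl vF.
    by rewrite addrAC subrr add0r.
  have [s1 s2] := h1 (x - 1 *: v).
  have : dotv (x - 1 *: v - node i0) v = (- g j) * dotv (node j - node i0) v.
    have bz i : i \in T -> bary_fun c b i (x - 1 *: v) = l' i - g i.
      by move=> iT; rewrite baryB bx// mul1r.
    move: (x - 1 *: v) s1 s2 bz => z s1 s2 bz.
    have e0 : dotv (node i0) v = \sum_(i in T) bary_fun c b i z * dotv (node i0) v.
      by rewrite -mulr_suml s1 mul1r.
    rewrite [in LHS]s2 dotvBl dotv_suml e0 -sumrB.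
    rewrite (bigD1 j)//= big1 ?addr0.
      by rewrite -mulrBr -dotvBl bz// /l' (negbTE jF) sub0r.
    move=> i /andP[iT ij]; rewrite -mulrBr -dotvBl; case: (boolP (i \in F)) => iF.
      by rewrite vF// mulr0.
    by rewrite (Tj i) ?eqxx in ij.
  rewrite E; have := vT i0 j i0F; rewrite inE jF jT => /(_ isT).
  move: (dotv _ _) (g j) => D G D0 e; nra.
suff : \forall e \near (0 : R)^'+, forall i, i \in T -> 0 < bary_fun c b i (x - e *: v).
  by apply: filterS => e h; apply/oE.
apply: filter_forall => i.
have [iF|iF] := boolP (i \in F).
  have gp : 0 < `|g i| + 1 by rewrite ltr_pwDr.
  have p : 0 < l i / (`|g i| + 1) by rewrite divr_gt0// l0.
  near=> e => iT; rewrite baryB bx// /l' iF -/(g i).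
  have e0 : 0 < e by [].
  have : e < l i / (`|g i| + 1) by near: e; exact: nbhs_right_lt.
  rewrite ltr_pdivlMr// => h; rewrite subr_gt0; apply: le_lt_trans h.
  by rewrite ler_wpM2l ?(ltW e0)// (le_trans (ler_norm _))// lerDl.
near=> e => iT; rewrite (Tj i iT iF) baryB bx// /l' (negbTE jF) -/(g j) sub0r -mulrN.
by rewrite mulr_gt0 ?oppr_gt0//.
Unshelve. all: by end_near. Qed.

(** For small e the gradient is evaluated inside a single cell, where the function
    equals one that is smooth up to the face. *)
Lemma grad_jumpE F w (P : {set 'I_(num_nodes m)} -> 'rV[R]_d -> R) x :
  (forall T, T \in cells m -> simplex T) -> #|F| = d ->
  (forall T, T \in cells m -> F \subset T -> smooth (P T) /\ forall y, hull T y -> w y = P T y) ->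
  ohull F x ->
  grad_jump F w x = \sum_(T in cells m | F \subset T)
    dotv (\row_i pderive i (P T) x) (cell_normal T F).
Proof.
move=> sC hF hP Fx; apply: cvg_lim => //.
apply: cvg_big; first exact: add_continuous.
move=> T /andP[Tm FT]; have [sP wP] := hP T Tm FT; have sT := sC T Tm.
set v := cell_normal T F.
have hv : v = 0 \/ (unit_normal F v /\ forall i j, i \in F -> j \in T :\: F -> dotv (node j - node i) v < 0).
  by rewrite /v /cell_normal; case: xgetP => [y -> ?|_]; [right|left].
case: hv => [->|[uv vT]].
  by under eq_cvg do rewrite dotv0r; rewrite dotv0r; exact: cvg_cst.
have cG : continuous (fun y => dotv (\row_i pderive i (P T) y) v).
  apply: continuous_big => [z|i _ y]; first exact: add_continuous.
  under [X in continuous_at _ X]eq_fun do rewrite mxE.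
  apply: continuousM; last exact: cst_continuous.
  exact: smooth_pderive_continuous.
have L : (x - e *: v) @[e --> (0 : R)^'+] --> x.
  apply: cvg_at_right_filter; rewrite -[X in _ --> X]subr0 -(scale0r v).
  by apply: cvgB; [exact: cvg_cst|apply: cvgZr_tmp; exact: cvg_id].
apply: (cvg_trans _ (continuous_cvg _ (cG x) L)); apply: near_eq_cvg.
have := inward_ohull sT FT hF uv vT Fx; apply: filterS => e oe /=.
apply: eq_bigr => i _; rewrite !mxE; congr (_ * _).
apply: near_eq_derive; have : nbhs (x - e *: v) (ohull T) by apply: open_nbhs_nbhs; split=> //; exact: ohull_open.
by apply: filterS => y /ohull_hull hy; rewrite wP.
Qed.

End gradient_jump.

(** * The stabilisation form *)

Section stabilisation.
Context {R : realType} {n : nat} {m : mesh R n.+1} {Omega : set 'rV[R]_n.+1}.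
Hypotheses (pO : polygonal_domain Omega) (tO : triangulation Omega m).
Variables (p : nat) (beta : 'rV[R]_n.+1 -> 'rV[R]_n.+1) (eps : R).
Hypotheses (ab : admissible_velocity Omega beta) (eps0 : 0 <= eps).
Implicit Types (S T F : {set 'I_(num_nodes m)}) (x y : 'rV[R]_n.+1) (t : 'rV[R]_n) (u v w : 'rV[R]_n.+1 -> R).

(** The polynomial is only known to exist on each cell; a choice makes the jump an
    explicit continuous function. *)
Definition cell_poly v T : 'rV[R]_n.+1 -> R :=
  xget (fun=> 0) [set P | Defs.polynomial p P /\ forall x, hull T x -> v x = P x].

Lemma cell_polyP v T : Vh Omega m p v -> T \in cells m ->
  Defs.polynomial p (cell_poly v T) /\ forall x, hull T x -> v x = cell_poly v T x.
Proof.
move=> [_ /(_ T)] h Tm; have [P pP vP] := h Tm.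
have : [set P | Defs.polynomial p P /\ forall x, hull T x -> v x = P x] (cell_poly v T).
  by apply: xgetPex; exists P.
by [].
Qed.

Definition jump_poly v F x : R := \sum_(T in cells m | F \subset T)
  dotv (\row_i pderive i (cell_poly v T) x) (cell_normal T F).

Lemma interior_faceP F : F \in interior_faces m ->
  #|F| = n.+1 /\ #|[set T in cells m | F \subset T]| = 2.
Proof. by rewrite inE => /andP[/eqP-> /eqP->]. Qed.

Lemma grad_jump_poly v F x : Vh Omega m p v -> F \in interior_faces m -> ohull F x ->
  grad_jump F v x = jump_poly v F x.
Proof.
move=> hv /interior_faceP[hF _] Fx; apply: grad_jumpE => //.
  exact: (cell_simplex tO).
move=> T Tm FT; have [pP vP] := cell_polyP hv Tm.
by split=> //; exact: (poly_smooth_sep pP).1.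
Qed.

Lemma grad_jump_lin (a : R) u v F x : Vh Omega m p u -> Vh Omega m p v -> F \in interior_faces m ->
  ohull F x -> grad_jump F (fun y => a * u y + v y) x = a * grad_jump F u x + grad_jump F v x.
Proof.
move=> hu hv hF Fx; rewrite (grad_jump_poly hu hF Fx) (grad_jump_poly hv hF Fx); have [cF _] := interior_faceP hF.
rewrite (@grad_jumpE _ _ _ F _ (fun T y => a * cell_poly u T y + cell_poly v T y))//.
- rewrite /jump_poly mulr_sumr -big_split; apply: eq_bigr => T /andP[Tm FT] /=.
  rewrite -dotv_linl; congr dotv; apply/rowP => i; rewrite !mxE.
  have sP := (poly_smooth_sep (cell_polyP hu Tm).1).1; have sQ := (poly_smooth_sep (cell_polyP hv Tm).1).1.
  by rewrite pderive_lin.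
- exact: (cell_simplex tO).
- move=> T Tm FT; have [pP uP] := cell_polyP hu Tm; have [pQ vQ] := cell_polyP hv Tm; split.
    apply: smoothD; last exact: (poly_smooth_sep pQ).1.
    by apply: smoothZ; exact: (poly_smooth_sep pP).1.
  by move=> y hy; rewrite uP// vQ.
Qed.

Lemma jump_poly_continuous v F : Vh Omega m p v -> continuous (jump_poly v F).
Proof.
move=> hv; apply: continuous_big => [z|T /andP[Tm _] y]; first exact: add_continuous.
apply: continuous_big => [z|i _ {}y]; first exact: add_continuous.
under [X in continuous_at _ X]eq_fun do rewrite mxE.
apply: continuousM; last exact: cst_continuous.
by apply: smooth_pderive_continuous; exact: (poly_smooth_sep (cell_polyP hv Tm).1).1.
Qed.

Let weight F (z : 'rV[R]_n.+1) : R := diam (hull F) ^+ 2 * (`|dotv z (face_normal F)| + eps).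

Let weight_continuous F : continuous (weight F).
Proof.
move=> z; apply: (@continuousM R _ (fun=> diam (hull F) ^+ 2)
  (fun y => `|dotv y (face_normal F)| + eps) z); first exact: cst_continuous.
apply: (@continuousD _ _ _ (fun y => `|dotv y (face_normal F)|) (fun=> eps)); last exact: cst_continuous.
apply: (@continuous_comp _ _ _ (fun z => dotv z (face_normal F)) Num.norm); last exact: norm_continuous.
apply: continuous_big => [y|i _ y]; first exact: add_continuous.
by apply: continuousM; [exact: coord_continuous|exact: cst_continuous].
Qed.

Lemma interior_face_cell F : F \in interior_faces m -> exists2 T, T \in cells m & F \subset T.
Proof.
move=> /interior_faceP[_ h]; have /card_gt0P[T] : (0 < #|[set T in cells m | F \subset T]|)%N by rewrite h.
by rewrite inE => /andP[? ?]; exists T.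
Qed.

Lemma face_sub_closure F : F \in interior_faces m -> hull F `<=` closure Omega.
Proof.
move=> /interior_face_cell[T Tm FT]; apply: subset_trans (hull_sub_closure tO Tm).
exact: hull_mono.
Qed.

Let integrand u v F t := weight F (beta (face_param F t)) * jump_poly u F (face_param F t) *
  jump_poly v F (face_param F t).

Let integrand_integrable u v F : Vh Omega m p u -> Vh Omega m p v -> F \in interior_faces m ->
  (leb n).-integrable (@ref_simplex R n) (EFin \o integrand u v F).
Proof.
move=> hu hv hF; have [cF _] := interior_faceP hF.
have cb : {within @ref_simplex R n, continuous (fun t => beta (face_param F t))}.
  apply/subspace_continuousP => t rt.
  have [/subspace_continuousP cb _ _ _] := ab.
  have ct : closure Omega (face_param F t).
    by apply: (face_sub_closure hF); exact: (face_param_hull cF).1.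
  move=> A nA; have := cb _ ct A nA; rewrite /within/= => nb.
  have := @face_param_continuous R n m F t _ nb; rewrite /= => nb'.
  have {}nb' : \forall s \near t, closure Omega (face_param F s) -> A (beta (face_param F s)) by exact: nb'.
  have : \forall s \near t, @ref_simplex R n s -> A (beta (face_param F s)); last by [].
  apply: filterS nb' => s hs rs; apply: hs.
  by apply: (face_sub_closure hF); exact: (face_param_hull cF).1.
have cj w : Vh Omega m p w -> {within @ref_simplex R n, continuous (fun t => jump_poly w F (face_param F t))}.
  move=> hw; apply: continuous_subspaceT => t; apply: continuous_comp; first exact: face_param_continuous.
  exact: jump_poly_continuous.
have cI : {within @ref_simplex R n, continuous (integrand u v F)}.
  move=> t; apply: cvgM; last exact: (cj v hv t).
  apply: cvgM; last exact: (cj u hu t).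
  exact: (@continuous_comp (subspace (@ref_simplex R n)) _ _ _ (weight F) t (cb t) (@weight_continuous F _)).
have cR : compact (@ref_simplex R n).
  by apply: bounded_closed_compact; [apply/box_boundedE; exact: ref_simplex_bounded|exact: ref_simplex_closed].
have [M M0 hM] := continuous_compact_bounded cR cI.
apply: (bounded_integrable_leb (M := M)) => //.
- exact: measurable_ref_simplex.
- exact: ref_simplex_bounded.
- by apply: within_continuous_measurable_rV => //; exact: measurable_ref_simplex.
Qed.

Let face_term u v F := face_integral F (fun x =>
    diam (hull F) ^+ 2 * (`|dotv (beta x) (face_normal F)| + eps) * grad_jump F u x * grad_jump F v x).

Let stab_termE u v : stab_form m eps beta u v = \sum_(F in interior_faces m) face_term u v F.
Proof. by []. Qed.

Let face_termE u v F : Vh Omega m p u -> Vh Omega m p v -> F \in interior_faces m ->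
  face_term u v F = Num.sqrt (\det (face_jac F *m (face_jac F)^T)) *
    \int[leb n]_(t in @ref_simplex R n) integrand u v F t.
Proof.
move=> hu hv hF; have [cF _] := interior_faceP hF.
rewrite /face_term face_integralE; congr (_ * _).
have [N [mN N0 sub]] := @ref_simplex_boundary R n.
apply: (@Rintegral_off_null _ _ _ (leb n) _ N) => // t rt nN.
have oF := (face_param_hull cF).2 _ (sub t rt nN).
by rewrite !grad_jump_poly.
Qed.

Lemma stab_form_linl (a : R) u v w : Vh Omega m p u -> Vh Omega m p v -> Vh Omega m p w ->
  stab_form m eps beta (fun x => a * u x + v x) w =
  a * stab_form m eps beta u w + stab_form m eps beta v w.
Proof.
move=> hu hv hw; rewrite !stab_termE mulr_sumr -big_split; apply: eq_bigr => F hF /=.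
have hl := Vh_lin a (domain_open pO) hu hv.
have [cF _] := interior_faceP hF.
rewrite !face_termE// mulrCA -mulrDr; congr (_ * _).
have mr := @measurable_ref_simplex R n.
have Iu := integrand_integrable hu hw hF; have Iv := integrand_integrable hv hw hF.
have [N [mN N0 sub]] := @ref_simplex_boundary R n.
rewrite -RintegralZl// -RintegralD//; last by have := integrableZl mr a Iu.
apply: (@Rintegral_off_null _ _ _ (leb n) _ N) => // t rt nN.
have oF := (face_param_hull cF).2 _ (sub t rt nN).
rewrite /integrand -!grad_jump_poly// grad_jump_lin//.
by move: (weight _ _) (grad_jump _ _ _) (grad_jump _ _ _) (grad_jump _ _ _) => A B C D; ring.
Qed.

Lemma stab_formC u v : stab_form m eps beta u v = stab_form m eps beta v u.
Proof.
rewrite !stab_termE; apply: eq_bigr => F _; rewrite /face_term.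
by apply: (congr1 (face_integral F)); apply/funext => x; exact: mulrAC.
Qed.

Lemma stab_form_ge0 v : 0 <= stab_form m eps beta v v.
Proof.
apply: sumr_ge0 => F _; apply: mulr_ge0; first exact: sqrtr_ge0.
apply: Rintegral_ge0 => t _; rewrite -mulrA -expr2 mulr_ge0 ?sqr_ge0// mulr_ge0 ?sqr_ge0// addr_ge0//.
Qed.

Lemma det_bound (A : 'M[R]_n) (M : R) : (forall i j, `|A i j| <= M) -> `|\det A| <= n`!%:R * M ^+ n.
Proof.
move=> hA; apply: (le_trans (ler_norm_sum _ _ _)).
apply: (@le_trans _ _ (\sum_(s : 'S_n) M ^+ n)); last first.
  by rewrite sumr_const card_Sn mulr_natl.
apply: ler_sum => s _; rewrite normrM normrX normrN1 expr1n mul1r normr_prod.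
have -> : M ^+ n = \prod_(i < n) M by rewrite prodr_const card_ord.
by apply: ler_prod => i _; rewrite normr_ge0 hA.
Qed.

Let h := mesh_size m.

Lemma face_node_hull F k : (k < #|F|)%N -> hull F (face_node F k).
Proof.
move=> kF; have : face_node F k \in [seq node i | i <- enum F].
  by apply: mem_nth; rewrite size_map -cardE.
by move=> /mapP[i]; rewrite mem_enum => iF ->; exact: node_hull.
Qed.

(** The Gram matrix of the edges has entries of order h^2, and a determinant is a sum
    of n! products. *)
Lemma face_measure_bound F : 0 <= h -> F \in interior_faces m ->
  Num.sqrt (\det (face_jac F *m (face_jac F)^T)) <= Num.sqrt n`!%:R * h ^+ n.
Proof.
move=> h0 hF; have [cF _] := interior_faceP hF; have [T Tm FT] := interior_face_cell hF.
have hd x y : hull F x -> hull F y -> enorm (x - y) <= h.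
  move=> Fx Fy; apply: le_trans (diam_le_mesh_size Tm); apply: le_diam; first exact: hull_bounded.
    exact: hull_mono FT _ Fx.
  exact: hull_mono FT _ Fy.
rewrite -[h ^+ n]ger0_norm ?exprn_ge0// -sqrtr_sqr -sqrtrM ?ler0n//.
apply: ler_wsqrtr; apply: (le_trans (ler_norm _)); rewrite -exprM mulnC exprM.
apply: det_bound => i j.
have -> : (face_jac F *m (face_jac F)^T) i j = dotv (row i (face_jac F)) (row j (face_jac F)).
  by rewrite mxE; apply: eq_bigr => k _; rewrite !mxE.
have hr k : enorm (row k (face_jac F)) <= h.
  have -> : row k (face_jac F) = face_node F k.+1 - face_node F 0%N.
    by apply/rowP => j'; rewrite !mxE.
  by apply: hd; apply: face_node_hull; rewrite cF// ltnS.
by apply: (le_trans (dotv_CS _ _)); rewrite expr2; apply: ler_pM => //; exact: enorm_ge0.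
Qed.

Variable C : R.
Hypotheses (C0 : 0 <= C) (h0 : 0 < h).
Hypothesis hC : forall T, T \in cells m -> simplex T -> forall P, Defs.polynomial p P ->
  forall y i, hull T y ->
  h ^+ n.+3 * pderive i P y ^+ 2 <= C * \int[leb n.+1]_(x in ohull T) (P x ^+ 2).

Let cell_mass v T := \int[leb n.+1]_(x in ohull T) (v x * v x).

Lemma cell_mass_ge0 v T : 0 <= cell_mass v T.
Proof. by apply: Rintegral_ge0 => x _; rewrite -expr2 sqr_ge0. Qed.

(** An interior face belongs to exactly two cells, whence the factor 2; on each the
    inverse estimate bounds the gradient. *)
Lemma jump_poly_bound v F x : Vh Omega m p v -> F \in interior_faces m -> hull F x ->
  h ^+ n.+3 * jump_poly v F x ^+ 2 <=
  2 * n.+1%:R * C * \sum_(T in cells m | F \subset T) cell_mass v T.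
Proof.
move=> hv hF Fx; have [_ c2] := interior_faceP hF.
pose g T := enorm (\row_i pderive i (cell_poly v T) x).
have g0 T : 0 <= g T by exact: enorm_ge0.
have gB T : T \in cells m -> F \subset T -> h ^+ n.+3 * g T ^+ 2 <= n.+1%:R * C * cell_mass v T.
  move=> Tm FT; have sT := cell_simplex tO Tm; have [pP vP] := cell_polyP hv Tm.
  rewrite /g enorm_sq /dotv mulr_sumr.
  have -> : cell_mass v T = \int[leb n.+1]_(x in ohull T) (cell_poly v T x ^+ 2).
    by apply: eq_Rintegral => y /set_mem/ohull_hull hy; rewrite vP// expr2.
  rewrite -mulrA mulr_natl -[X in _ *+ X]card_ord -sumr_const; apply: ler_sum => i _.
  by rewrite !mxE -expr2; apply: hC => //; exact: hull_mono FT _ Fx.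
have jB : jump_poly v F x ^+ 2 <= 2 * \sum_(T in cells m | F \subset T) g T ^+ 2.
  have E (G : {set 'I_(num_nodes m)} -> R) : \sum_(T in cells m | F \subset T) G T =
      \sum_(T in [set T in cells m | F \subset T]) G T by apply: eq_bigl => T; rewrite inE.
  rewrite E /jump_poly E.
  have /eqP/cards2P[T1 [T2 [T12 ->]]] := c2.
  rewrite !big_setU1 ?inE//= !big_set1.
  have b1 T : `|dotv (\row_i pderive i (cell_poly v T) x) (cell_normal T F)| <= g T.
    apply: (le_trans (dotv_CS _ _)); rewrite -[leRHS]mulr1; apply: ler_wpM2l; first exact: enorm_ge0.
    exact: cell_normal_le1.
  have := b1 T1; have := b1 T2; have := g0 T1; have := g0 T2.
  move: (dotv _ _) (dotv _ _) (g T1) (g T2) => a b A B hB hA.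
  rewrite !ler_norml => /andP[? ?] /andP[? ?].
  have : 0 <= (A - B) ^+ 2 by exact: sqr_ge0.
  have : 0 <= (A + B - (a + b)) * (A + B + (a + b)) by apply: mulr_ge0; lra.
  nra.
apply: (le_trans (ler_wpM2l (exprn_ge0 _ (ltW h0)) jB)).
rewrite mulrCA -[2 * _ * C]mulrA -[leRHS]mulrA; apply: ler_wpM2l => //.
rewrite !mulr_sumr; apply: ler_sum => T /andP[Tm FT]; exact: gB.
Qed.

(** The powers of h are those of a trace inequality: h^2 from the weight, h^n from
    the face, h^-(n+3) from the gradients. A cell has 2^(n+2) sets of vertices, which
    bounds the number of its faces. *)
Lemma stab_form_bound v : Vh Omega m p v ->
  stab_form m eps beta v v <=
  Num.sqrt n`!%:R * 2 ^+ n * (2 * n.+1%:R * C) * 2 ^+ n.+2 *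
  ((sup_norm Omega beta + eps) / h) * ip Omega v v.
Proof.
move=> hv; have hO := domain_open pO; have bO := domain_bounded tO.
set B := sup_norm Omega beta; have B0 : 0 <= B := sup_norm_ge0 bO ab.
set S := Num.sqrt n`!%:R; have S0 : 0 <= S := sqrtr_ge0 _.
set K := 2 * n.+1%:R * C; have K0 : 0 <= K by rewrite /K !mulr_ge0.
have mr := @measurable_ref_simplex R n.
have fB F : F \in interior_faces m -> face_term v v F <=
    S * 2 ^+ n * K * ((B + eps) / h) * \sum_(T in cells m | F \subset T) cell_mass v T.
  move=> hF; have [cF _] := interior_faceP hF; rewrite face_termE//.
  set I := \sum_(T in _ | _) _.
  have I0 : 0 <= I by apply: sumr_ge0 => T _; exact: cell_mass_ge0.
  have hB t : ref_simplex t -> integrand v v F t <= h ^+ 2 * (B + eps) * (K * I / h ^+ n.+3).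
    move=> rt; have Ft := (face_param_hull cF).1 _ rt.
    have [T Tm FT] := interior_face_cell hF.
    rewrite /integrand -mulrA -expr2; apply: ler_pM.
    - by rewrite /weight mulr_ge0 ?sqr_ge0// addr_ge0.
    - exact: sqr_ge0.
    - rewrite /weight; apply: ler_pM; rewrite ?sqr_ge0 ?addr_ge0//.
        rewrite lerXn2r ?nnegrE ?(ltW h0) ?diam_ge0//.
        apply: (le_trans _ (diam_le_mesh_size Tm)); apply: (diam_le Ft) => x y Fx Fy.
        by apply: le_diam; [exact: hull_bounded|exact: hull_mono FT _ Fx|exact: hull_mono FT _ Fy].
      rewrite lerD2r; apply: (le_trans (dotv_CS _ _)); rewrite -[leRHS]mulr1.
      apply: ler_pM; rewrite ?enorm_ge0//; last exact: face_normal_le1.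
      by apply: (beta_le_sup bO ab); exact: (face_sub_closure hF).
    - by rewrite ler_pdivlMr ?exprn_gt0// mulrC; exact: jump_poly_bound.
  set M := h ^+ 2 * _ * _ in hB.
  have M0 : 0 <= M.
    rewrite /M !mulr_ge0 ?invr_ge0 ?exprn_ge0 ?addr_ge0//; exact: ltW.
  have IB : \int[leb n]_(t in @ref_simplex R n) integrand v v F t <= M * 2 ^+ n.
    apply: (@le_trans _ _ (\int[leb n]_(t in @ref_simplex R n) M)).
      apply: le_Rintegral => //; first exact: integrand_integrable.
      apply: continuous_integrable_box => //; first exact: ref_simplex_bounded.
      exact: cst_continuous.
    rewrite Rintegral_cst//; apply: ler_wpM2l => //.
    have lb : (leb n (@ref_simplex R n) <= (2 ^+ n)%:E)%E.
      rewrite -[2]mulr1 -(leb_cube n ler01); apply: le_measure; rewrite ?inE//.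
        exact: measurable_cube.
      exact: ref_simplex_cube.
    by rewrite -lee_fin fineK// ge0_fin_numE// (le_lt_trans lb)// ltry.
  have m0 : 0 <= \int[leb n]_(t in @ref_simplex R n) integrand v v F t.
    apply: Rintegral_ge0 => t _; rewrite /integrand -mulrA -expr2 mulr_ge0 ?sqr_ge0//.
    by rewrite /weight mulr_ge0 ?sqr_ge0// addr_ge0.
  apply: (@le_trans _ _ ((S * h ^+ n) * (M * 2 ^+ n))).
    apply: ler_pM => //.
    by apply: face_measure_bound => //; exact: ltW.
  rewrite le_eqVlt; apply/orP; left; apply/eqP; rewrite /M.
  have -> : h ^+ n.+3 = h ^+ 3 * h ^+ n by rewrite -exprD.
  move: (exprn_gt0 n h0); move: (h ^+ n) (2 ^+ n) => hh a hh0.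
  by field; rewrite !gt_eqF.
rewrite stab_termE; apply: (le_trans (ler_sum _ (fun F hF => fB F hF))).
rewrite -mulr_sumr; set Q := S * _ * _.
have Q0 : 0 <= Q * ((B + eps) / h).
  by rewrite /Q !mulr_ge0 ?exprn_ge0 ?addr_ge0 ?invr_ge0// ltW.
have -> : Q * 2 ^+ n.+2 * ((B + eps) / h) * ip Omega v v =
   Q * ((B + eps) / h) * (2 ^+ n.+2 * ip Omega v v).
  by rewrite (mulrAC Q) -[LHS]mulrA.
apply: ler_wpM2l => //.
have mO := open_measurable_rV hO.
rewrite /ip (Rintegral_cells (ltn0Sn n) pO tO (si_sq mO hv.1.1)) mulr_sumr.
rewrite (exchange_big_dep (mem (cells m)))/=; last by move=> F T _ /andP[].
apply: ler_sum => T Tm; rewrite -/(cell_mass v T).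
rewrite sumr_const -[leLHS]mulr_natl; apply: ler_wpM2r; first exact: cell_mass_ge0.
have sT := cell_simplex tO Tm.
rewrite -natrX ler_nat -sT.1 -card_powerset; apply: subset_leq_card.
by apply/fintype.subsetP => F; rewrite !inE => /andP[_ /andP[_ ?]].
Qed.

End stabilisation.

(** * Stability of the extrapolated scheme in an abstract setting *)

Section bilinear_forms.
Context {R : realType} {E : lmodType R}.
Implicit Types (B : E -> E -> R) (x y z : E) (a : R).

Definition linear_left B := forall a x y z, B (a *: x + y) z = a * B x z + B y z.

Definition semi_inner B := [/\ linear_left B, forall x y, B x y = B y x & forall x, 0 <= B x x].

Lemma linear_leftD B x y z : linear_left B -> B (x + y) z = B x z + B y z.
Proof. by move=> lB; rewrite -[x]scale1r lB mul1r scale1r. Qed.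

Lemma linear_left0 B z : linear_left B -> B 0 z = 0.
Proof. by move=> lB; have := linear_leftD 0 0 z lB; rewrite addr0; lra. Qed.

Lemma linear_leftZ B a x z : linear_left B -> B (a *: x) z = a * B x z.
Proof. by move=> lB; rewrite -[a *: x]addr0 lB linear_left0// addr0. Qed.

Lemma linear_leftB B x y z : linear_left B -> B (x - y) z = B x z - B y z.
Proof. by move=> lB; rewrite addrC -scaleN1r lB mulN1r addrC. Qed.

Definition linear_leftE B (lB : linear_left B) :=
  ((fun x y z => @linear_leftB B x y z lB), (fun x y z => @linear_leftD B x y z lB),
   (fun a x z => @linear_leftZ B a x z lB)).

Lemma semi_inner_linr B a x y z : semi_inner B -> B z (a *: x + y) = a * B z x + B z y.
Proof. by move=> [lB sB _]; rewrite sB lB !(sB z). Qed.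

Lemma semi_inner_rightB B x y z : semi_inner B -> B z (x - y) = B z x - B z y.
Proof. by move=> [lB sB _]; rewrite sB linear_leftB// !(sB z). Qed.

Lemma semi_inner_rightD B x y z : semi_inner B -> B z (x + y) = B z x + B z y.
Proof. by move=> [lB sB _]; rewrite sB linear_leftD// !(sB z). Qed.

Lemma semi_inner_rightZ B a x z : semi_inner B -> B z (a *: x) = a * B z x.
Proof. by move=> [lB sB _]; rewrite sB linear_leftZ// !(sB z). Qed.

Definition semi_innerE B (hB : semi_inner B) (lB : linear_left B) :=
  (linear_leftE lB, (fun x y z => @semi_inner_rightB B x y z hB),
   (fun x y z => @semi_inner_rightD B x y z hB), (fun a x z => @semi_inner_rightZ B a x z hB)).

Lemma young B (t : R) x y : semi_inner B -> 0 < t ->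
  `|2 * B x y| <= t * B x x + t^-1 * B y y.
Proof.
move=> hB t0; have [lB sB pB] := hB.
have h a : 0 <= a ^+ 2 * B x x + 2 * a * B x y + B y y.
  have := pB (a *: x + y); rewrite lB !(semi_inner_linr _ _ _ _ hB) (sB y x).
  by move: (B x x) (B x y) (B y y) => p q r; congr (_ <= _); ring.
have p : t * t^-1 = 1 by rewrite mulfV// gt_eqF.
have ti : 0 < t^-1 by rewrite invr_gt0.
have e1 := mulr_ge0 (ltW ti) (h t); have e2 := mulr_ge0 (ltW ti) (h (- t)).
move: p e1 e2; move: (t^-1) (B x x) (B x y) (B y y) => s X Y Z p.
have -> : s * (t ^+ 2 * X + 2 * t * Y + Z) = (t * s) * (t * X + 2 * Y) + s * Z by ring.
have -> : s * ((- t) ^+ 2 * X + 2 * - t * Y + Z) = (t * s) * (t * X - 2 * Y) + s * Z by ring.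
by rewrite p ler_norml => e1 e2; apply/andP; split; lra.
Qed.

Lemma semi_inner_subr B x y : semi_inner B -> B (x - y) (x - y) <= 2 * B x x + 2 * B y y.
Proof.
move=> hB; have [lB sB pB] := hB.
have := pB (x + y); rewrite !(semi_innerE hB lB).
by rewrite (sB y x); move: (B x x) (B x y) (B y y) => p q r; lra.
Qed.

End bilinear_forms.

Lemma discrete_gronwall (R : realType) (f : nat -> R) (b c : R) M : 0 <= c -> (forall n, 0 <= f n) ->
  (forall n, (n <= M)%N -> f n <= b + c * \sum_(0 <= j < n) f j) -> f M <= b * expR (c * M%:R).
Proof.
move=> c0 f0 h.
have H n : (n <= M)%N -> b + c * \sum_(0 <= j < n) f j <= b * (1 + c) ^+ n.
  elim: n => [|n IH] nM; first by rewrite big_nil mulr0 addr0 mulr1.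
  have := IH (ltnW nM); have := h n (ltnW nM); rewrite big_nat_recr//= mulrDr exprSr mulrA.
  by move: (\sum_(_ <= _ < _) _) (f n) (b * (1 + c) ^+ n) => p q r; nra.
have b0 : 0 <= b by have := h 0%N (leq0n M); have := f0 0%N; rewrite big_nil; lra.
apply: (le_trans (h M (leqnn M))); apply: (le_trans (H M (leqnn M))); apply: ler_wpM2l => //.
rewrite (mulrC c) expRM_natl lerXn2r ?nnegrE ?expR_ge0 ?addr_ge0//.
exact: expR_ge1Dx.
Qed.

Lemma expR_le (R : realType) (x : R) : expR x <= 1 + x * expR x.
Proof.
have := expR_ge1Dx (- x); rewrite expRN => h.
have e0 := expR_gt0 x; have := ler_wpM2r (ltW e0) h.
by rewrite mulVf ?gt_eqF//; move: (expR x) => y; lra.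
Qed.

Section abstract_stability.
Context {R : realType} {E : lmodType R}.
Variables (I C S A : E -> E -> R) (tau k kappa : R) (L : nat -> E -> R) (ell : nat -> R).
Variables (u : nat -> E) (N : nat).
Hypotheses (hI : semi_inner I) (hS : semi_inner S) (hA : semi_inner A).
Hypotheses (lC : linear_left C) (C0 : forall x, C x x = 0).
(* The elements x and forms I, C, S, A stand for discrete functions, the scalar product,
   convection, stabilisation and diffusion; k is the size of the transport over one step.
   The value 1 / 1000 only has to leave room for the numerical coefficients below. *)
Hypotheses (tau0 : 0 < tau) (k0 : 0 <= k) (kappa0 : 0 < kappa) (kappa1 : kappa <= 1 / 1000).
Hypothesis hC : forall x y, `|tau * C x y| <= k * Num.sqrt (I x x) * Num.sqrt (I y y).
Hypotheses (kk : k <= kappa) (k4 : k ^+ 4 <= kappa * tau) (tauk : tau <= kappa).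
Hypotheses (hSk : forall x, tau * S x x <= kappa * I x x) (hAk : forall x, tau * A x x <= kappa * I x x).
Hypothesis hL : forall n x, `|L n x| <= ell n * Num.sqrt (S x x + A x x + I x x).
Hypothesis scheme : forall n, (n.+2 <= N)%N -> forall v,
  I (3 *: u n.+2 - 4 *: u n.+1 + u n) v +
  2 * tau * (C (2 *: u n.+1 - u n) v + S (2 *: u n.+1 - u n) v + A (u n.+2) v) =
  2 * tau * L n.+2 v.

Let a n := I (u n) (u n).
Let w n := 2 *: u n.+1 - u n.
Let dl n := u n.+2 - w n.
Let ww n := I (w n) (w n).
Let dd n := I (dl n) (dl n).
Let D n := tau * S (w n) (w n) + tau * A (w n) (w n).

Let I0 x : 0 <= I x x. Proof. by case: hI. Qed.
Let S0 x : 0 <= S x x. Proof. by case: hS. Qed.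
Let A0 x : 0 <= A x x. Proof. by case: hA. Qed.

Let D0 n : 0 <= D n.
Proof. by rewrite /D addr_ge0// mulr_ge0// ltW. Qed.

Let C_young (t : R) x y : 0 < t -> `|2 * (tau * C x y)| <= t * k ^+ 2 * I x x + t^-1 * I y y.
Proof.
move=> t0; rewrite normrM ger0_norm//; apply: (le_trans (ler_wpM2l _ (hC x y))) => //.
have {2}-> : I x x = Num.sqrt (I x x) ^+ 2 by rewrite sqr_sqrtr.
have {2}-> : I y y = Num.sqrt (I y y) ^+ 2 by rewrite sqr_sqrtr.
move: (Num.sqrt _) (Num.sqrt _) => Y X.
have p : t * t^-1 = 1 by rewrite mulfV// gt_eqF.
have ti : 0 < t^-1 by rewrite invr_gt0.
have := mulr_ge0 (ltW ti) (sqr_ge0 (t * (k * X) - Y)).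
move: p; move: (t^-1) => s p.
have -> : s * (t * (k * X) - Y) ^+ 2 = (t * s) * (t * (k * X) ^+ 2 - 2 * (k * X) * Y) + s * Y ^+ 2 by ring.
by rewrite p; nra.
Qed.

Let L_young (t : R) n x : 0 < t ->
  `|2 * (tau * L n x)| <= t * (tau * ell n ^+ 2) + t^-1 * (tau * S x x + tau * A x x + tau * I x x).
Proof.
move=> t0; have Q0 : 0 <= S x x + A x x + I x x by rewrite !addr_ge0.
rewrite normrM ger0_norm// normrM gtr0_norm//.
have -> : t * (tau * ell n ^+ 2) + t^-1 * (tau * S x x + tau * A x x + tau * I x x) =
   tau * (t * ell n ^+ 2 + t^-1 * (S x x + A x x + I x x)).
  by move: (S x x) (A x x) (I x x) (t^-1) => p q r s; ring.
rewrite mulrCA; apply: ler_wpM2l; first exact: ltW.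
apply: (le_trans (ler_wpM2l _ (hL n x))) => //.
have {2}-> : S x x + A x x + I x x = Num.sqrt (S x x + A x x + I x x) ^+ 2 by rewrite sqr_sqrtr.
move: (Num.sqrt _) (ell n) => X Y.
have p : t * t^-1 = 1 by rewrite mulfV// gt_eqF.
have ti : 0 < t^-1 by rewrite invr_gt0.
have := mulr_ge0 (ltW ti) (sqr_ge0 (t * Y - X)).
move: p; move: (t^-1) => s p.
have -> : s * (t * Y - X) ^+ 2 = (t * s) * (t * Y ^+ 2 - 2 * Y * X) + s * X ^+ 2 by ring.
by rewrite p; nra.
Qed.

(** Testing with the extrapolation removes the transport term, by skew-symmetry, and
    makes the difference quotient telescope up to the square of the second difference. *)
Lemma energy_step n : (n.+2 <= N)%N ->
  3 * a n.+2 - a n.+1 - (3 * a n.+1 - a n) + 7 / 4 * D n <=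
  301 / 100 * dd n + 16 * (tau * ell n.+2 ^+ 2) + 1 / 4 * (tau * ww n).
Proof.
move=> nN; have := scheme nN (w n); rewrite -/(w n) C0.
have [lI sI _] := hI; have [lA sA _] := hA.
have E1 : 2 * I (3 *: u n.+2 - 4 *: u n.+1 + u n) (w n) =
   3 * a n.+2 - a n.+1 - (3 * a n.+1 - a n) - 3 * dd n.
  rewrite /dd /dl /a /w !(semi_innerE hI lI).
  rewrite (sI (u n.+1) (u n.+2)) (sI (u n) (u n.+2)) (sI (u n) (u n.+1)).
  move: (I _ _) (I _ _) (I _ _) (I _ _) (I _ _) (I _ _) => p1 p2 p3 p4 p5 p6; ring.
have E2 : A (u n.+2) (w n) = A (w n) (w n) + A (dl n) (w n).
  by rewrite /dl linear_leftB// addrC subrK.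
have Y1 := young (dl n) (w n) hA (ltr01 : 0 < 1 :> R).
have Y2 := @L_young 8 n.+2 (w n) (ltr0Sn _ 7); have := hAk (dl n).
have pS := mulr_ge0 (ltW tau0) (S0 (w n)).
have := I0 (dl n); rewrite /D E2 => pd pA sch.
move: Y1 Y2; rewrite !ler_norml invr1 !mul1r => /andP[Y1 _] /andP[_ Y2].
have {}Y1 := ler_wpM2l (ltW tau0) Y1.
rewrite -/(ww n) -/(dd n) in Y2 pd pA *.
have pk : kappa * dd n <= 1 / 1000 * dd n by apply: ler_wpM2r.
lra.
Qed.

(** Testing the scheme with an increment bounds the increment, up to the time
    step, by the dissipation and the second difference. *)
Lemma increment_bound n : (n.+2 <= N)%N ->
  I (u n.+2 - u n.+1) (u n.+2 - u n.+1) <= 2 * dd n + 4 * k ^+ 2 * ww n + D n + tau * ell n.+2 ^+ 2.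
Proof.
move=> nN; have [lI sI _] := hI; have [lA sA _] := hA; have [lS sS _] := hS.
have := scheme nN (u n.+2 - u n.+1); rewrite -/(w n).
have -> v : I (3 *: u n.+2 - 4 *: u n.+1 + u n) v = 2 * I (u n.+2 - u n.+1) v + I (dl n) v.
  by rewrite /dl /w !(linear_leftE lI); ring.
have -> v : A (u n.+2) v = A (w n) v + A (dl n) v by rewrite /dl linear_leftB// addrC subrK.
move: (u n.+2 - u n.+1) => d sch.
have Y1 := young (dl n) d hI (ltr0Sn R 1).
have Y2 := @C_young 4 (w n) d (ltr0Sn _ 3).
have Y3 := young (w n) d hS (ltr01 : 0 < 1 :> R).
have Y4 := young (w n) d hA (ltr01 : 0 < 1 :> R).
have Y5 := young (dl n) d hA (ltr01 : 0 < 1 :> R).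
have Y6 := @L_young 1 n.+2 d ltr01.
move: Y1 Y2 Y3 Y4 Y5 Y6; rewrite invr1 !mul1r.
move=> /ler_normlP[Y1 _] /ler_normlP[Y2 _] /ler_normlP[Y3 _] /ler_normlP[Y4 _] /ler_normlP[Y5 _] /ler_normlP[_ Y6].
have {}Y3 := ler_wpM2l (ltW tau0) Y3; have {}Y4 := ler_wpM2l (ltW tau0) Y4.
have {}Y5 := ler_wpM2l (ltW tau0) Y5.
have b1 := hAk d; have b2 := hSk d; have b3 := hAk (dl n).
have p1 := ler_wpM2r (I0 d) kappa1; have p2 := ler_wpM2r (I0 (dl n)) kappa1.
have p3 := ler_wpM2r (I0 d) tauk; have p4 := I0 d; have p5 := I0 (dl n).
have p6 := mulr_ge0 (ltW tau0) (S0 (w n)); have p7 := mulr_ge0 (ltW tau0) (A0 (w n)).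
rewrite -/(dd n) in Y1 Y5 b3 p2 p5 *; rewrite /D /ww.
have p8 : 0 <= tau * ell n.+2 ^+ 2 by rewrite mulr_ge0 ?sqr_ge0// ltW.
have p9 : 0 <= k ^+ 2 * I (w n) (w n) by rewrite mulr_ge0 ?sqr_ge0.
move: sch Y1 Y2 Y3 Y4 Y5 Y6 b1 b2 b3 p1 p2 p3 p4 p5 p6 p7 p8 p9.
move: (I (w n) (w n)) (I d d) (dd n) (I (dl n) d) (C (w n) d) => ww_ i_d dd_ x1 x2.
move: (S (w n) d) (A (w n) d) (A (dl n) d) (S (w n) (w n)) (A (w n) (w n)) (L n.+2 d) => x3 x4 x5 x6 x7 x8.
move: (A d d) (S d d) (A (dl n) (dl n)) (ell n.+2 ^+ 2) (k ^+ 2) => x9 x10 x11 x12 x13.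
lra.
Qed.

(** The difference of two consecutive equations, tested with the second
    difference. The transport term produces the square of an increment, which is
    handled by the previous bound; the resulting factor [k ^ 4] is what the
    four-thirds condition on the time step controls. *)
Lemma difference_step n : (n.+3 <= N)%N ->
  dd n.+1 <= 26 / 100 * dd n + 1 / 100 * (tau * ww n) + 7 / 100 * (D n.+1 + D n) +
    (tau * ell n.+3 ^+ 2 + tau * ell n.+2 ^+ 2).
Proof.
move=> nN; have nN' := ltnW nN; have [lI sI _] := hI; have [lA sA _] := hA; have [lS sS _] := hS.
have := scheme nN (dl n.+1); have := scheme nN' (dl n.+1); rewrite -/(w n) -/(w n.+1) => s1 s2.
have F1 v : I (3 *: u n.+3 - 4 *: u n.+2 + u n.+1) v - I (3 *: u n.+2 - 4 *: u n.+1 + u n) v =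
   3 * I (dl n.+1) v - I (dl n) v.
  by rewrite /dl /w !(linear_leftE lI); ring.
have F2 v : C (w n.+1) v - C (w n) v = C (u n.+2 - u n.+1) v + C (dl n) v.
  by rewrite /dl /w !(linear_leftE lC); ring.
have F3 v : S (w n.+1) v - S (w n) v = S (w n.+1 - w n) v by rewrite (linear_leftB (w n.+1)).
have F4 v : A (u n.+3) v - A (u n.+2) v = A (w n.+1 - w n) v + A (dl n.+1) v - A (dl n) v.
  by rewrite (linear_leftB (w n.+1))// (linear_leftB (u n.+3))// (linear_leftB (u n.+2))//; ring.
have {F1}F1 := F1 (dl n.+1); have {F2}F2 := F2 (dl n.+1); have {F3}F3 := F3 (dl n.+1).
have {F4}F4 := F4 (dl n.+1).
have {}F2 := congr1 ( *%R tau) F2; have {}F3 := congr1 ( *%R tau) F3; have {}F4 := congr1 ( *%R tau) F4.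
have D1 := increment_bound nN'.
have G1 := semi_inner_subr (w n.+1) (w n) hS; have G2 := semi_inner_subr (w n.+1) (w n) hA.
move: (w n.+1 - w n) (u n.+2 - u n.+1) F2 F3 F4 D1 G1 G2 => x d F2 F3 F4 D1 G1 G2.
have t16 : 0 < 16^-1 :> R by rewrite invr_gt0.
have Y1 := young (dl n) (dl n.+1) hI (ltr01 : 0 < 1 :> R).
have Y2 := @C_young 4 d (dl n.+1) (ltr0Sn _ 3).
have Y2' := @C_young 10 (dl n) (dl n.+1) (ltr0Sn _ 9).
have Y3 := young x (dl n.+1) hS t16.
have Y4 := young x (dl n.+1) hA t16.
have Y5 := young (dl n) (dl n.+1) hA (ltr01 : 0 < 1 :> R).
have Y6 := @L_young 1 n.+2 (dl n.+1) ltr01.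
have Y7 := @L_young 1 n.+3 (dl n.+1) ltr01.
move: Y1 Y2 Y2' Y3 Y4 Y5 Y6 Y7; rewrite invr1 invrK !mul1r.
move=> /ler_normlP[_ Y1] /ler_normlP[Y2 _] /ler_normlP[Y2' _] /ler_normlP[Y3 _] /ler_normlP[Y4 _].
move=> /ler_normlP[_ Y5] /ler_normlP[Y6 _] /ler_normlP[_ Y7].
have {}Y3 := ler_wpM2l (ltW tau0) Y3; have {}Y4 := ler_wpM2l (ltW tau0) Y4.
have {}Y5 := ler_wpM2l (ltW tau0) Y5.
have {}G1 := ler_wpM2l (ltW tau0) G1; have {}G2 := ler_wpM2l (ltW tau0) G2.
have b1 := hAk (dl n.+1); have b2 := hSk (dl n.+1); have b3 := hAk (dl n).
have p1 := ler_wpM2r (I0 (dl n.+1)) kappa1; have p2 := ler_wpM2r (I0 (dl n)) kappa1.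
have p3 := ler_wpM2r (I0 (dl n.+1)) tauk; have p4 := I0 (dl n.+1); have p5 := I0 (dl n).
have p6 := D0 n; have p7 := D0 n.+1; have p8 := mulr_ge0 (ltW tau0) (A0 (dl n.+1)).
have p9 : 0 <= tau * ell n.+2 ^+ 2 by rewrite mulr_ge0 ?sqr_ge0// ltW.
have p10 : 0 <= tau * ell n.+3 ^+ 2 by rewrite mulr_ge0 ?sqr_ge0// ltW.
have k2 : k ^+ 2 <= 1 / 1000.
  rewrite expr2; apply: (@le_trans _ _ (k * 1)); last first.
    by rewrite mulr1; exact: le_trans kk kappa1.
  apply: ler_wpM2l => //; apply: (le_trans kk); apply: (le_trans kappa1).
  by rewrite ler_pdivrMr ?ltr0n// mul1r ler1n.
have q1 : k ^+ 2 * dd n <= 1 / 1000 * dd n by apply: ler_wpM2r.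
have q2 : k ^+ 2 * D n <= 1 / 1000 * D n by apply: ler_wpM2r.
have q3 : k ^+ 2 * (tau * ell n.+2 ^+ 2) <= 1 / 1000 * (tau * ell n.+2 ^+ 2) by apply: ler_wpM2r.
have w0 : 0 <= ww n := I0 _.
have q4 : k ^+ 2 * (k ^+ 2 * ww n) <= 1 / 1000 * (tau * ww n).
  rewrite mulrA -exprD; apply: (@le_trans _ _ (kappa * tau * ww n)); first by apply: ler_wpM2r.
  by rewrite -mulrA; apply: ler_wpM2r => //; rewrite mulr_ge0// ltW.
have {}D1 := ler_wpM2l (sqr_ge0 k) D1.
rewrite -/(dd n) -/(dd n.+1) in F1 Y1 Y2 Y2' Y6 Y7 b1 b2 b3 p1 p2 p3 p4 p5 *.
move: G1 G2 D1 q2 p6 p7; rewrite /D => G1 G2 D1 q2 p6 p7.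
have {}w0 := mulr_ge0 (ltW tau0) w0; rewrite /ww in D1 q4 w0 *.
move: s1 s2 F1 F2 F3 F4 G1 G2 D1 Y1 Y2 Y2' Y3 Y4 Y5 Y6 Y7 b1 b2 b3 p1 p2 p3 p4 p5 p6 p7 p8 p9 p10 q1 q2 q3 q4 w0.
move: (I (3 *: u n.+3 - 4 *: u n.+2 + u n.+1) (dl n.+1)) (I (3 *: u n.+2 - 4 *: u n.+1 + u n) (dl n.+1)) => I1 I2.
move: (C (w n.+1) (dl n.+1)) (C (w n) (dl n.+1)) (C d (dl n.+1)) (C (dl n) (dl n.+1)) => C1 C2 C3 C4.
move: (S (w n.+1) (dl n.+1)) (S (w n) (dl n.+1)) (S x (dl n.+1)) (S x x) (S (dl n.+1) (dl n.+1)) => S1 S2 S3 S4 S5.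
move: (A (u n.+3) (dl n.+1)) (A (u n.+2) (dl n.+1)) (A x (dl n.+1)) (A x x) => A1 A2 A3 A4.
move: (A (dl n.+1) (dl n.+1)) (A (dl n) (dl n)) (A (dl n) (dl n.+1)) => A5 A6 A7.
move: (S (w n.+1) (w n.+1)) (S (w n) (w n)) (A (w n.+1) (w n.+1)) (A (w n) (w n)) => S6 S7 A8 A9.
move: (I (dl n) (dl n.+1)) (I d d) (I (w n) (w n)) (dd n) (dd n.+1) => I3 I4 I5 d1 d2.
move: (L n.+2 (dl n.+1)) (L n.+3 (dl n.+1)) (ell n.+2 ^+ 2) (ell n.+3 ^+ 2) (k ^+ 2) => L1 L2 e1 e2 kk2.
lra.
Qed.

Lemma extrapolation_le n : ww n <= 6 * a n.+1 + 3 * a n.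
Proof.
have [lI sI _] := hI; have Y := young (u n.+1) (u n) hI (ltr01 : 0 < 1 :> R).
move: Y; rewrite invr1 !mul1r => /ler_normlP[Y _].
rewrite /ww /w /a !(semi_innerE hI lI) (sI (u n) (u n.+1)).
by move: Y; move: (I _ _) (I _ _) (I _ _) => p q r; lra.
Qed.

Lemma second_difference_le : dd 0 <= 4 * a 2 + 8 * a 1 + 4 * a 0.
Proof.
have [lI sI _] := hI; have Y1 := young (u 1) (u 0) hI (ltr01 : 0 < 1 :> R).
have Y2 := young (u 2) (u 0) hI (ltr01 : 0 < 1 :> R).
have Y3 := young (u 2) (u 1) hI (ltr01 : 0 < 1 :> R).
move: Y1 Y2 Y3; rewrite invr1 !mul1r => /ler_normlP[Y1 _] /ler_normlP[_ Y2] /ler_normlP[Y3 _].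
rewrite /dd /dl /w /a !(semi_innerE hI lI) (sI (u 0) (u 1)) (sI (u 0) (u 2)) (sI (u 1) (u 2)).
move: Y1 Y2 Y3; move: (I _ _) (I _ _) (I _ _) (I _ _) (I _ _) (I _ _) => p1 p2 p3 p4 p5 p6; lra.
Qed.

(** A discrete Lyapunov function for the scheme: the energy step alone leaves
    the second difference uncontrolled, and the contraction of the latter in the
    difference step pays for it. *)
Lemma lyapunov n : (n.+2 <= N)%N ->
  3 * a n.+2 - a n.+1 + 11 / 10 * dd n + D n + 1 / 20 * (tau * ww n) + 5 * (tau * ell n.+2 ^+ 2) <=
  8 * (a 0 + a 1 + a 2) + 3 / 10 * (tau * \sum_(0 <= j < n.+1) ww j) +
  26 * (tau * \sum_(0 <= j < n.+1) ell j.+2 ^+ 2).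
Proof.
elim: n => [|n IH] nN.
  rewrite !big_nat1; have h1 := second_difference_le; have h2 := extrapolation_le 0.
  have h3 := hSk (w 0); have h4 := hAk (w 0); have h5 := ler_wpM2r (I0 (w 0)) kappa1.
  have p0 := I0 (u 0); have p1 := I0 (u 1); have p2 := I0 (u 2); have p3 := I0 (w 0).
  rewrite -/(ww 0) in h3 h4 h5 p3; rewrite -/(a 0) -/(a 1) -/(a 2) in p0 p1 p2.
  have p4 := mulr_ge0 (ltW tau0) p3; have p5 := mulr_ge0 (ltW tau0) (sqr_ge0 (ell 2)).
  rewrite /D.
  move: (ell 2 ^+ 2) p5 => e p5; move: h1 h2 h3 h4 h5 p0 p1 p2 p3 p4.
  move: (a 0) (a 1) (a 2) (dd 0) (ww 0) (S (w 0) (w 0)) (A (w 0) (w 0)) => a0 a1 a2 d0 w0 s0 A00; lra.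
have {}IH := IH (ltnW nN); rewrite !(big_nat_recr n.+1)//= !mulrDr.
(* The weight 11/10 of the second difference reproduces itself, as
   (301/100 + 11/10) * 26/100 <= 11/10; the term in ell pays for the older of the two
   functionals in the difference step. *)
have h1 := energy_step nN; have h2 := difference_step nN.
have p0 := D0 n.+1; have p1 := D0 n; have p2 := I0 (dl n); rewrite -/(dd n) in p2.
have p3 := mulr_ge0 (ltW tau0) (sqr_ge0 (ell n.+2)); have p4 := mulr_ge0 (ltW tau0) (sqr_ge0 (ell n.+3)).
have p5 : 0 <= tau * ww n by rewrite mulr_ge0 ?(ltW tau0)//; exact: I0.
move: IH h1 h2 p0 p1 p2 p3 p4 p5.
move: (tau * \sum_(0 <= j < n.+1) ww j) (tau * \sum_(0 <= j < n.+1) ell j.+2 ^+ 2) => s1 s2.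
move: (tau * ww n) (tau * ww n.+1) (tau * ell n.+2 ^+ 2) (tau * ell n.+3 ^+ 2) => x1 x2 x3 x4.
move: (D n.+1) (D n) (dd n) (dd n.+1) (a n.+3) (a n.+2) (a n.+1) => y1 y2 y3 y4 y5 y6 y7; lra.
Qed.

Lemma sum_extrapolation_le n :
  \sum_(0 <= j < n.+1) ww j <= 9 * (\sum_(0 <= j < n.+2) a j) - 3 * a n.+1.
Proof.
elim: n => [|n IH].
  rewrite big_nat1 !big_nat_recr//= big_nil add0r; have := extrapolation_le 0; have := I0 (u 0).
  by rewrite -/(a 0); move: (a 0) (a 1) (ww 0) => p q r; lra.
rewrite (big_nat_recr n.+1)//= (big_nat_recr n.+2)//=; have := extrapolation_le n.+1.
by move: IH; move: (\sum_(_ <= _ < _) _) (\sum_(_ <= _ < _) _) (ww n.+1) (a n.+1) (a n.+2) => p q r s t; lra.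
Qed.

Let Z := \sum_(0 <= j < N.-1) ell j.+2 ^+ 2.

Let bound := 4 * (a 0 + a 1 + a 2) + 13 * (tau * Z).

(** The Lyapunov bound gives 3 a (n+1) <= a n + data + sum, and inserting the bound for
    a n reproduces it: the constants satisfy 4 = (4 + 8) / 3, 13 = (13 + 26) / 3 and
    3/2 >= (3/2 + 9 * 3/10) / 3. *)
Lemma summed_bound n : (n <= N)%N -> a n <= bound + 3 / 2 * tau * \sum_(0 <= j < n) a j.
Proof.
have aN j : 0 <= a j := I0 _.
have s0 i : 0 <= tau * \sum_(0 <= j < i) a j by rewrite mulr_ge0 ?(ltW tau0)// sumr_ge0.
have Z0 : 0 <= tau * Z by rewrite mulr_ge0 ?(ltW tau0)// sumr_ge0// => j _; exact: sqr_ge0.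
elim: n => [|n IH] nN.
  have := aN 0; have := aN 1; have := aN 2; rewrite big_nil mulr0 addr0 /bound.
  by move: Z0; move: (tau * Z) => z; lra.
have [n2|] := ltnP n 2.
  have := s0 n.+1; have := aN 0; have := aN 1; have := aN 2; rewrite /bound -mulrA.
  move: Z0; move: (tau * _) (tau * Z) => p q Z0.
  by case: n n2 {IH nN} => [|[|//]] _; lra.
case: n IH nN => [//|[//|n]] IH nN _.
have {}IH := IH (ltnW nN); have h1 := lyapunov nN.
have h2 := ler_wpM2l (ltW tau0) (sum_extrapolation_le n.+1).
have h3 : tau * \sum_(0 <= j < n.+2) ell j.+2 ^+ 2 <= tau * Z.
  apply: ler_wpM2l; first exact: ltW.
  rewrite /Z (@big_cat_nat _ _ _ n.+2 0 N.-1)//=; last by rewrite -ltnS prednK// (leq_trans _ nN).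
  by rewrite lerDl sumr_ge0// => j _; exact: sqr_ge0.
have p1 := I0 (dl n.+1); have p2 := D0 n.+1; rewrite -/(dd n.+1) in p1.
have p3 := mulr_ge0 (ltW tau0) (sqr_ge0 (ell n.+3)).
have p4 : 0 <= tau * ww n.+1 by rewrite mulr_ge0 ?(ltW tau0)//; exact: I0.
have p5 := s0 n.+3; have p6 := mulr_ge0 (ltW tau0) (aN n.+2).
move: IH h1 h2 h3 p1 p2 p3 p4 p5 p6 Z0; rewrite /bound !(big_nat_recr n.+2 0 a)//=.
move: (\sum_(0 <= j < n.+2) a j) (\sum_(0 <= j < n.+2) ww j) (\sum_(0 <= j < n.+2) ell j.+2 ^+ 2) => s1 s2 s3.
move: (D n.+1) (dd n.+1) (a n.+3) (a n.+2) (a 0) (a 1) (a 2) (ww n.+1) (ell n.+3 ^+ 2) => x1 x2 x3 x4 x5 x6 x7 x8 x9.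
lra.
Qed.

(** Gronwall gives growth at the rate 3/2 <= b; then e^x <= 1 + x e^x. *)
Lemma abstract_stability (b : R) : 8 <= b ->
  I (u N) (u N) <= (I (u 0) (u 0) + I (u 1) (u 1) + I (u 2) (u 2) + 9 * tau * \sum_(1 <= n < N) ell n.+1 ^+ 2) *
    (8 * (1 + b * (N%:R * tau) * expR (b * (N%:R * tau)))).
Proof.
move=> b8; rewrite big_add1 -/Z -!/(a _).
have aN j : 0 <= a j := I0 _.
have Z0 : 0 <= tau * Z by rewrite mulr_ge0 ?(ltW tau0)// sumr_ge0// => j _; exact: sqr_ge0.
have T0 : 0 <= N%:R * tau by rewrite mulr_ge0// ltW.
have c0 : 0 <= 3 / 2 * tau by have := tau0; lra.
have := discrete_gronwall c0 aN summed_bound; move=> /le_trans; apply.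
have e1 : expR (3 / 2 * tau * N%:R) <= expR (b * (N%:R * tau)).
  rewrite ler_expR -mulrA (mulrC tau); apply: ler_wpM2r => //; lra.
have e2 := expR_le (b * (N%:R * tau)).
have e3 := expR_ge0 (3 / 2 * tau * N%:R).
have h : bound <= 8 * (a 0 + a 1 + a 2 + 9 * tau * Z).
  by have := aN 0; have := aN 1; have := aN 2; rewrite /bound; move: Z0; rewrite -mulrA; move: (tau * Z) => z; lra.
have h0 : 0 <= bound by have := aN 0; have := aN 1; have := aN 2; rewrite /bound; lra.
apply: (@le_trans _ _ (8 * (a 0 + a 1 + a 2 + 9 * tau * Z) * expR (b * (N%:R * tau)))).
  by apply: ler_pM.
rewrite -[leLHS]mulrA [leRHS]mulrCA; apply: ler_wpM2l => //; apply: ler_wpM2l; last exact: e2.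
by rewrite -(pmulr_rge0 _ (ltr0Sn R 7)); exact: le_trans h0 h.
Qed.

End abstract_stability.

(** * The dual norm *)

Section dual_norm.
Context {R : realType} {n : nat} {m : mesh R n.+1} {Omega : set 'rV[R]_n.+1}.
Hypotheses (pO : polygonal_domain Omega) (tO : triangulation Omega m).
Variables (p : nat) (beta : 'rV[R]_n.+1 -> 'rV[R]_n.+1) (mu gamma eps : R).
Hypotheses (ab : admissible_velocity Omega beta) (eps0 : 0 <= eps) (gamma0 : 0 <= gamma) (mu0 : 0 < mu).
Implicit Types (v : 'rV[R]_n.+1 -> R).

Local Notation dual := (dual_norm Omega m p mu gamma eps beta).

Definition full_energy v := gamma * stab_form m eps beta v v + diff_form Omega mu v v + ip Omega v v.

Lemma full_energyE v : energy_sq Omega m mu gamma eps beta v + L2norm Omega v ^+ 2 = full_energy v.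
Proof. by rewrite energy_sqE ?(ltW mu0) ?stab_form_ge0// L2norm_sq. Qed.

Lemma full_energy_ge0 v : 0 <= full_energy v.
Proof. by rewrite !addr_ge0 ?mulr_ge0 ?stab_form_ge0 ?diff_form_ge0 ?ip_ge0// ltW. Qed.

(** Evenness turns the one-sided supremum of the dual norm into a bound on the
    absolute value. The opposite is written as a combination a v + w, the form in which
    the linearity of the functionals and of the discrete space is expressed. *)
Lemma full_energy_opp v : Vh Omega m p v -> full_energy (fun x => - 2 * v x + v x) = full_energy v.
Proof.
move=> hv; have oO := domain_open pO; have mO := open_measurable_rV oO.
have h2 : Vh Omega m p (fun x => - 2 * v x + v x) by exact: Vh_lin.
have e1 : stab_form m eps beta (fun x => - 2 * v x + v x) (fun x => - 2 * v x + v x) = stab_form m eps beta v v.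
  rewrite (stab_form_linl pO tO eps ab (- 2) hv hv h2) (stab_formC _ _ v).
  by rewrite (stab_form_linl pO tO eps ab (- 2) hv hv hv); move: (stab_form _ _ _ _ _) => s; ring.
have e2 : diff_form Omega mu (fun x => - 2 * v x + v x) (fun x => - 2 * v x + v x) = diff_form Omega mu v v.
  rewrite (diff_form_linl mu (- 2) oO hv.1 hv.1 h2.1) (diff_formC _ _ v).
  by rewrite (diff_form_linl mu (- 2) oO hv.1 hv.1 hv.1); move: (diff_form _ _ _ _) => s; ring.
have e3 : ip Omega (fun x => - 2 * v x + v x) (fun x => - 2 * v x + v x) = ip Omega v v.
  rewrite (ip_linl mO (- 2) hv.1.1 hv.1.1 h2.1.1) (ipC _ v).
  by rewrite (ip_linl mO (- 2) hv.1.1 hv.1.1 hv.1.1); move: (ip _ _ _) => s; ring.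
by rewrite /full_energy e1 e2 e3.
Qed.

Lemma H1norm_le_energy v : H1 Omega v ->
  H1norm Omega v <= Num.sqrt (1 + mu^-1) * Num.sqrt (full_energy v).
Proof.
move=> hv; have oO := domain_open pO.
have m1 : 0 <= 1 + mu^-1 by rewrite addr_ge0// invr_ge0 ltW.
rewrite -(@ler_pXn2r _ 2)// ?nnegrE ?mulr_ge0 ?sqrtr_ge0//.
rewrite exprMn (sqr_sqrtr m1) (sqr_sqrtr (full_energy_ge0 v)) H1norm_sq L2norm_sq /full_energy.
have -> : \sum_i L2norm Omega (wderive Omega i v) ^+ 2 = mu^-1 * diff_form Omega mu v v.
  rewrite diff_formE// mulrA mulVf ?gt_eqF// mul1r.
  by apply: eq_bigr => i _; exact: L2norm_sq.
have i0 : 0 <= mu^-1 by rewrite invr_ge0 ltW.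
have a0 := ip_ge0 Omega v; have a1 := mulr_ge0 gamma0 (@stab_form_ge0 R n m beta eps eps0 v).
have a2 := diff_form_ge0 Omega v (ltW mu0).
move: (ip _ _ _) (gamma * _) (diff_form _ _ _ _) (mu^-1) i0 a0 a1 a2 => x y z i i0 a0 a1 a2; nra.
Qed.

(** The supremum in the dual norm ranges over functions with a nonzero value in the
    domain; a functional vanishes on the other ones by continuity. *)
Lemma H1norm_eq0 v : H1 Omega v -> (forall x, Omega x -> v x = 0) -> H1norm Omega v = 0.
Proof.
move=> hv v0; have oO := domain_open pO; have mO := open_measurable_rV oO.
have L0 (f : 'rV[R]_n.+1 -> R) : measurable_fun Omega f -> {ae leb n.+1, forall x, Omega x -> f x = 0} ->
    L2norm Omega f = 0.
  move=> mf f0; rewrite (@L2norm_ae _ _ _ mO f (cst 0) mf)//.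
  rewrite /L2norm /ip; under eq_Rintegral do rewrite mul0r.
  by rewrite Rintegral_cst// mul0r sqrtr0.
have vn : L2norm Omega v = 0 by apply: L0; [exact: hv.1.1|apply/aeW => x Ox; exact: v0].
rewrite /H1norm vn big1 ?expr0n/= ?addr0 ?sqrtr0// => i _; rewrite L0 ?expr0n//.
  exact: (H1_si_wderive oO i hv).1.
have v0' : {in Omega, v =1 cst 0} by move=> x /set_mem; exact: v0.
have := wderive_local oO oO (@subset_refl _ Omega) (H1_weak i hv) (@smooth_cst R n.+1 0) v0'.
by apply: filterS => x hx Ox; rewrite hx// /pderive derive_cst.
Qed.

(** A functional that is bounded for the norm of H1 is bounded for the energy norm,
    because mu > 0; hence the supremum is finite. *)
Lemma dual_norm_bound L v : bounded_linear Omega m p L -> Vh0 Omega m p v ->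
  `|L v| <= dual L * Num.sqrt (full_energy v).
Proof.
move=> [linL [C hL]] hv; have oO := domain_open pO.
pose Ls := [set L v / Num.sqrt (energy_sq Omega m mu gamma eps beta v + L2norm Omega v ^+ 2) | v in
    [set v | Vh0 Omega m p v /\ exists2 x, Omega x & v x != 0]].
pose K := `|C| * Num.sqrt (1 + mu^-1).
have LK f : Vh0 Omega m p f -> `|L f| <= K * Num.sqrt (full_energy f).
  move=> hf; apply: (le_trans (hL f hf)); apply: (@le_trans _ _ (`|C| * H1norm Omega f)).
    by apply: ler_wpM2r; [exact: sqrtr_ge0|exact: ler_norm].
  by rewrite /K -mulrA; apply: ler_wpM2l => //; exact: H1norm_le_energy hf.1.1.
have K0 : 0 <= K by rewrite mulr_ge0// sqrtr_ge0.
have ubL : has_ubound Ls.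
  exists K => _ [f [hf _] <-]; rewrite full_energyE.
  have [e0|e0] := eqVneq (Num.sqrt (full_energy f)) 0; first by rewrite e0 invr0 mulr0.
  have e1 : 0 < Num.sqrt (full_energy f) by rewrite lt_neqAle eq_sym e0 sqrtr_ge0.
  by rewrite ler_pdivrMr//; apply: le_trans (LK f hf); exact: ler_norm.
have inL f x : Vh0 Omega m p f -> Omega x -> f x != 0 ->
    L f / Num.sqrt (full_energy f) <= dual L.
  move=> hf Ox fx; apply: ub_le_sup => //; exists f; last by rewrite full_energyE.
  by split=> //; exists x.
pose N v : 'rV[R]_n.+1 -> R := fun x => - 2 * v x + v x.
have N0 f : Vh0 Omega m p f -> Vh0 Omega m p (N f) by move=> hf; exact: Vh0_lin.
have LN f : Vh0 Omega m p f -> L (N f) = - L f.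
  by move=> hf; have := linL (- 2) f f hf hf; rewrite -/(N f) => ->; ring.
have NE f x : N f x = - f x by rewrite /N; ring.
have key f x : Vh0 Omega m p f -> Omega x -> f x != 0 ->
    `|L f / Num.sqrt (full_energy f)| <= dual L.
  move=> hf Ox fx; rewrite ler_norml; apply/andP; split; last exact: inL hf Ox fx.
  have := inL _ x (N0 f hf) Ox; rewrite NE oppr_eq0 => /(_ fx).
  by rewrite LN// (full_energy_opp hf.1) mulNr lerNl.
have [[x Ox vx]|nv] := pselect (exists2 x, Omega x & v x != 0).
  have [e0|e0] := eqVneq (Num.sqrt (full_energy v)) 0.
    by have := LK v hv; rewrite e0 !mulr0.
  have e1 : 0 < Num.sqrt (full_energy v) by rewrite lt_neqAle eq_sym e0 sqrtr_ge0.
  have := key v x hv Ox vx; rewrite normrM normfV (gtr0_norm e1).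
  by rewrite ler_pdivrMr.
have v0 x : Omega x -> v x = 0.
  by move=> Ox; apply/eqP; apply: contrapT => /negP vx; apply: nv; exists x.
have := hL v hv; rewrite (H1norm_eq0 hv.1.1 v0) mulr0 => h; apply: (le_trans h).
rewrite mulr_ge0 ?sqrtr_ge0//.
have [[_ [f [hf [x Ox fx]] _]]|nL] := pselect (Ls !=set0).
  exact: le_trans (normr_ge0 _) (key f x hf Ox fx).
rewrite /dual_norm (_ : [set _ | _ in _] = set0) ?sup0//.
by apply/seteqP; split=> // y hy; apply: nL; exists y.
Qed.

End dual_norm.

(** * Application to the finite element scheme *)

Section scheme.
Context {R : realType} {n : nat}.
Implicit Types (m : mesh R n.+1) (Omega : set 'rV[R]_n.+1) (beta : 'rV[R]_n.+1 -> 'rV[R]_n.+1).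

Lemma mesh_size_ge0 m : 0 <= mesh_size m.
Proof. by rewrite /mesh_size; apply: bigmax_ge_id. Qed.

Lemma mesh_size_le_diam Omega m : polygonal_domain Omega -> triangulation Omega m ->
  mesh_size m <= diam (closure Omega).
Proof.
move=> pO tO; have bO := box_bounded_closure (domain_bounded tO).
apply: mesh_size_le; first exact: diam_ge0.
move=> T Tm; have sT := cell_simplex tO Tm.
have [k kT] : exists k, k \in T by apply/set0Pn; rewrite -card_gt0 sT.1.
apply: (diam_le (node_hull kT)) => x y hx hy.
by apply: le_diam => //; exact: (hull_sub_closure tO Tm).
Qed.

Lemma stab_form_estimate p (sigma q : R) : exists2 C : R, 0 <= C &
  forall Omega m beta eps, polygonal_domain Omega -> triangulation Omega m ->
  shape_regular sigma m -> quasi_uniform q m -> admissible_velocity Omega beta -> 0 <= eps ->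
  0 < mesh_size m -> forall v, Vh Omega m p v ->
  stab_form m eps beta v v <= C * ((sup_norm Omega beta + eps) / mesh_size m) * ip Omega v v.
Proof.
have [C C0 hC] := @cell_inverse R n.+1 p sigma q (ltn0Sn n).
exists (Num.sqrt n`!%:R * 2 ^+ n * (2 * n.+1%:R * C) * 2 ^+ n.+2).
  apply: mulr_ge0; last exact: exprn_ge0.
  by apply: mulr_ge0; [apply: mulr_ge0; [exact: sqrtr_ge0|exact: exprn_ge0]|exact: mulr_ge0].
move=> Omega m beta eps pO tO sr qu ab eps0 h0 v hv.
exact: (stab_form_bound pO tO ab eps0 C0 h0 (hC m sr qu h0) hv).
Qed.

(** Conditions on the threshold: it absorbs the constants of the inverse
    estimates and the size of the domain, which bounds the time step. *)
Lemma time_step_bounds (kappa C1 C2 D gamma eps tau h b mu : R) :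
  0 < kappa -> kappa <= 1 -> 0 <= C1 -> 0 <= C2 -> 0 <= D -> 0 <= gamma -> 0 <= eps ->
  0 < tau -> 0 <= h -> h <= D -> 0 <= b -> 0 < mu -> 1 < Pe mu h b ->
  Num.max (Co tau h b) (Co43 tau h b) <= kappa / (1 + C1 + C1 ^+ 4 + D + gamma * C2 * (1 + eps)) ->
  [/\ 0 < h, C1 * (tau * (b / h)) <= kappa, (C1 * (tau * (b / h))) ^+ 4 <= kappa * tau,
      tau <= kappa & gamma * C2 * (tau * ((b + eps) / h)) <= kappa /\ C1 * (tau * (mu / h ^+ 2)) <= kappa].
Proof.
move=> ka ka1 C10 C20 D0 ga ep ta h0 hD b0 m0.
rewrite /Pe ltr_pdivlMr// mul1r => pe.
have h1 : 0 < h by rewrite lt_neqAle h0 andbT; apply/negP => /eqP h00; move: pe; rewrite -h00; nra.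
set K := 1 + _ + _ + _ + _; have C14 : 0 <= C1 ^+ 4 by exact: exprn_ge0.
have g0 : 0 <= gamma * C2 * (1 + eps) by rewrite !mulr_ge0// addr_ge0.
have K1 : 1 <= K by rewrite /K -!addrA lerDl !addr_ge0.
have K0 : 0 < K by apply: lt_le_trans K1.
rewrite ge_max => /andP[co c43].
have ti : 0 < tau / h by rewrite divr_gt0.
have coE : Co tau h b = b * (tau / h) + tau / h by rewrite /Co mulrDl mul1r mulrDl mulrA.
have kK : kappa / K <= kappa by rewrite ler_pdivrMr// ler_peMr// ltW.
have part c : 0 <= c -> c <= K -> c * (kappa / K) <= kappa.
  by move=> c0 cK; rewrite mulrCA ler_piMr ?(ltW ka)// ler_pdivrMr// mul1r.
have th : tau / h <= kappa / K.
  by apply: le_trans co; rewrite coE lerDr mulr_ge0// ltW.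
have tb0 : 0 <= tau * (b / h) by rewrite !mulr_ge0 ?invr_ge0// ltW.
have tb : tau * (b / h) <= kappa / K.
  by apply: le_trans co; rewrite coE mulrCA lerDl ltW.
have C1K : C1 <= K by rewrite /K; move: (gamma * _ * _) (C1 ^+ 4) g0 C14 => x y; lra.
have c1 : C1 * (tau * (b / h)) <= kappa.
  by apply: le_trans (part C1 C10 C1K); apply: ler_wpM2l.
have C14K : C1 ^+ 4 <= K by rewrite /K; move: (gamma * _ * _) (C1 ^+ 4) g0 C14 => x y; lra.
have DK : D <= K by rewrite /K; move: (gamma * _ * _) (C1 ^+ 4) g0 C14 => x y; lra.
have gK : gamma * C2 * (1 + eps) <= K by rewrite /K; move: (gamma * _ * _) (C1 ^+ 4) g0 C14 => x y; lra.
split=> //.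
(* The cube of the four-thirds Courant number is tau^3 (b/h)^4. *)
- have bh0 : 0 <= b / h by rewrite mulr_ge0// invr_ge0.
  have c3 : Co43 tau h b ^+ 3 = tau ^+ 3 * (b / h) ^+ 4.
    rewrite /Co43 exprMn; congr (_ * _).
    rewrite -[LHS]powR_mulrn ?powR_ge0// -powRrM (_ : 4 / 3 * 3%:R = 4%:R); first exact: powR_mulrn.
    by field.
  have c30 : 0 <= Co43 tau h b by rewrite /Co43 mulr_ge0 ?powR_ge0// ltW.
  have k1 : kappa / K <= 1 by apply: le_trans kK ka1.
  have k0' : 0 <= kappa / K by rewrite divr_ge0// ltW.
  have c31 : Co43 tau h b ^+ 3 <= kappa / K.
    apply: (@le_trans _ _ ((kappa / K) ^+ 3)); first by rewrite lerXn2r.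
    by rewrite exprSr ler_piMl// exprn_ile1.
  have -> : (C1 * (tau * (b / h))) ^+ 4 = (C1 ^+ 4 * Co43 tau h b ^+ 3) * tau.
    by rewrite c3; move: (b / h) => z; ring.
  apply: ler_wpM2r; first exact: ltW.
  by apply: le_trans (part _ C14 C14K); apply: ler_wpM2l.
- have : tau <= D * (kappa / K).
    have -> : tau = h * (tau / h) by field; rewrite gt_eqF.
    by apply: ler_pM => //; exact: ltW.
  by move=> /le_trans; apply; exact: part.
- split.
    apply: le_trans (part _ g0 gK); rewrite -[leRHS]mulrA; apply: ler_wpM2l; first by rewrite mulr_ge0.
    apply: (@le_trans _ _ ((1 + eps) * Co tau h b)); last first.
      by apply: ler_wpM2l => //; rewrite addr_ge0.
    rewrite /Co mulrCA mulrA mulrA; apply: ler_wpM2r; first by rewrite invr_ge0.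
    rewrite [leRHS]mulrA; apply: ler_wpM2r; first exact: ltW.
    by have := mulr_ge0 b0 ep; lra.
- apply: le_trans c1; apply: ler_wpM2l => //; apply: ler_wpM2l; first exact: ltW.
  by rewrite expr2 invfM mulrA; apply: ler_wpM2r; rewrite ?invr_ge0// ler_pdivrMr// ltW.
Qed.

(** Application of the abstract estimate to the discrete forms, in which convection,
    stabilisation and diffusion have the sizes tau b / h, tau (b + eps) / h and
    tau mu / h^2 <= tau b / h. *)
Lemma scheme_stability (p : nat) (sigma q eps gamma : R) (Omega : set 'rV[R]_n.+1) :
  polygonal_domain Omega -> 0 <= eps -> 0 <= gamma ->
  exists2 kappa0 : R, 0 < kappa0 &
  forall (m : mesh R n.+1) (mu : R) (beta : 'rV[R]_n.+1 -> 'rV[R]_n.+1) (tau : R),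
    triangulation Omega m -> shape_regular sigma m -> quasi_uniform q m ->
    0 < mu -> admissible_velocity Omega beta -> 0 < tau ->
    1 < Pe mu (mesh_size m) (sup_norm Omega beta) ->
    Num.max (Co tau (mesh_size m) (sup_norm Omega beta))
            (Co43 tau (mesh_size m) (sup_norm Omega beta)) <= kappa0 ->
  forall (L : nat -> ('rV[R]_n.+1 -> R) -> R) (N : nat) (u : nat -> 'rV[R]_n.+1 -> R),
    (forall n, bounded_linear Omega m p (L n)) ->
    (forall n, (n <= N)%N -> Vh0 Omega m p (u n)) ->
    (forall n, (1 <= n <= N.-1)%N -> forall v, Vh0 Omega m p v ->
       ip Omega (bdf2 tau u n) v
       + conv_form_h Omega m gamma eps beta (extrapolation u n) v
       + diff_form Omega mu (u n.+1) v = L n.+1 v) ->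
  forall b, 8 <= b -> (2 <= N)%N ->
  L2norm Omega (u N) ^+ 2 <=
    (L2norm Omega (u 0%N) ^+ 2 + L2norm Omega (u 1%N) ^+ 2
     + L2norm Omega (u 2%N) ^+ 2
     + 9 * tau * \sum_(1 <= n < N)
         dual_norm Omega m p mu gamma eps beta (L n.+1) ^+ 2)
    * (8 * (1 + b * (N%:R * tau) * expR (b * (N%:R * tau)))).
Proof.
move=> pO eps0 gamma0; have oO := domain_open pO; have mO := open_measurable_rV oO.
have [C1 C10 hC1] := @discrete_form_bounds R n.+1 p sigma q (ltn0Sn n).
have [C2 C20 hC2] := stab_form_estimate p sigma q.
pose D := diam (closure Omega); have D0 : 0 <= D := diam_ge0 _.
have [kappa [ka0 ka1 kaE]] : exists kappa : R, [/\ 0 < kappa, kappa <= 1 & kappa <= 1 / 1000].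
  exists (1 / 1000); split; [|by rewrite ler_pdivrMr ?ltr0n// mul1r ler1n|exact: lexx].
  by apply: divr_gt0; [exact: ltr01|rewrite ltr0n].
exists (kappa / (1 + C1 + C1 ^+ 4 + D + gamma * C2 * (1 + eps))).
  by rewrite divr_gt0// -!addrA ltr_pwDl// !addr_ge0 ?exprn_ge0 ?mulr_ge0// addr_ge0.
move=> m mu beta tau tO sr qu mu0 ab tau0 pe ko L N u hL hu sch b b8 N2.
have bO := domain_bounded tO; have B0 := sup_norm_ge0 bO ab.
have hD := mesh_size_le_diam pO tO; rewrite -/D in hD.
have [h0 k1 k4 tk [gk ak]] := time_step_bounds ka0 ka1 C10 C20 D0 gamma0 eps0 tau0
  (mesh_size_ge0 m) hD B0 mu0 pe ko.
have [cB dB] := hC1 Omega m pO tO sr qu h0; have {}hC2 := hC2 Omega m beta eps pO tO sr qu ab eps0 h0.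
(* The span of the iterates, described by coefficients, so that the forms become
   bilinear without side conditions. *)
pose Phi (l : 'rV[R]_N.+1) : 'rV[R]_n.+1 -> R := fun x => \sum_i l ord0 i * u i x.
pose e (j : nat) : 'rV[R]_N.+1 := delta_mx ord0 (inord j).
have PhiL a l l' : Phi (a *: l + l') = fun x => a * Phi l x + Phi l' x.
  apply/funext => x; rewrite /Phi mulr_sumr -big_split; apply: eq_bigr => i _ /=.
  by rewrite !mxE mulrDl mulrA.
have Phie j : (j <= N)%N -> Phi (e j) = u j.
  move=> jN; apply/funext => x; rewrite /Phi (bigD1 (inord j))//= /e mxE !eqxx mul1r inordK//.
  by rewrite big1 ?addr0// => i /negbTE ij; rewrite mxE eqxx ij mul0r.
have PhiV l : Vh0 Omega m p (Phi l).
  have H (r : seq 'I_N.+1) : Vh0 Omega m p (fun x => \sum_(i <- r) l ord0 i * u i x).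
    elim: r => [|i r IH].
      have := Vh0_lin (-1) oO (hu 0%N isT) (hu 0%N isT).
      by congr Vh0; apply/funext => x; rewrite big_nil; ring.
    under eq_fun do rewrite big_cons.
    by apply: (Vh0_lin _ oO _ IH); apply: hu; rewrite -ltnS ltn_ord.
  exact: H.
pose I l l' := ip Omega (Phi l) (Phi l').
pose C l l' := conv_form Omega beta (Phi l) (Phi l').
pose S l l' := gamma * stab_form m eps beta (Phi l) (Phi l').
pose A l l' := diff_form Omega mu (Phi l) (Phi l').
have hI : semi_inner I.
  split=> [a l l' l''|l l'|l]; first by rewrite /I PhiL; apply: (ip_linl mO); exact: (PhiV _).1.1.1.
    exact: ipC.
  exact: ip_ge0.
have hS : semi_inner S.
  split=> [a l l' l''|l l'|l].
  - rewrite /S PhiL (stab_form_linl pO tO eps ab a (PhiV _).1 (PhiV _).1 (PhiV _).1).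
    by move: (stab_form _ _ _ _ _) (stab_form _ _ _ _ _) => x y; ring.
  - by rewrite /S stab_formC.
  - by rewrite /S mulr_ge0// stab_form_ge0.
have hA : semi_inner A.
  split=> [a l l' l''|l l'|l].
  - by rewrite /A PhiL; apply: diff_form_linl => //; exact: (PhiV _).1.1.
  - exact: diff_formC.
  - by apply: diff_form_ge0; exact: ltW.
have lC : linear_left C.
  move=> a l l' l''; rewrite /C PhiL.
  by apply: (conv_form_linl oO bO ab); [exact: (PhiV _).1.1|exact: (PhiV _).1.1|exact: (PhiV _).1.1.1].
have C0 l : C l l = 0 by exact: (conv_form_diag oO bO ab (PhiV l).2).
have normI l : Num.sqrt (I l l) = L2norm Omega (Phi l) by [].
pose k := C1 * (tau * (sup_norm Omega beta / mesh_size m)).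
have k0 : 0 <= k by rewrite /k !mulr_ge0// ?invr_ge0 ltW.
have hCk x y : `|tau * C x y| <= k * Num.sqrt (I x x) * Num.sqrt (I y y).
  rewrite !normI normrM (gtr0_norm tau0) /k (mulrCA C1) -!(mulrA tau); apply: ler_wpM2l; first exact: ltW.
  by apply: cB => //; exact: (PhiV _).1.
have hSk x : tau * S x x <= kappa * I x x.
  have := hC2 _ (PhiV x).1; rewrite /S -/(I x x).
  move=> /(ler_wpM2l (mulr_ge0 (ltW tau0) gamma0)); rewrite -!(mulrA tau) => /le_trans; apply.
  have := ler_wpM2r (ip_ge0 Omega (Phi x)) gk; rewrite -/(I x x); apply: le_trans.
  by rewrite le_eqVlt; apply/orP; left; apply/eqP; move: (I x x) (_ / _) => i z; ring.
have hAk x : tau * A x x <= kappa * I x x.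
  have := dB mu _ (ltW mu0) (PhiV x).1; rewrite L2norm_sq -/(I x x) -/(A x x).
  move=> /(ler_wpM2l (ltW tau0))/le_trans; apply.
  have := ler_wpM2r (ip_ge0 Omega (Phi x)) ak; rewrite -/(I x x); apply: le_trans.
  by rewrite le_eqVlt; apply/orP; left; apply/eqP; move: (I x x) (_ / _) => i z; ring.
have hLb j x : `|L j (Phi x)| <= dual_norm Omega m p mu gamma eps beta (L j) * Num.sqrt (S x x + A x x + I x x).
  exact: (dual_norm_bound pO tO ab eps0 gamma0 mu0 (hL j) (PhiV x)).
have scheme' j : (j.+2 <= N)%N -> forall v,
  I (3 *: e j.+2 - 4 *: e j.+1 + e j) v +
  2 * tau * (C (2 *: e j.+1 - e j) v + S (2 *: e j.+1 - e j) v + A (e j.+2) v) =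
  2 * tau * L j.+2 (Phi v).
  move=> jN v; have j1 := ltnW jN; have j0 := ltnW j1.
  have jr : (1 <= j.+1 <= N.-1)%N by rewrite /= -ltnS prednK// (leq_trans _ jN).
  have := sch j.+1 jr (Phi v) (PhiV v).
  have -> : bdf2 tau u j.+1 = Phi ((2 * tau)^-1 *: (3 *: e j.+2 - 4 *: e j.+1 + e j)).
    rewrite -[X in Phi X]addr0 PhiL; apply/funext => x.
    have -> : Phi 0 x = 0 by rewrite /Phi big1// => i _; rewrite mxE mul0r.
    rewrite addr0 -addrA PhiL -scaleNr PhiL !Phie// /bdf2 /=.
    by rewrite mulrC; congr (_ * _); ring.
  have -> : extrapolation u j.+1 = Phi (2 *: e j.+1 - e j).
    rewrite PhiL -[- e j]addr0 -scaleN1r PhiL !Phie//; apply/funext => x.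
    have -> : Phi 0 x = 0 by rewrite /Phi big1// => i _; rewrite mxE mul0r.
    by rewrite /extrapolation /=; ring.
  rewrite -(Phie _ jN) /conv_form_h -/(S _ _) -/(C _ _) -/(A _ _) -/(I _ _).
  have [lI _ _] := hI; rewrite (linear_leftZ _ _ _ lI).
  move: (I _ _) (C _ _) (S _ _) (A _ _) => x1 x2 x3 x4 <-.
  by field; rewrite gt_eqF.
have := @abstract_stability R _ I C S A tau k kappa (fun j l => L j (Phi l)) _ e N hI hS hA lC C0 tau0 k0
  kaE hCk k1 k4 tk hSk hAk hLb scheme' b b8.
rewrite /I !Phie// ?(leq_trans _ N2)// !L2norm_sq; exact.
Qed.

End scheme.

Theorem theorem3p5 (R : realType) (d : nat) (hd : (1 <= d <= 3)%N)
    (Omega : set 'rV[R]_d) (hOmega : polygonal_domain Omega)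
    (eps_perp : R) (heps : 0 <= eps_perp)
    (sigma q : R) (p : nat) (hp : (1 <= p)%N) (gamma : R) (hgamma : 0 <= gamma) :
  exists2 kappa0 : R, 0 < kappa0 &
  forall (m : mesh R d) (mu : R) (beta : 'rV[R]_d -> 'rV[R]_d) (tau : R),
    triangulation Omega m -> shape_regular sigma m -> quasi_uniform q m ->
    0 < mu -> admissible_velocity Omega beta -> 0 < tau ->
    1 < Pe mu (mesh_size m) (sup_norm Omega beta) ->
    Num.max (Co tau (mesh_size m) (sup_norm Omega beta))
            (Co43 tau (mesh_size m) (sup_norm Omega beta)) <= kappa0 ->
  forall (L : nat -> ('rV[R]_d -> R) -> R) (N : nat) (u : nat -> 'rV[R]_d -> R),
    (forall n, bounded_linear Omega m p (L n)) ->
    (forall n, (n <= N)%N -> Vh0 Omega m p (u n)) ->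
    (forall n, (1 <= n <= N.-1)%N -> forall v, Vh0 Omega m p v ->
       ip Omega (bdf2 tau u n) v
       + conv_form_h Omega m gamma eps_perp beta (extrapolation u n) v
       + diff_form Omega mu (u n.+1) v = L n.+1 v) ->
  L2norm Omega (u N) ^+ 2 <=
    (L2norm Omega (u 0%N) ^+ 2 + L2norm Omega (u 1%N) ^+ 2
     + L2norm Omega (u 2%N) ^+ 2
     + 9 * tau * \sum_(1 <= n < N)
         dual_norm Omega m p mu gamma eps_perp beta (L n.+1) ^+ 2)
    * stability_factor (cL (Vh0 Omega m p) L) (N%:R * tau).

Proof.
case: d hd Omega hOmega => [//|n] _ Omega pO.
have [kappa0 k0 h] := scheme_stability p sigma q pO heps hgamma.
exists kappa0 => // m mu beta tau tO sr qu mu0 ab tau0 pe ko L N u hL hu sch.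
have c0 : 0 <= cL (Vh0 Omega m p) L by rewrite /cL; case: ifP.
have T0 : 0 <= N%:R * tau by rewrite mulr_ge0// ltW.
rewrite /stability_factor; set c := _ / 4 + 8.
have c8 : 8 <= c by rewrite /c lerDr divr_ge0.
(* For N < 2 the last iterate is one of the data on the right. *)
have [N2|N2] := leqP 2 N.
  exact: (h m mu beta tau tO sr qu mu0 ab tau0 pe ko L N u hL hu sch c c8 N2).
have c1 : 0 <= c by apply: le_trans c8; exact: ler0n.
set f := 8 * _.
have f1 : 1 <= f.
  have : 0 <= c * (N%:R * tau) * expR (c * (N%:R * tau)) by exact: (mulr_ge0 (mulr_ge0 c1 T0) (expR_ge0 _)).
  by rewrite /f; move: (_ * expR _) => x x0; lra.
pose a i := L2norm Omega (u i) ^+ 2; have a0 i : 0 <= a i by exact: sqr_ge0.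
have aN : a N <= a 0 + a 1 + a 2.
  have := a0 0; have := a0 1; have := a0 2; move: N2; rewrite -!/(a _).
  by case: (N) => [|[|//]] _; lra.
rewrite -!/(a _); set z := 9 * tau * _.
have z0 : 0 <= z.
  by rewrite /z mulr_ge0//; [rewrite mulr_ge0// ltW|apply: sumr_ge0 => i _; exact: sqr_ge0].
apply: (@le_trans _ _ (a 0 + a 1 + a 2 + z)); first by move: aN z0; lra.
by rewrite ler_peMr// !addr_ge0.
Qed.
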